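(* Let $\lambda\in C^1([0,+\infty);(0,+\infty))$, let $T>0$, let $\rho_0\in L^2(0,1)$ be nonnegative almost everywhere, and let $y_d\in L^2(0,T)$. Set $L^2_{+}(0,T):=\{u\in L^2(0,T): u \text{ is nonnegative almost everywhere}\}$ and, for $u\in L^2_+(0,T)$, $$J(u):=\int_0^T|u(t)|^2\,dt+\int_0^T|y(t)-y_d(t)|^2\,dt,$$ where $y(t):=\rho(t,1)\lambda(W(t))$ is the out-flux corresponding to the in-flux $u$ and the initial data $\rho_0$, as defined in the context. Then the infimum of the functional $J$ in $L^2_{+}(0,T)$ is achieved, i.e., there exists $u_{\infty}\in L^2_{+}(0,T)$ such that $$J(u_{\infty})=\inf_{u\in L^2_{+}(0,T)}J(u).$$
   Context: The function $\lambda\in C^1([0,+\infty);(0,+\infty))$ is extended to all of $\mathbb{R}$ in such a way that the extension, still denoted $\lambda$, lies in $C^1(\mathbb{R};(0,+\infty))$. For $u\in L^2_+(0,T)$, $\rho$ denotes the weak solution of the Cauchy problem $$\partial_t\rho(t,x)+\partial_x\big(\lambda(W(t))\,\rho(t,x)\big)=0,\qquad W(t)=\int_0^1\rho(t,x)\,dx,\qquad (t,x)\in[0,T]\times[0,1],$$ $$\rho(0,x)=\rho_0(x)\ \ (0\le x\le 1),\qquad \rho(t,0)\,\lambda(W(t))=u(t)\ \ (0\le t\le T).$$ Weak solution means: a function $\rho\in C^0([0,T];L^1(0,1))$ such that, for every $\tau\in[0,T]$ and every $\varphi\in C^1([0,\tau]\times[0,1])$ satisfying $\varphi(\tau,x)=0$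 for all $x\in[0,1]$ and $\varphi(t,1)=0$ for all $t\in[0,\tau]$, one has $$\int_0^{\tau}\int_0^1\rho(t,x)\big(\varphi_t(t,x)+\lambda(W(t))\varphi_x(t,x)\big)\,dx\,dt+\int_0^{\tau}u(t)\varphi(t,0)\,dt+\int_0^1\rho_0(x)\varphi(0,x)\,dx=0.$$ For nonnegative $\rho_0\in L^2(0,1)$ and $u\in L^2_+(0,T)$ this Cauchy problem admits a unique weak solution, and it belongs to $C^0([0,T];L^2(0,1))\cap C^0([0,1];L^2(0,T))$, where the second space refers to the map $x\mapsto\rho(\cdot,x)$. In particular $\rho(\cdot,1)\in L^2(0,T)$ is well defined as the value of this continuous map at $x=1$, and the out-flux $y(t)=\rho(t,1)\lambda(W(t))$ is a well-defined element of $L^2(0,T)$. *)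

(* Defs.v *)
(* All measurability is Borel measurability, and all integrals are
   taken with respect to the Lebesgue measure on R. *)
From HB Require Import structures.
From mathcomp Require Import all_boot all_order all_algebra.
From mathcomp Require Import all_classical all_reals all_analysis.

Set Implicit Arguments.
Unset Strict Implicit.
Unset Printing Implicit Defensive.

Import Order.TTheory GRing.Theory Num.Theory.
Import numFieldNormedType.Exports.

Local Open Scope classical_set_scope.
Local Open Scope ring_scope.

Section Defs.
Context {R : realType}.
Local Notation mu := (@lebesgue_measure R).

(* Elements of Lebesgue spaces are represented by functions R -> R, of which
   only the restriction to the relevant interval matters.  Intervals are
   closed: L^p(a, b) and L^p([a, b]) are the same space. *)

Definition in_Lp (p : \bar R) (D : set R) (f : R -> R) : Prop :=
  f \_ D \in Lfun mu p.

Definition ae_nonneg (D : set R) (f : R -> R) : Prop :=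
  {ae mu, forall x, D x -> 0 <= f x}.

Definition L2plus (T : R) : set (R -> R) :=
  [set u | in_Lp 2%:E `[0, T] u /\ ae_nonneg `[0, T] u].

(* s |-> g s belongs to C^0(A; L^p(D)). *)
Definition C0_Lp (p : \bar R) (A D : set R) (g : R -> R -> R) : Prop :=
  (forall s, A s -> in_Lp p D (g s)) /\
  (forall s0, A s0 ->
     'N[mu]_p[EFin \o ((fun x => g s x - g s0 x)%R \_ D)]%E
       @[s --> within A (nbhs s0)] --> 0%E).

(* C^1 up to the boundary, for D an interval with nonempty interior: f is C^1
   in the interior of D, and f and its derivative extend continuously to D. *)
Definition C1_on (D : set R) (f : R -> R) : Prop :=
  exists df : R -> R,
    [/\ {within D, continuous f}, {within D, continuous df} &
        forall x, D° x -> is_derive x 1 f (df x)].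

(* phi is C^1 up to the boundary on [0, tau] x [0, 1], with partial
   derivatives phi_t and phi_x. *)
Definition C1_rect (tau : R) (phi phi_t phi_x : R -> R -> R) : Prop :=
  let Q := `[0, tau] `*` `[0, 1] in
  [/\ {within Q, continuous (fun z : R * R => phi z.1 z.2)},
      {within Q, continuous (fun z : R * R => phi_t z.1 z.2)},
      {within Q, continuous (fun z : R * R => phi_x z.1 z.2)} &
      forall t x : R, 0 < t < tau -> 0 < x < 1 ->
        is_derive t 1 (fun s => phi s x) (phi_t t x) /\
        is_derive x 1 (fun z => phi t z) (phi_x t x)].

Definition W (rho : R -> R -> R) (t : R) : R :=
  \int[mu]_(x in `[0, 1]) rho t x.

(* An element of C^0([0,T]; L^1(0,1)) is represented by a jointly measurable
   function of (t, x): such a representative always exists, and joint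
   measurability is what gives the sections x |-> rho(., x) a meaning
   independent of the choice of a representative of rho(t, .) for each t. *)
Definition is_weak_solution (lam : R -> R) (T : R) (rho0 u : R -> R)
    (rho : R -> R -> R) : Prop :=
  [/\ measurable_fun
       (`[0, T] `*` `[0, 1] : set (measurableTypeR R * measurableTypeR R))
       (fun z => rho z.1 z.2),
      C0_Lp 1%:E `[0, T] `[0, 1] rho &
      forall tau : R, 0 <= tau <= T ->
      forall phi phi_t phi_x : R -> R -> R, C1_rect tau phi phi_t phi_x ->
        (forall x, 0 <= x <= 1 -> phi tau x = 0) ->
        (forall t, 0 <= t <= tau -> phi t 1 = 0) ->
        \int[mu]_(t in `[0, tau]) (\int[mu]_(x in `[0, 1])
           (rho t x * (phi_t t x + lam (W rho t) * phi_x t x)))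
        + \int[mu]_(t in `[0, tau]) (u t * phi t 0)
        + \int[mu]_(x in `[0, 1]) (rho0 x * phi 0 x) = 0].

(* The representative of the weak solution is required to make
   x |-> rho(., x) an element of C^0([0,1]; L^2(0,T)).  By continuity this
   determines rho(., 1) as an element of L^2(0,T), even though {x = 1} is
   negligible. *)
Definition has_sections (T : R) (rho : R -> R -> R) : Prop :=
  C0_Lp 2%:E `[0, 1] `[0, T] (fun x t => rho t x).

(* "The" weak solution, unique up to a choice of representative; the value 0
   would only be used if no solution existed. *)
Definition weak_solution (lam : R -> R) (T : R) (rho0 u : R -> R) :
    R -> R -> R :=
  xget (fun _ _ => 0)
    [set rho | is_weak_solution lam T rho0 u rho /\ has_sections T rho].

Definition outflux (lam : R -> R) (T : R) (rho0 u : R -> R) (t : R) : R :=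
  let rho := weak_solution lam T rho0 u in rho t 1 * lam (W rho t).

Definition J (lam : R -> R) (T : R) (rho0 yd u : R -> R) : \bar R :=
  (\int[mu]_(t in `[0%R, T]) (`|u t| ^+ 2)%R%:E
   + \int[mu]_(t in `[0%R, T]) (`|outflux lam T rho0 u t - yd t| ^+ 2)%R%:E)%E.

End Defs.

(* Main.v *)
Require Import Defs.
From HB Require Import structures.
From mathcomp Require Import all_boot all_order all_algebra.
From mathcomp Require Import all_classical all_reals all_analysis.
From mathcomp Require Import measurable_realfun.
From mathcomp Require Import ring lra.

(** The functional is coercive and, as a function of the in-flux and of the
    out-flux, lower semicontinuous for the weak topology of L^2.  What has to
    be shown is that the out-flux depends on the in-flux continuously for weak
    convergence, although the equation is nonlinear and nonlocal.

    Attach to each particle a label [r]: its time of entrance if [r > 0], minus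
    its initial position if [r <= 0].  The data form a single function [v] of
    the label ([vin]), equal to [u r] for [0 < r <= T] and to [rho0 (- r)] for
    [-1 <= r <= 0].  Let [xi] be the distance covered by the particles: its
    derivative is the speed [lambda (W t)] for [t > 0], and [xi t = t] for
    [t <= 0].  The particles present in [[0, 1]] at time [t] are those with
    label between [back xi t], which is [xi^-1 (xi t - 1)], and [t].  Hence
    [W t = prim v t - prim v (back xi t)], where [prim v] is the primitive of
    [v], and the mass that has left up to time [t] is [prim v t - W t].  Both
    formulas hold for every weak solution ([sol_mass], [sol_flux]); they are
    obtained by testing the equation with functions that are constant along
    the characteristics, or whose derivatives concentrate at [x = 1].  So [xi]
    solves a fixed point equation in which the data occur only through
    [prim v].

    This equation is a contraction for the norm [sup_t exp (- k t) |xi t|] when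
    [k] is large ([mass_contraction]).  For [v] in L^2 the mass is not a
    Lipschitz function of [xi] at a fixed time, but its integral in time is,
    once the integrals over times and over labels are exchanged.  The
    contraction yields a characteristic, hence by transport along it a weak
    solution ([characteristic_exists], [weak_solution_exists]), and shows that
    the mass depends continuously on [prim v] for the uniform norm
    ([characteristic_mass_stable]).  So does the primitive of the out-flux.

    It remains to apply the direct method ([optimum_exists]).  The primitives
    of a sequence that is bounded in L^2 are uniformly 1/2-Hoelder, so they
    converge uniformly along an ultrafilter ([ultra_equicontinuous_cvg]), and
    the limit is the primitive of a function whose norm is at most the limit
    of the norms ([weak_limit]).  Applied to a minimizing sequence, this gives
    the optimal in-flux.  It also applies to the deviations of the out-fluxes
    from [yd], whose primitives converge, by the continuous dependence, to that
    of the deviation of the optimal out-flux; and a function is determined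
    almost everywhere by its primitive ([prim_inj]). *)

Set Implicit Arguments.
Unset Strict Implicit.
Unset Printing Implicit Defensive.
Import Order.TTheory GRing.Theory Num.Theory.
Import numFieldNormedType.Exports.
Local Open Scope classical_set_scope.
Local Open Scope ring_scope.

(** * Real-valued integrals on the line *)

Section Toolkit.
Context {R : realType}.
Local Notation mu := (@lebesgue_measure R).
Implicit Types f g : R -> R.

Definition L1 f := mu.-integrable setT (EFin \o f).

Lemma L1_measurable f : L1 f -> measurable_fun setT f.
Proof. by move=> /measurable_int/measurable_EFinP. Qed.

Lemma L1_dominated f g : measurable_fun setT f -> L1 g ->
  (forall x, `|f x| <= g x) -> L1 f.
Proof.
move=> mf Lg fg; apply: (le_integrable measurableT _ _ Lg) => //.
  exact/measurable_EFinP.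
by move=> x _ /=; rewrite lee_fin (le_trans (fg x))// ler_norm.
Qed.

Lemma L1D f g : L1 f -> L1 g -> L1 (fun x => f x + g x).
Proof. exact: integrableD. Qed.

Lemma L1Z k f : L1 f -> L1 (fun x => k * f x).
Proof. exact: integrableZl. Qed.

Lemma L1N f : L1 f -> L1 (fun x => - f x).
Proof. by move=> /(L1Z (-1)); under eq_fun do rewrite mulN1r. Qed.

Lemma L1B f g : L1 f -> L1 g -> L1 (fun x => f x - g x).
Proof. by move=> Lf /L1N; exact: L1D. Qed.

Lemma L1_norm f : L1 f -> L1 (fun x => `|f x|).
Proof. exact: integrable_norm. Qed.

Lemma L1_0 : L1 (fun=> 0).
Proof. exact: integrable0. Qed.

Lemma Int_EFin (D : set R) f : measurable D -> mu.-integrable D (EFin \o f) ->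
  (\int[mu]_(x in D) (f x)%:E = (\int[mu]_(x in D) f x)%:E)%E.
Proof.
by move=> mD If; rewrite /Rintegral fineK //; exact: (@integrable_fin_num _ _ _ mu D mD _ If).
Qed.

Lemma Int0 : \int[mu]_x (0 : R) = 0.
Proof. by rewrite Rintegral_cst// mul0r. Qed.

Lemma L1_itv (C a b : R) : L1 (fun x => C * \1_`[a, b] x).
Proof. exact/L1Z/integrable_indic_itv. Qed.

Lemma Int_itv (C a b : R) : a <= b ->
  \int[mu]_x (C * \1_`[a, b] x) = C * (b - a).
Proof.
move=> ab; rewrite RintegralZl//; last exact: integrable_indic_itv.
congr (_ * _); rewrite /Rintegral integral_indic// setIT.
transitivity (fine (mu `[a, b])) => //.
rewrite lebesgue_measure_itv/= lte_fin.
by move: ab; rewrite le_eqVlt => /predU1P[->|->//]; rewrite ltxx subrr.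
Qed.

Lemma aeS (P Q : R -> Prop) : (forall x, P x -> Q x) ->
  {ae mu, forall x, P x} -> {ae mu, forall x, Q x}.
Proof. by move=> PQ; apply: filterS => //; exact: (ae_filter_ringOfSetsType mu). Qed.

Lemma ae_and (P Q : R -> Prop) : {ae mu, forall x, P x} ->
  {ae mu, forall x, Q x} -> {ae mu, forall x, P x /\ Q x}.
Proof. by apply: filterS2 => //; exact: (ae_filter_ringOfSetsType mu). Qed.

Lemma Int_ae_eq f g : measurable_fun setT f -> measurable_fun setT g ->
  {ae mu, forall x, f x = g x} -> \int[mu]_x f x = \int[mu]_x g x.
Proof.
move=> mf mg fg; congr fine; apply: ae_eq_integral => //; try exact/measurable_EFinP.
by apply: aeS fg => x ->.
Qed.

Lemma L1_ae_eq f g : measurable_fun setT g ->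
  {ae mu, forall x, f x = g x} -> L1 f -> L1 g.
Proof.
move=> mg fg Lf; apply/integrableP; split; first exact/measurable_EFinP.
have /integrableP[mf] := Lf; apply: le_lt_trans.
rewrite le_eqVlt; apply/orP; left; apply/eqP; apply: ae_eq_integral => //.
- by apply: measurableT_comp => //; exact/measurable_EFinP.
- exact: measurableT_comp.
- by apply: aeS fg => x /= ->.
Qed.

(** Dominated convergence with convergence everywhere, so that the
    measurability of the limit is part of the conclusion. *)
Lemma Int_cvg (f_ : nat -> R -> R) f g :
  (forall n, measurable_fun setT (f_ n)) ->
  (forall x, f_ n x @[n --> \oo] --> f x) -> L1 g ->
  (forall n x, `|f_ n x| <= g x) ->
  L1 f /\ \int[mu]_x f_ n x @[n --> \oo] --> \int[mu]_x f x.
Proof.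
move=> mf ff Lg fg.
have mf0 : measurable_fun setT f.
  by apply: (measurable_fun_cvg mf) => x _; exact: ff.
have [||||Lf _ cf] := @dominated_convergence _ _ _ mu setT measurableT
  (fun n => EFin \o f_ n) (EFin \o f) (EFin \o g) _ _ _ Lg.
- by move=> n; apply/measurable_EFinP; exact: mf.
- exact/measurable_EFinP.
- by apply: aeW => x _; apply: cvg_EFin; [exact: nearW|exact: ff].
- by apply: aeW => x n _; rewrite lee_fin.
split=> //; apply: fine_cvg.
rewrite fineK//; exact: (integrable_fin_num measurableT Lf).
Qed.

Lemma Int_cvg_ae (f_ : nat -> R -> R) f g :
  (forall n, measurable_fun setT (f_ n)) -> measurable_fun setT f ->
  {ae mu, forall x, f_ n x @[n --> \oo] --> f x} -> L1 g ->
  (forall n x, `|f_ n x| <= g x) ->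
  \int[mu]_x f_ n x @[n --> \oo] --> \int[mu]_x f x.
Proof.
move=> mf mf0 ff Lg fg.
have [||||Lf _ cf] := @dominated_convergence _ _ _ mu setT measurableT
  (fun n => EFin \o f_ n) (EFin \o f) (EFin \o g) _ _ _ Lg.
- by move=> n; apply/measurable_EFinP; exact: mf.
- exact/measurable_EFinP.
- by apply: aeS ff => x fx _; apply: cvg_EFin; [exact: nearW|exact: fx].
- by apply: aeW => x n _; rewrite lee_fin.
apply: fine_cvg.
rewrite fineK//; exact: (integrable_fin_num measurableT Lf).
Qed.

(** The bound [g] makes [F] integrable on the plane. The sections [F (., y)]
    are then integrable for almost every [y] only, which is enough, since
    the value of the inner integral at the other [y] does not affect the
    outer one. *)
Lemma Int_fubini (F : R * R -> R) g :
  measurable_fun setT F -> (forall x, L1 (fun y => F (x, y))) -> L1 g ->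
  (forall x, \int[mu]_y `|F (x, y)| <= g x) ->
  [/\ L1 (fun x => \int[mu]_y F (x, y)), L1 (fun y => \int[mu]_x F (x, y)) &
  \int[mu]_x \int[mu]_y F (x, y) = \int[mu]_y \int[mu]_x F (x, y)].
Proof.
move=> mF LF Lg Fg.
have mF' : measurable_fun setT (EFin \o F) by exact/measurable_EFinP.
have iF : (mu \x mu)%E.-integrable setT (EFin \o F).
  apply/integrable12ltyP => //=.
  have Lg' := integrable_fin_num measurableT (L1_norm Lg).
  apply: (@le_lt_trans _ _ (\int[mu]_x (`|g x|%:E))%E); last first.
    by rewrite -ge0_fin_numE//; exact: integral_ge0.
  apply: ge0_le_integral => //.
  - by move=> x _; apply: integral_ge0.
  - have := @measurable_fun_fubini_tonelli_F _ _ _ _ _ mu (abse \o (EFin \o F)).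
    by apply; [exact: measurableT_comp|move=> ? /=].
  - exact: (measurable_int _ (L1_norm Lg)).
  move=> x _; rewrite -(fineK (_ : (\int[mu]_y _)%E \is a fin_num)); last first.
    exact: (integrable_fin_num measurableT (L1_norm (LF x))).
  by rewrite lee_fin (le_trans (Fg x))// ler_norm.
have iF2 : (mu \x mu)%E.-integrable setT (fun p => (F (p.2, p.1))%:E).
  apply/integrable12ltyP => //=; last exact/(integrable21ltyP mu mu mF').
  exact: (@measurableT_comp _ _ _ _ _ _ _ _ (fun p => (p.2, p.1)) mF'
    (@measurable_swap _ _ R R)).
have := @Fubini _ _ _ _ _ mu mu (EFin \o F) iF.
have E1 : (\int[mu]_x \int[mu]_y (EFin \o F) (x, y) =
    \int[mu]_x (\int[mu]_y F (x, y))%:E)%E.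
  apply: eq_integral => x _; rewrite fineK//.
  exact: (integrable_fin_num measurableT (LF x)).
have L1a : L1 (fun x => \int[mu]_y F (x, y)).
  apply: eq_integrable (integrable_fubini_F iF) => // x _ /=.
  by rewrite /fubini_F fineK//; exact: (integrable_fin_num measurableT (LF x)).
have ae2 : {ae mu, forall y, fubini_G mu (EFin \o F) y =
    (\int[mu]_x F (x, y))%:E}.
  apply: aeS (ae_integrable2 iF) => y iy /=.
  by rewrite /fubini_G fineK//; exact: (integrable_fin_num measurableT iy).
have iG : mu.-integrable setT (fubini_G mu (EFin \o F)).
  exact: (integrable_fubini_F iF2).
have m2 : measurable_fun setT (fun y => \int[mu]_x F (x, y)).
  have mG := measurable_int _ iG.
  exact: (measurableT_comp (fine_measurable measurableT) mG).
have L1b : L1 (fun y => \int[mu]_x F (x, y)).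
  apply/integrableP; split; first exact/measurable_EFinP.
  have /integrableP[mG] := iG; apply: le_lt_trans.
  rewrite le_eqVlt; apply/orP; left; apply/eqP; apply: ae_eq_integral => //.
  - by apply: measurableT_comp => //; exact/measurable_EFinP.
  - exact: measurableT_comp.
  - by apply: aeS ae2 => x /= ->.
move=> E; split; [exact: L1a|exact: L1b|congr fine].
rewrite -E1 E; apply: ae_eq_integral.
- exact: measurableT.
- exact: (measurable_int _ iG).
- exact/measurable_EFinP.
- by apply: aeS ae2 => x + _; exact.
Qed.

Lemma L1M_bounded f g C : L1 f -> measurable_fun setT g ->
  (forall x, `|g x| <= C) -> L1 (fun x => f x * g x).
Proof.
move=> Lf mg gC; apply: (@L1_dominated _ (fun x => C * `|f x|)).
- by apply: measurable_funM => //; exact: L1_measurable.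
- exact/L1Z/L1_norm.
- by move=> x; rewrite normrM mulrC ler_wpM2r.
Qed.

Lemma Int_le f g : L1 f -> L1 g -> (forall x, f x <= g x) ->
  \int[mu]_x f x <= \int[mu]_x g x.
Proof. by move=> Lf Lg fg; apply: le_Rintegral. Qed.

Lemma Int_ge0 f : (forall x, 0 <= f x) -> 0 <= \int[mu]_x f x.
Proof. by move=> f0; apply: Rintegral_ge0. Qed.

Lemma Int_fubini_prod (F : R * R -> R) f g :
  measurable_fun setT F -> L1 f -> L1 g ->
  (forall x, 0 <= f x) -> (forall y, 0 <= g y) ->
  (forall x y, `|F (x, y)| <= f x * g y) ->
  [/\ forall x, L1 (fun y => F (x, y)), forall y, L1 (fun x => F (x, y)),
   L1 (fun x => \int[mu]_y F (x, y)), L1 (fun y => \int[mu]_x F (x, y)) &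
  \int[mu]_x \int[mu]_y F (x, y) = \int[mu]_y \int[mu]_x F (x, y)].
Proof.
move=> mF Lf Lg f0 g0 Ffg.
have LF1 x : L1 (fun y => F (x, y)).
  apply: (@L1_dominated _ (fun y => f x * g y)) => //; last exact: L1Z.
  by apply: (measurableT_comp mF) => //; apply: measurable_fun_pair.
have LF2 y : L1 (fun x => F (x, y)).
  apply: (@L1_dominated _ (fun x => g y * f x)) => //; last 2 first.
  - exact: L1Z.
  - by move=> x; rewrite mulrC.
  by apply: (measurableT_comp mF) => //; apply: measurable_fun_pair.
have [] := @Int_fubini F (fun x => (\int[mu]_y g y) * f x) mF LF1.
- exact: L1Z.
- move=> x; rewrite mulrC -RintegralZl//; apply: Int_le => //.
    exact/L1_norm.
  exact: L1Z.
by move=> *; split.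
Qed.

Definition L2 f := measurable_fun setT f /\ L1 (fun x => f x ^+ 2).

Lemma L2M f g : L2 f -> L2 g -> L1 (fun x => f x * g x).
Proof.
move=> [mf Lf] [mg Lg].
apply: (@L1_dominated _ (fun x => f x ^+ 2 + g x ^+ 2)).
- exact: measurable_funM.
- exact: L1D.
- move=> x; rewrite normrM -(real_normK (num_real (f x))).
  rewrite -(real_normK (num_real (g x))).
  have := sqr_ge0 (`|f x| - `|g x|).
  have := normr_ge0 (f x); have := normr_ge0 (g x).
  nra.
Qed.

Lemma L2D f g : L2 f -> L2 g -> L2 (fun x => f x + g x).
Proof.
move=> Lf Lg; split; first by apply: measurable_funD; [case: Lf|case: Lg].
have -> : (fun x => (f x + g x) ^+ 2) =
  (fun x => f x ^+ 2 + (2 * (f x * g x) + g x ^+ 2)).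
  by apply/funext => x; ring.
by apply: L1D; [case: Lf|apply: L1D; [apply/L1Z/L2M|case: Lg]].
Qed.

Lemma L2Z k f : L2 f -> L2 (fun x => k * f x).
Proof.
move=> [mf Lf]; split; first exact: measurable_funM.
by under eq_fun do rewrite exprMn; exact: L1Z.
Qed.

Lemma L2B f g : L2 f -> L2 g -> L2 (fun x => f x - g x).
Proof.
move=> Lf /(L2Z (-1)) Lg; have := L2D Lf Lg.
by under eq_fun do rewrite mulN1r.
Qed.

Lemma Int_sqrD f g k : L2 f -> L2 g ->
  \int[mu]_x (f x + k * g x) ^+ 2 = \int[mu]_x f x ^+ 2 +
    2 * k * \int[mu]_x (f x * g x) + k ^+ 2 * \int[mu]_x g x ^+ 2.
Proof.
move=> Lf Lg; have [_ Lf2] := Lf; have [_ Lg2] := Lg; have Lfg := L2M Lf Lg.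
rewrite -!RintegralZl// -RintegralD//; last exact: L1Z.
rewrite -RintegralD//; last exact: L1Z.
  by apply: eq_Rintegral => x _; ring.
by apply: L1D => //; exact: L1Z.
Qed.

(** The polynomial [k |-> \int (f + k g)^2] is nonnegative, so its
    discriminant is nonpositive. *)
Lemma cauchy_schwarz f g : L2 f -> L2 g ->
  (\int[mu]_x (f x * g x)) ^+ 2 <= (\int[mu]_x f x ^+ 2) * \int[mu]_x g x ^+ 2.
Proof.
move=> Lf Lg; set B := \int[mu]_x (f x * g x).
set A := \int[mu]_x f x ^+ 2; set C := \int[mu]_x g x ^+ 2.
have P k : 0 <= A + 2 * k * B + k ^+ 2 * C.
  by rewrite -Int_sqrD//; apply: Int_ge0 => x; exact: sqr_ge0.
have C0 : 0 <= C by apply: Int_ge0 => x; exact: sqr_ge0.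
(* in the degenerate case the polynomial is affine, and takes the value -1
   unless B = 0 *)
have [C1|C1] := eqVneq C 0.
  have [->|B0] := eqVneq B 0; first by rewrite C1; nra.
  have := P (- (A + 1) / (2 * B)); rewrite C1.
  have -> : 2 * (- (A + 1) / (2 * B)) * B = - (A + 1) by field.
  by move=> ?; exfalso; lra.
(* the minimum of the polynomial *)
have := P (- B / C).
have -> : A + 2 * (- B / C) * B + (- B / C) ^+ 2 * C = (A * C - B ^+ 2) / C by field.
by rewrite pmulr_lge0 ?invr_gt0 ?lt_def ?C1// subr_ge0.
Qed.

End Toolkit.

(** * Change of variables *)

Section Density.
Context {R : realType}.
Local Notation mu := (@lebesgue_measure R).
Variables (c : R -> R) (mc : measurable_fun setT c) (c0 : forall x, 0 <= c x).

Definition density_measure (A : set (measurableTypeR R)) : \bar R :=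
  (\int[mu]_(x in A) (c x)%:E)%E.

Let density0 : density_measure set0 = 0%E.
Proof. by rewrite /density_measure integral_set0. Qed.

Let density_ge0 A : (0 <= density_measure A)%E.
Proof. by apply: integral_ge0 => x _; rewrite lee_fin. Qed.

Let mcE D : measurable_fun D (EFin \o c).
Proof. by apply: measurable_funTS; exact/measurable_EFinP. Qed.

Let density_sigma_additive : semi_sigma_additive density_measure.
Proof.
move=> /= F mF tF mUF; rewrite /density_measure; apply: cvg_toP.
  apply: ereal_nondecreasing_is_cvgn => m n mn.
  apply: lee_sum_nneg_natr => // k _ _; apply: integral_ge0 => /= x Fkx.
  by rewrite lee_fin.
rewrite ge0_integral_bigcup//=; first exact: mcE.
by move=> x _; rewrite lee_fin.
Qed.

HB.instance Definition _ := isMeasure.Build _ _ _ density_measure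
  density0 density_ge0 density_sigma_additive.

Import HBNNSimple.

(** Simple functions first, then monotone convergence. *)
Lemma ge0_integral_density (f : R -> R) :
  measurable_fun setT f -> (forall x, 0 <= f x) ->
  (\int[density_measure]_x (f x)%:E = \int[mu]_x (f x * c x)%:E)%E.
Proof.
move=> mf f0.
have mf' : measurable_fun [set: measurableTypeR R] (EFin \o f).
  exact/measurable_EFinP.
pose f_ := nnsfun_approx measurableT mf'.
have f0' y : [set: measurableTypeR R] y -> (0 <= (EFin \o f) y)%E.
  by rewrite lee_fin.
have S n : (\int[density_measure]_x (f_ n x)%:E = \int[mu]_x (f_ n x * c x)%:E)%E.
  have mn k : measurable (f_ n @^-1` [set k]) by [].
  under eq_integral do rewrite fimfunE -fsumEFin//.
  rewrite ge0_integral_fsum//; last 2 first.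
  - by move=> y; exact/measurable_EFinP/measurable_funM.
  - by move=> y x _; rewrite nnfun_muleindic_ge0.
  transitivity (\sum_(k \in range (f_ n))
    \int[mu]_x (k * \1_(f_ n @^-1` [set k]) x * c x)%:E)%E.
    apply: eq_fsbigr => r rf.
    have r0 : 0 <= r by move: rf; rewrite inE => -[y _ <-].
    rewrite integralZl_indic_nnsfun// integral_indic//= setIT.
    rewrite /density_measure integral_mkcond -ge0_integralZl//; last 2 first.
    - by apply/(measurable_restrictT (EFin \o c) (mn r)); exact: mcE.
    - by move=> x _; rewrite patchE; case: ifP; rewrite ?lee_fin.
    apply: eq_integral => x _; rewrite patchE indicE.
    by case: ifP => _; rewrite /= -?EFinM ?mulr1 ?mulr0 ?mul0r ?mule0.
  rewrite -ge0_integral_fsum//.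
  - apply: eq_integral => x _; rewrite fsumEFin//; congr EFin.
    by rewrite [in RHS]fimfunE !fsbig_finite// mulr_suml.
  - move=> r; apply/measurable_EFinP; apply: measurable_funM => //.
    exact: measurable_funM.
  - move=> r x _; rewrite EFinM mule_ge0 ?lee_fin//.
    by rewrite -lee_fin nnfun_muleindic_ge0.
transitivity (limn (fun n => \int[density_measure]_x (f_ n x)%:E))%E.
  rewrite -monotone_convergence//.
  - by apply: eq_integral => y _; apply/esym/cvg_lim => //; apply: cvg_nnsfun_approx.
  - by move=> n; exact/measurable_EFinP.
  - by move=> n y _; rewrite lee_fin.
  - by move=> y _ m n mn; rewrite lee_fin; exact/lefP/nd_nnsfun_approx.
under eq_fun do rewrite S.
rewrite -monotone_convergence//.
- apply: eq_integral => x _; apply/cvg_lim => //; rewrite EFinM.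
  under eq_fun do rewrite EFinM.
  by apply: cvgeZr => //; apply: cvg_nnsfun_approx.
- by move=> n; apply/measurable_EFinP/measurable_funM.
- by move=> n y _; rewrite lee_fin mulr_ge0.
- move=> y _ m n mn; rewrite lee_fin ler_wpM2r//.
  exact/lefP/nd_nnsfun_approx.
Qed.

Variables (phi : R -> R) (mphi : measurable_fun setT phi).
Hypothesis phiE : forall a b, a <= b ->
  (\int[mu]_(x in phi @^-1` `]a, b]) (c x)%:E = (b - a)%:E)%E.

(** By [phiE] the image under [phi] of the measure with density [c] gives
    every interval its length, so it is the Lebesgue measure. This form
    suits the characteristics, whose derivative jumps at time 0. *)
Lemma ge0_integral_cov (g : R -> R) :
  measurable_fun setT g -> (forall x, 0 <= g x) ->
  (\int[mu]_x (g x)%:E = \int[mu]_x (g (phi x) * c x)%:E)%E.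
Proof.
move=> mg g0.
have mphi' : measurable_fun setT (phi : measurableTypeR R -> measurableTypeR R) := mphi.
rewrite -ge0_integral_density; last 2 first.
- exact: measurableT_comp mphi.
- by [].
have := @ge0_integral_pushforward _ _ (measurableTypeR R) (measurableTypeR R) R
  phi mphi' density_measure setT (EFin \o g) measurableT.
rewrite preimage_setT /= => <-; last 2 first.
- exact/measurable_EFinP.
- by move=> x _; rewrite lee_fin.
apply: eq_measure_integral => A mA _.
apply: (@lebesgue_measure_unique R (pushforward density_measure
  (phi : measurableTypeR R -> measurableTypeR R))) => //.
move=> _ [[a b] _ <-]; rewrite /pushforward /= /density_measure.
have [ab|ba] := leP a b; last first.
  have -> : `]a, b]%classic = set0 by rewrite set_itv_ge// bnd_simp -leNgt ltW.
  by rewrite /pushforward preimage_set0 integral_set0 measure0.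
rewrite [RHS]phiE// lebesgue_measure_itv/= lte_fin.
by move: ab; rewrite le_eqVlt => /predU1P[->|->//]; rewrite ltxx subrr.
Qed.

Lemma L1_cov (g : R -> R) : measurable_fun setT g ->
  L1 (fun x => g (phi x) * c x) <-> L1 g.
Proof.
move=> mg; have mgp : measurable_fun setT (fun x => g (phi x) * c x).
  by apply: measurable_funM => //; exact: measurableT_comp mphi.
have E : (\int[mu]_x `|(g x)%:E| = \int[mu]_x `|(g (phi x) * c x)%:E|)%E.
  rewrite (@ge0_integral_cov (fun x => `|g x|)) => //; last exact: measurableT_comp.
  by apply: eq_integral => x _ /=; rewrite normrM (ger0_norm (c0 x)).
split=> /integrableP[_ i]; apply/integrableP; split; try exact/measurable_EFinP.
  by rewrite /= E.
by rewrite /= -E.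
Qed.

Lemma Int_cov (g : R -> R) : L1 g ->
  \int[mu]_x g x = \int[mu]_x (g (phi x) * c x).
Proof.
move=> Lg; have mg := L1_measurable Lg.
have P (h : R -> R) : measurable_fun setT h -> (forall x, 0 <= h x) ->
    \int[mu]_x h x = \int[mu]_x (h (phi x) * c x).
  by move=> mh h0; rewrite /Rintegral ge0_integral_cov.
pose gp x := Num.max (g x) 0; pose gm x := Num.max (- g x) 0.
have gE x : g x = gp x - gm x.
  by rewrite /gp /gm; case: (leP (g x) 0) => h; [rewrite max_l|rewrite max_r]; lra.
have mgp : measurable_fun setT gp by exact: measurable_maxr.
have mgm : measurable_fun setT gm.
  by apply: measurable_maxr => //; exact: measurableT_comp.
have Lgp : L1 gp.
  apply: L1_dominated (L1_norm Lg) _ => // x.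
  by rewrite ger0_norm ?le_max ?lexx ?orbT// ge_max ler_norm normr_ge0.
have Lgm : L1 gm.
  apply: L1_dominated (L1_norm Lg) _ => // x.
  by rewrite ger0_norm ?le_max ?lexx ?orbT// ge_max -normrN ler_norm normr_ge0.
under eq_Rintegral do rewrite gE.
under [RHS]eq_Rintegral do rewrite gE mulrBl.
rewrite RintegralB// RintegralB//; last 2 first.
- exact/L1_cov.
- exact/L1_cov.
by congr (_ - _); apply: P => // x; rewrite le_max lexx orbT.
Qed.

End Density.

(** * Primitives of square-integrable functions *)

Section Primitive.
Context {R : realType}.
Local Notation mu := (@lebesgue_measure R).
Implicit Types (f g v : R -> R) (s t a b C E : R).

Lemma measurable_if_real d (T : measurableType d) (b : T -> bool) (f g : T -> R) :
  measurable_fun setT b -> measurable_fun setT f -> measurable_fun setT g ->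
  measurable_fun setT (fun x => if b x then f x else g x).
Proof. by move=> mb mf mg; apply: measurable_fun_ifT. Qed.

Lemma measurable_mem_itv d (T : measurableType d) (f : T -> R) (i : interval R) :
  measurable_fun setT f -> measurable_fun setT (fun x => f x \in i).
Proof.
move=> mf; apply: (measurable_fun_bool true).
rewrite setTI (_ : _ @^-1` _ = f @^-1` [set` i]); last first.
  by apply/seteqP; split => x /=.
by rewrite -[X in measurable X]setTI; exact: mf.
Qed.

Lemma measurable_between a b : measurable_fun setT (fun r : R => a <= r <= b).
Proof. by apply: measurable_and; apply: measurable_fun_ler. Qed.

Lemma measurable_between_lt a b : measurable_fun setT (fun r : R => a < r <= b).
Proof.
by apply: measurable_and; [apply: measurable_fun_ltr|apply: measurable_fun_ler].
Qed.

Lemma IntE (i : interval R) f :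
  \int[mu]_(x in [set` i]) f x = \int[mu]_x (if x \in i then f x else 0).
Proof.
rewrite Rintegral_mkcond; apply: eq_Rintegral => x _; rewrite patchE.
by rewrite mem_setE.
Qed.

Lemma L1_if (b : R -> bool) f : measurable_fun setT b -> L1 f ->
  L1 (fun x => if b x then f x else 0).
Proof.
move=> mb Lf; apply: L1_dominated (L1_norm Lf) _.
  by apply: measurable_if_real => //; exact: L1_measurable.
by move=> x; case: ifP; rewrite ?normr0.
Qed.

Definition supported a b f := forall x, ~~ (a <= x <= b) -> f x = 0.

Lemma patch_supported a b f : supported a b (f \_ `[a, b]).
Proof. by move=> x hx; rewrite patchE mem_setE in_itv/= (negbTE hx). Qed.

(** [|f| <= f^2 + 1] on the support. *)
Lemma L2_supported_L1 a b f : L2 f -> supported a b f -> L1 f.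
Proof.
move=> [mf Lf2] fs; apply: L1_dominated mf (L1D Lf2 (L1_itv 1 a b)) _ => x.
rewrite indicE mem_setE in_itv/= mul1r; case: (boolP (a <= x <= b)) => hx; last first.
  by rewrite fs// normr0 expr0n addr0.
rewrite -(real_normK (num_real (f x))).
have := sqr_ge0 (`|f x| - 1); have := normr_ge0 (f x); rewrite /=; nra.
Qed.

Lemma L1_itv_integrable (i : interval R) f : L1 f ->
  mu.-integrable [set` i] (EFin \o f).
Proof. by move=> Lf; apply: integrableS Lf. Qed.

(** The lower end [-oo] makes the increments of the primitive integrals over
    intervals anywhere on the line; the functions at stake vanish far to the
    left. *)
Definition prim v t := \int[mu]_(r in `]-oo, t]) v r.

Lemma primB v s t : L1 v -> s <= t ->
  prim v t - prim v s = \int[mu]_r (if s < r <= t then v r else 0).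
Proof.
move=> Lv st; rewrite /prim Rintegral_itvB ?bnd_simp//; last exact: L1_itv_integrable.
by rewrite IntE; apply: eq_Rintegral => r _; rewrite in_itv.
Qed.

Lemma prim_le v s t : L1 v -> (forall r, 0 <= v r) -> s <= t ->
  prim v s <= prim v t.
Proof.
move=> Lv v0 st; rewrite -subr_ge0 primB//; apply: Int_ge0 => r.
by case: ifP.
Qed.

Lemma L2_itv1 (a b : R) : L2 (fun r => if a < r <= b then 1 else 0 : R).
Proof.
have mb := measurable_between_lt a b; split; first exact: measurable_if_real.
apply: L1_dominated (L1_itv 1 a b) _.
  by apply: measurable_funX; exact: measurable_if_real.
move=> x; rewrite indicE mul1r mem_setE in_itv/=.
case: ifP => [/andP[h1 h2]|_]; last by rewrite expr0n normr0.
by rewrite h2 (ltW h1)/= expr1n normr1.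
Qed.

(** Cauchy-Schwarz against the indicator of the interval: the primitives of
    functions that are bounded in L^2 are uniformly 1/2-Hoelder. *)
Lemma prim_holder v s t E : L2 v -> L1 v -> \int[mu]_r v r ^+ 2 <= E -> s <= t ->
  (prim v t - prim v s) ^+ 2 <= E * (t - s).
Proof.
move=> Lv L1v vE st; rewrite primB//.
pose k r : R := if s < r <= t then 1 else 0.
have -> : \int[mu]_r (if s < r <= t then v r else 0) = \int[mu]_r (v r * k r).
  by apply: eq_Rintegral => r _; rewrite /k; case: ifP; rewrite ?mulr1 ?mulr0.
apply: le_trans (cauchy_schwarz Lv (L2_itv1 s t)) _.
have k0 : 0 <= \int[mu]_x k x ^+ 2 by apply: Int_ge0 => x; exact: sqr_ge0.
apply: ler_pM => //; first by apply: Int_ge0 => x; exact: sqr_ge0.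
have -> : t - s = \int[mu]_x (1 * \1_`[s, t] x) by rewrite Int_itv// mul1r.
apply: Int_le; [by case: (L2_itv1 s t)|exact: L1_itv|] => x.
rewrite indicE mul1r mem_setE in_itv/= /k.
case: ifP => [/andP[h1 h2]|_]; last by rewrite expr0n; case: (_ && _).
by rewrite h2 (ltW h1)/= expr1n.
Qed.

Lemma bounded_primC v C E s t : L2 v -> L1 v -> \int[mu]_r v r ^+ 2 <= E ->
  0 <= C -> E * `|t - s| <= C ^+ 2 -> `|prim v t - prim v s| <= C.
Proof.
move=> Lv L1v vE C0; wlog st : s t / s <= t.
  by move=> h; have [|/ltW] := leP s t; [|rewrite distrC (distrC (prim v t))]; exact: h.
rewrite [`|t - s|]ger0_norm ?subr_ge0// => EC.
rewrite -(ler_pXn2r (_ : 0 < 2)%N) ?nnegrE// real_normK ?num_real//.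
exact: le_trans (prim_holder Lv L1v vE st) EC.
Qed.

Lemma prim_continuous v : L2 v -> L1 v -> continuous (prim v).
Proof.
move=> Lv L1v x; apply/cvgrPdist_le => e e0.
set E := \int[mu]_r v r ^+ 2.
have E0 : 0 <= E by apply: Int_ge0 => r; exact: sqr_ge0.
near=> y; apply: (bounded_primC Lv L1v (lexx _) (ltW e0)); rewrite -/E.
apply: (@le_trans _ _ ((E + 1) * `|x - y|)).
  by apply: ler_wpM2r => //; lra.
rewrite mulrC -ler_pdivlMr; last lra.
near: y; apply: (@cvgr_dist_le _ R^o); rewrite ?divr_gt0 ?exprn_gt0//; lra.
Unshelve. all: by end_near. Qed.

End Primitive.

(** * Increasing bi-Lipschitz functions *)

Section Bilip.
Context {R : realType}.
Implicit Types (f g : R -> R) (m M s t : R).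

Definition bilip m M f := forall s t, s <= t ->
  m * (t - s) <= f t - f s <= M * (t - s).

Lemma bilip_lt m M f s t : 0 < m -> bilip m M f -> s < t -> f s < f t.
Proof.
move=> m0 fmM st; have /andP[h _] := fmM s t (ltW st).
by rewrite -subr_gt0 (lt_le_trans _ h)// mulr_gt0// subr_gt0.
Qed.

Lemma bilip_leE m M f s t : 0 < m -> bilip m M f -> (f s <= f t) = (s <= t).
Proof.
move=> m0 fmM; apply/idP/idP => [|st].
  by apply: contraTT; rewrite -!ltNge; exact: (bilip_lt m0 fmM).
by move: st; rewrite le_eqVlt => /predU1P[->//|/(bilip_lt m0 fmM)/ltW].
Qed.

Lemma bilip_ltE m M f s t : 0 < m -> bilip m M f -> (f s < f t) = (s < t).
Proof. by move=> m0 fmM; rewrite !ltNge (bilip_leE _ _ m0 fmM). Qed.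

Lemma bilip_dist m M f s t : 0 < m -> bilip m M f ->
  m * `|t - s| <= `|f t - f s| <= M * `|t - s|.
Proof.
move=> m0 fmM; wlog st : s t / s <= t.
  by move=> h; have [|/ltW] := leP s t; [|rewrite distrC (distrC (f t))]; exact: h.
have fst : f s <= f t by rewrite (bilip_leE _ _ m0 fmM).
by rewrite !ger0_norm ?subr_ge0//; exact: fmM.
Qed.

Lemma bilip_continuous m M f : 0 < m -> bilip m M f -> continuous f.
Proof.
move=> m0 fmM x; apply/cvgrPdist_lt => e e0.
have M0 : 0 < `|M| + 1 by rewrite ltr_wpDl.
near=> y; have /andP[_ h] := bilip_dist y x m0 fmM.
apply: le_lt_trans h _; apply: (@le_lt_trans _ _ ((`|M| + 1) * `|x - y|)).
  by apply: ler_wpM2r => //; rewrite ler_wpDr// ler_norm.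
rewrite mulrC -ltr_pdivlMr//; near: y.
by apply: (@cvgr_dist_lt _ R^o); rewrite ?divr_gt0//; exact: cvg_id.
Unshelve. all: by end_near. Qed.

(** As [f] grows at rate at least [m], the intermediate value theorem finds
    a preimage of [y] at distance at most [|y - f 0| / m] from the origin. *)
Lemma bilip_inv m M f : 0 < m -> bilip m M f ->
  exists g, [/\ cancel f g, cancel g f & bilip M^-1 m^-1 g].
Proof.
move=> m0 fmM.
have M0 : 0 < M.
  have /andP[h1 h2] := fmM 0 1 ler01.
  by have := le_trans h1 h2; rewrite !subr0 !mulr1; exact: lt_le_trans.
have cf := bilip_continuous m0 fmM.
have S y : exists x, f x = y.
  pose d := `|y - f 0| / m.
  have d0 : 0 <= d by rewrite divr_ge0// ltW.
  have h1 : f (- d) <= y.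
    have /andP[h _] := fmM (- d) 0 ltac:(lra); move: h.
    have -> : m * (0 - - d) = `|y - f 0| by rewrite /d; field; rewrite gt_eqF.
    by have := ler_norm (f 0 - y); rewrite distrC; lra.
  have h2 : y <= f d.
    have /andP[h _] := fmM 0 d d0; move: h.
    have -> : m * (d - 0) = `|y - f 0| by rewrite /d; field; rewrite gt_eqF.
    by have := ler_norm (y - f 0); lra.
  have [| |x _ fx] := @IVT _ f (- d) d y _ (continuous_subspaceT cf); [lra| |by exists x].
  by rewrite ge_min h1 le_max h2 orbT.
have [g gK] := choice S.
have fK : cancel f g.
  by move=> x; apply/le_anti;
    rewrite -(bilip_leE (g (f x)) x m0 fmM) -(bilip_leE x (g (f x)) m0 fmM) gK lexx.
exists g; split=> // s t st.
have gst : g s <= g t by rewrite -(bilip_leE _ _ m0 fmM) !gK.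
have := fmM _ _ gst; rewrite !gK => /andP[h1 h2].
by rewrite ler_pdivrMl// ler_pdivlMl// h1 h2.
Qed.

(** A total function of [f], so that what is built from it can be defined
    before [f] is known to be bi-Lipschitz. *)
Definition binv f : R -> R := xget (id : R -> R) [set g : R -> R | cancel f g /\ cancel g f].

Lemma binvP m M f : 0 < m -> bilip m M f ->
  [/\ cancel f (binv f), cancel (binv f) f & bilip M^-1 m^-1 (binv f)].
Proof.
move=> m0 fmM; have [g [fK gK gb]] := bilip_inv m0 fmM.
rewrite /binv; case: xgetP => [h _ [fhK hK]|/(_ g)[]//]; split => //.
suff -> : h = g by [].
by apply/funext => y; rewrite -{1}(gK y) fhK.
Qed.

Lemma bilip_gt0 m M f : 0 < m -> bilip m M f -> 0 < M.
Proof.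
move=> m0 fmM; have /andP[h1 h2] := fmM 0 1 ler01.
by have := le_trans h1 h2; rewrite !subr0 !mulr1; exact: lt_le_trans.
Qed.

End Bilip.

(** * Mass between two characteristics *)

Section Influx.
Context {R : realType}.
Local Notation mu := (@lebesgue_measure R).
Implicit Types (v xi a b : R -> R) (t s r : R).

(** The in-flux and the initial density as one function of a label [r]
    attached to each particle: its time of entrance if [r > 0], minus its
    initial position if [r <= 0]. This is why the support lies in [[-1, T]]. *)
Record influx (T E : R) (v : R -> R) : Prop := Influx {
  influx_meas : measurable_fun setT v;
  influx_ge0 : forall r, 0 <= v r;
  influx_supp : forall r, ~~ (-1 <= r <= T) -> v r = 0;
  influx_sqr : L1 (fun r => v r ^+ 2);
  influx_le : \int[mu]_r v r ^+ 2 <= E }.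

Lemma influx_L2 T E v : influx T E v -> L2 v.
Proof. by case. Qed.

Lemma influx_L1 T E v : influx T E v -> L1 v.
Proof. by move=> iv; exact: L2_supported_L1 (influx_L2 iv) (influx_supp iv). Qed.

(** The integrand is [y] on an interval of length at most [|p - q|], which
    is empty unless it starts before [t]. *)
Lemma Int_window (y p q t : R) : 0 <= y ->
  \int[mu]_s (if (s \in `[0, t]) && (Num.min p q <= s < Num.max p q) then y else 0)
  <= if Num.min p q <= t then y * `|p - q| else 0.
Proof.
move=> y0; have [h|h] := leP (Num.min p q) t; last first.
  rewrite -[leRHS]Int0 le_eqVlt; apply/orP; left; apply/eqP.
  apply: eq_Rintegral => s _; rewrite in_itv/=; case: ifP => // /and3P[/andP[_ st] bs _].
  by have := lt_le_trans h (le_trans bs st); rewrite ltxx.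
have minmax : Num.min p q <= Num.max p q by rewrite le_max !ge_min lexx.
have -> : `|p - q| = Num.max p q - Num.min p q.
  case: (leP p q) => pq; first by rewrite distrC ger0_norm// subr_ge0.
  by rewrite gtr0_norm// subr_gt0.
have F s : (if (s \in `[0, t]) && (Num.min p q <= s < Num.max p q) then y else 0) <=
    y * \1_`[Num.min p q, Num.max p q] s.
  rewrite indicE mem_setE !in_itv/=; case: ifP => [/andP[_ /andP[h1 h2]]|_].
    by rewrite h1 (ltW h2) mulr1.
  by rewrite mulr_ge0.
rewrite -Int_itv//; apply: Int_le => //; last exact: L1_itv.
apply: L1_dominated (L1_itv y (Num.min p q) (Num.max p q)) _.
  apply: measurable_if_real => //; apply: measurable_and.
    exact: measurable_mem_itv.
  by apply: measurable_and; [exact: measurable_fun_ler|exact: measurable_fun_ltr].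
by move=> s; rewrite ger0_norm//; case: ifP.
Qed.

Section Exchange.
Variables (v : R -> R) (a1 a2 b1 b2 : R -> R).
Hypotheses (Lv : L1 v) (v0 : forall r, 0 <= v r).
Hypotheses (ab1 : forall r s, (r <= a1 s) = (b1 r <= s)).
Hypotheses (ab2 : forall r s, (r <= a2 s) = (b2 r <= s)).
Hypotheses (mb1 : measurable_fun setT b1) (mb2 : measurable_fun setT b2).

(** By the adjunctions [ab1] and [ab2], the label [r] lies between [a1 s]
    and [a2 s] exactly when the time [s] lies between [b1 r] and [b2 r]. *)
Lemma prim_dist_between s : `|prim v (a1 s) - prim v (a2 s)| =
  \int[mu]_r (if Num.min (b1 r) (b2 r) <= s < Num.max (b1 r) (b2 r) then v r else 0).
Proof.
have P x y : x <= y -> `|prim v x - prim v y| =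
    \int[mu]_r (if x < r <= y then v r else 0).
  move=> xy; rewrite distrC primB// ger0_norm//.
  by apply: Int_ge0 => r; case: ifP.
have [le12|/ltW le21] := leP (a1 s) (a2 s).
  rewrite P//; apply: eq_Rintegral => r _; congr (if _ then _ else _).
  rewrite ge_min lt_max ![s < _]ltNge -!ab2 -!ab1 ltNge.
  case: (leP r (a1 s)) => r1; case: (leP r (a2 s)) => r2 //=.
  by have := le_lt_trans (le_trans r1 le12) r2; rewrite ltxx.
rewrite distrC P//; apply: eq_Rintegral => r _; congr (if _ then _ else _).
rewrite ge_min lt_max ![s < _]ltNge -!ab2 -!ab1 ltNge.
case: (leP r (a1 s)) => r1; case: (leP r (a2 s)) => r2 //=.
by have := le_lt_trans (le_trans r2 le21) r1; rewrite ltxx.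
Qed.

(** The increments of the primitive are not Lipschitz in [a1 s - a2 s].
    Integrating in [s] and exchanging the integrals replaces them by the
    distance of [b1] and [b2], weighted by [v]. *)
Lemma Int_prim_dist t :
  L1 (fun r => if Num.min (b1 r) (b2 r) <= t then v r * `|b1 r - b2 r| else 0) ->
  \int[mu]_(s in `[0, t]) `|prim v (a1 s) - prim v (a2 s)| <=
  \int[mu]_r (if Num.min (b1 r) (b2 r) <= t then v r * `|b1 r - b2 r| else 0).
Proof.
move=> LB.
pose F (p : R * R) := if (p.1 \in `[0, t]) &&
  (Num.min (b1 p.2) (b2 p.2) <= p.1 < Num.max (b1 p.2) (b2 p.2)) then v p.2 else 0.
have mF : measurable_fun setT F.
  have m1 : measurable_fun setT (fun p : R * R => p.1) by exact: measurable_fst.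
  have m2 : measurable_fun setT (fun p : R * R => p.2) by exact: measurable_snd.
  have mb1' : measurable_fun setT (fun p : R * R => b1 p.2) by exact: measurableT_comp mb1 m2.
  have mb2' : measurable_fun setT (fun p : R * R => b2 p.2) by exact: measurableT_comp mb2 m2.
  apply: measurable_if_real => //.
    apply: measurable_and; first exact: measurable_mem_itv.
    apply: measurable_and.
      by apply: measurable_fun_ler => //; exact: measurable_minr.
    by apply: measurable_fun_ltr => //; exact: measurable_maxr.
  by apply: measurableT_comp m2; exact: L1_measurable.
have bF x y : `|F (x, y)| <= 1 * \1_`[0, t] x * v y.
  rewrite /F /= indicE mem_setE mul1r; case: (x \in _) => /=; last by rewrite normr0 mul0r.
  by rewrite mul1r; case: ifP => _; rewrite ?normr0// ger0_norm.
have f0 (x : R) : 0 <= (1 * \1_`[0, t] x :> R) by rewrite mul1r indicE.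
have [LF1 LF2 L12 L21 E12] := Int_fubini_prod mF (L1_itv 1 0 t) Lv f0 v0 bF.
clear f0 bF mF.
rewrite IntE (_ : Rintegral _ _ _ = \int[mu]_x \int[mu]_y F (x, y)); last first.
  apply: eq_Rintegral => s _; rewrite /F /=; clear -Lv v0 ab1 ab2.
  by case: ifP => _ /=; [exact: prim_dist_between|rewrite Int0].
rewrite E12; clear E12 LF1 LF2 L12.
apply: (Int_le L21 LB) => r; rewrite /F /=; exact: (@Int_window (v r) (b1 r) (b2 r) t (v0 r)).
Qed.
End Exchange.

(** As [b] increases at rate at least [sg], the integrand is at most [exp (k
    (t - sg (rt - r)))] up to [rt = b^-1 t], a function with an explicit
    primitive. The gain is the factor [1 / k], small for large [k]. *)
Lemma Int_exp_bilip (b : R -> R) (sg Sg k t : R) : 0 < sg -> 0 < k -> bilip sg Sg b ->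
  let f r := if (-1 <= r) && (b r <= t) then expR (k * b r) else 0 in
  L1 f /\ \int[mu]_r f r <= expR (k * t) / (k * sg).
Proof.
move=> sg0 k0 bb f; have [bK cK _] := binvP sg0 bb; set rt := binv b t.
have ksg : 0 < k * sg by rewrite mulr_gt0.
have brt r : (b r <= t) = (r <= rt) by rewrite -(bilip_leE r rt sg0 bb) cK.
pose G r := expR (k * (t - sg * (rt - r))).
have fG r : f r <= if r \in `[-1, rt] then G r else 0.
  rewrite /f brt in_itv/=; case: ifP => // /andP[_ rrt].
  rewrite ler_expR ler_wpM2l ?(ltW k0)//.
  by have /andP[h _] := bb _ _ rrt; move: h; rewrite cK; lra.
have cG : continuous G.
  move=> x; apply: continuous_comp; last exact: continuous_expR.
  apply: continuousM; first exact: cvg_cst.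
  apply: continuousB; first exact: cvg_cst.
  apply: continuousM; first exact: cvg_cst.
  by apply: continuousB; [exact: cvg_cst|exact: cvg_id].
have mG : measurable_fun setT G by exact: continuous_measurable_fun.
have mb : measurable_fun setT b.
  by apply: continuous_measurable_fun; exact: bilip_continuous sg0 bb.
have f0 r : 0 <= f r by rewrite /f; case: ifP => // _; exact: expR_ge0.
have LG : L1 (fun r => if r \in `[-1, rt] then G r else 0).
  apply: L1_dominated (L1_itv (expR (k * t)) (-1) rt) _.
    by apply: measurable_if_real => //; exact: measurable_mem_itv.
  move=> r; rewrite indicE mem_setE; case: ifPn => [|_]; last by rewrite normr0 mulr0.
  rewrite in_itv/= mulr1 ger0_norm ?expR_ge0// => /andP[_ rrt].
  rewrite ler_expR ler_wpM2l ?(ltW k0)// gerBl mulr_ge0// ?(ltW sg0)//.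
  by rewrite subr_ge0.
have Lf : L1 f.
  apply: L1_dominated LG _.
    apply: measurable_if_real => //.
      apply: measurable_and; first exact: measurable_fun_ler.
      exact: measurable_fun_ler.
    apply: measurableT_comp => //; exact: measurable_funM.
  by move=> r; rewrite ger0_norm.
split=> //; apply: (le_trans (Int_le Lf LG fG)).
have [rt1|rt1] := leP rt (-1).
  rewrite -IntE; move: rt1; rewrite le_eqVlt => /predU1P[->|rt1].
    by rewrite set_itv1 Rintegral_set1 divr_ge0 ?expR_ge0// ltW.
  rewrite set_itv_ge ?bnd_simp -?ltNge// Rintegral_set0.
  by rewrite divr_ge0 ?expR_ge0// ltW.
rewrite -IntE.
pose H r := G r / (k * sg).
have dH (x : R) : is_derive x (1 : R) H (G x).
  have dg : is_derive x (1 : R) (fun r : R => k * (t - sg * (rt - r))) (k * sg).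
    rewrite (_ : (fun r : R => _) = (fun r : R => (k * sg) *: r + k * (t - sg * rt))); last first.
      by apply/funext => r; rewrite /GRing.scale/=; ring.
    by apply: is_derive_eq; rewrite /GRing.scale/=; ring.
  have dE := is_derive_expR (k * (t - sg * (rt - x))).
  have := @is_derive1_comp R expR _ x _ _ dE dg.
  rewrite (_ : expR \o _ = G)// => dG.
  rewrite (_ : H = (k * sg)^-1 \*: G); last first.
    by apply/funext => r; rewrite /H /= mulrC.
  apply: (is_derive_eq (is_deriveZ _ dG)); rewrite /GRing.scale/= /G.
  by field; rewrite !gt_eqF.
rewrite /Rintegral (@continuous_FTC2 _ G H)//.
- rewrite -EFinB/= /H -mulrBl ler_wpM2r ?invr_ge0 ?(ltW ksg)//.
  rewrite {1}/G subrr mulr0 subr0 gerBl; exact: expR_ge0.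
- exact: continuous_subspaceT.
- have cH : continuous H by move=> x; apply: differentiable_continuous; apply/derivable1_diffP; case: (dH x).
  split.
  + by move=> x _; case: (dH x).
  + exact: (cvg_at_right_filter (cH _)).
  + exact: (cvg_at_left_filter (cH _)).
- by move=> x _; rewrite derive1E; case: (dH x).
Qed.

Lemma bilip_comp m1 M1 m2 M2 (f g : R -> R) : 0 < m1 -> 0 < m2 ->
  bilip m1 M1 f -> bilip m2 M2 g -> bilip (m1 * m2) (M1 * M2) (f \o g).
Proof.
move=> m10 m20 bf bg s t st /=.
have gst : g s <= g t by rewrite (bilip_leE _ _ m20 bg).
have /andP[f1 f2] := bf _ _ gst; have /andP[g1 g2] := bg _ _ st.
have M10 := bilip_gt0 m10 bf.
apply/andP; split.
  by apply: le_trans f1; rewrite -mulrA ler_pM2l.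
by apply: (le_trans f2); rewrite -mulrA ler_pM2l.
Qed.

Lemma bilip_shift m M (f : R -> R) c : bilip m M f -> bilip m M (fun x => f x + c).
Proof. by move=> bf s t st; have := bf _ _ st; rewrite opprD addrACA subrr addr0. Qed.

Lemma bilip_min m M (f g : R -> R) : bilip m M f -> bilip m M g ->
  bilip m M (fun x => Num.min (f x) (g x)).
Proof.
move=> bf bg s t st; have /andP[f1 f2] := bf _ _ st; have /andP[g1 g2] := bg _ _ st.
by case: (leP (f t) (g t)) => ?; case: (leP (f s) (g s)) => ?; apply/andP; split; lra.
Qed.

(** If [xi] is the distance covered by the particles, the label of the
    particle that is at position 1 at time [s]. *)
Definition back xi s := binv xi (xi s - 1).
(** The time at which the particle with label [r] reaches position 1. *)
Definition fwd xi r := binv xi (xi r + 1).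
(** The mass in [[0, 1]] at time [s]: the particles present have their
    labels between [back xi s] and [s]. *)
Definition mass v xi s := prim v s - prim v (back xi s).

Section Backward.
Variables (m M : R) (xi : R -> R).
Hypotheses (m0 : 0 < m) (xib : bilip m M xi).

Lemma xi_back s : xi (back xi s) = xi s - 1.
Proof. by rewrite /back; case: (binvP m0 xib) => _ ->. Qed.

Lemma xi_fwd s : xi (fwd xi s) = xi s + 1.
Proof. by rewrite /fwd; case: (binvP m0 xib) => _ ->. Qed.

Lemma back_fwdE r s : (r <= back xi s) = (fwd xi r <= s).
Proof.
by rewrite -(bilip_leE r _ m0 xib) -(bilip_leE _ s m0 xib) xi_back xi_fwd lerBrDr.
Qed.

Lemma fwd_bilip : bilip (M^-1 * m) (m^-1 * M) (fwd xi).
Proof.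
have M0 := bilip_gt0 m0 xib; have [_ _ bb] := binvP m0 xib.
by apply: (bilip_comp _ _ bb (bilip_shift 1 xib)) => //; rewrite invr_gt0.
Qed.

Lemma back_bilip : bilip (M^-1 * m) (m^-1 * M) (back xi).
Proof.
have M0 := bilip_gt0 m0 xib; have [_ _ bb] := binvP m0 xib.
by apply: (bilip_comp _ _ bb (bilip_shift (-1) xib)) => //; rewrite invr_gt0.
Qed.

Lemma le_fwd r : r <= fwd xi r.
Proof. by rewrite -(bilip_leE _ _ m0 xib) xi_fwd; lra. Qed.

Lemma back_le s : back xi s <= s.
Proof. by rewrite -(bilip_leE _ _ m0 xib) xi_back; lra. Qed.
End Backward.

(** When the faster of the two particles with label [r] reaches position 1,
    the other one is behind by at most twice the distance of the
    characteristics, a gap that it closes at speed at least [m]. *)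
Lemma fwd_dist m M xi1 xi2 N k t r : 0 < m -> 0 <= N -> 0 < k ->
  bilip m M xi1 -> bilip m M xi2 ->
  (forall s, s <= t -> `|xi1 s - xi2 s| <= N * expR (k * s)) ->
  Num.min (fwd xi1 r) (fwd xi2 r) <= t ->
  `|fwd xi1 r - fwd xi2 r| <= 2 * N / m * expR (k * Num.min (fwd xi1 r) (fwd xi2 r)).
Proof.
move=> m0 N0 k0 b1 b2 H.
wlog le12 : xi1 xi2 b1 b2 H / fwd xi1 r <= fwd xi2 r.
  move=> h; have [le12|/ltW le21] := leP (fwd xi1 r) (fwd xi2 r).
    by have := h _ _ b1 b2 H le12; rewrite min_l.
  have H' s : s <= t -> `|xi2 s - xi1 s| <= N * expR (k * s).
    by move=> st; rewrite distrC H.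
  by have := h _ _ b2 b1 H' le21; rewrite min_l// distrC.
rewrite min_l// => f1t; rewrite distrC ger0_norm ?subr_ge0//.
have /andP[h _] := b2 _ _ le12.
rewrite -(ler_pM2l m0) (le_trans h)//.
have -> : m * (2 * N / m * expR (k * fwd xi1 r)) = 2 * (N * expR (k * fwd xi1 r)).
  by field; rewrite gt_eqF.
have e1 := xi_fwd m0 b1 r; have e2 := xi_fwd m0 b2 r.
have := ler_norm (xi1 (fwd xi1 r) - xi2 (fwd xi1 r)).
have := ler_norm (xi2 r - xi1 r); rewrite distrC.
have := H _ f1t; have := H _ (le_trans (le_fwd m0 b1 r) f1t).
have : N * expR (k * r) <= N * expR (k * fwd xi1 r).
  by rewrite ler_wpM2l// ler_expR ler_wpM2l ?(ltW k0)// (le_fwd m0 b1).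
lra.
Qed.

(** The key estimate. At a fixed time, a function [v] in L^2 makes the mass
    no better than 1/2-Hoelder in the characteristic. Integrated in time,
    the exchange of integrals in [Int_prim_dist] and the Cauchy-Schwarz
    inequality make it Lipschitz for the norm [sup_s exp (- k s) |xi s|],
    with a constant of order [k^(-1/2)]. *)
Lemma mass_contraction T E v m M xi1 xi2 N k t :
  influx T E v -> 0 < m -> 0 <= N -> 0 < k ->
  bilip m M xi1 -> bilip m M xi2 ->
  (forall s, s <= t -> `|xi1 s - xi2 s| <= N * expR (k * s)) ->
  \int[mu]_(s in `[0, t]) `|mass v xi1 s - mass v xi2 s| <=
  2 / m * Num.sqrt (E * M / (2 * k * m)) * (N * expR (k * t)).
Proof.
move=> iv m0 N0 k0 b1 b2 H.
have M0 := bilip_gt0 m0 b1.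
have Lv := influx_L1 iv; have L2v := influx_L2 iv.
have v0 := influx_ge0 iv.
have f1b := fwd_bilip m0 b1; have f2b := fwd_bilip m0 b2.
set sg := M^-1 * m in f1b f2b.
have sg0 : 0 < sg by rewrite mulr_gt0 ?invr_gt0.
have minb := bilip_min f1b f2b.
pose kk r := if (-1 <= r) && (Num.min (fwd xi1 r) (fwd xi2 r) <= t)
  then expR (k * Num.min (fwd xi1 r) (fwd xi2 r)) else 0.
have k20 : 0 < 2 * k by lra.
have [Lk2 Ik2] := Int_exp_bilip t sg0 k20 minb.
have mf1 : measurable_fun setT (fwd xi1).
  by apply: continuous_measurable_fun; exact: bilip_continuous sg0 f1b.
have mf2 : measurable_fun setT (fwd xi2).
  by apply: continuous_measurable_fun; exact: bilip_continuous sg0 f2b.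
have mmin : measurable_fun setT (fun r => Num.min (fwd xi1 r) (fwd xi2 r)).
  exact: measurable_minr.
have k2E : (fun r => kk r ^+ 2) = (fun r => if (-1 <= r) && (Num.min (fwd xi1 r) (fwd xi2 r) <= t) then expR (2 * k * Num.min (fwd xi1 r) (fwd xi2 r)) else 0).
  apply/funext => r; rewrite /kk; case: ifP => _; last by rewrite expr0n.
  by rewrite expr2 -expRD; congr expR; ring.
have mkk : measurable_fun setT kk.
  apply: measurable_if_real => //.
    by apply: measurable_and; exact: measurable_fun_ler.
  by apply: measurableT_comp => //; exact: measurable_funM.
have Lk : L2 kk by split => //; rewrite k2E.
pose D r := if Num.min (fwd xi1 r) (fwd xi2 r) <= t then v r * `|fwd xi1 r - fwd xi2 r| else 0.
have DB r : D r <= 2 * N / m * (v r * kk r).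
  rewrite /D /kk; have [h|h] := leP (Num.min _ _) t; last by rewrite andbF !mulr0.
  rewrite andbT; case: ifPn => r1; last first.
    by rewrite (influx_supp iv) ?mul0r ?mulr0// (negbTE r1).
  rewrite mulrCA ler_wpM2l//; exact: (fwd_dist m0 N0 k0 b1 b2 H h).
have D0 r : 0 <= D r by rewrite /D; case: ifP => // _; rewrite mulr_ge0.
have LD : L1 D.
  apply: L1_dominated (L1Z (2 * N / m) (L2M L2v Lk)) _.
    apply: measurable_if_real => //; first exact: measurable_fun_ler.
    apply: measurable_funM; first exact: L1_measurable.
    by apply: measurableT_comp => //; exact: measurable_funB.
  by move=> r; rewrite ger0_norm.
have -> : \int[mu]_(s in `[0, t]) `|mass v xi1 s - mass v xi2 s| =
    \int[mu]_(s in `[0, t]) `|prim v (back xi1 s) - prim v (back xi2 s)|.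
  apply: eq_Rintegral => s _; rewrite /mass distrC; congr `|_|; ring.
apply: (le_trans (Int_prim_dist Lv v0 (back_fwdE m0 b1) (back_fwdE m0 b2) mf1 mf2 LD)).
apply: (le_trans (Int_le LD (L1Z _ (L2M L2v Lk)) DB)).
rewrite RintegralZl//; last exact: L2M.
have -> : 2 / m * Num.sqrt (E * M / (2 * k * m)) * (N * expR (k * t)) =
  2 * N / m * (Num.sqrt (E * M / (2 * k * m)) * expR (k * t)) by ring.
rewrite ler_wpM2l ?divr_ge0 ?mulr_ge0 ?(ltW m0)//.
have E0 : 0 <= E.
  by apply: le_trans (influx_le iv); apply: Int_ge0 => x; exact: sqr_ge0.
rewrite -(ler_pXn2r (_ : 0 < 2)%N)//; last 2 first.
- rewrite nnegrE; apply: Int_ge0 => x; rewrite mulr_ge0// /kk.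
  by case: ifP => // _; exact: expR_ge0.
- by rewrite nnegrE mulr_ge0 ?expR_ge0.
apply: (le_trans (cauchy_schwarz L2v Lk)).
rewrite exprMn sqr_sqrtr; last by rewrite divr_ge0 ?mulr_ge0// ltW.
have -> : E * M / (2 * k * m) * expR (k * t) ^+ 2 = E * (expR (2 * k * t) / (2 * k * sg)).
  rewrite (_ : 2 * k * t = k * t + k * t); last by ring.
  by rewrite expRD /sg; field; rewrite !gt_eqF.
apply: ler_pM => //.
- by apply: Int_ge0 => x; exact: sqr_ge0.
- by apply: Int_ge0 => x; exact: sqr_ge0.
- exact: influx_le iv.
- by rewrite k2E.
Qed.

End Influx.

(** * Characteristics of the nonlocal speed *)

Section Flow.
Context {R : realType}.
Local Notation mu := (@lebesgue_measure R).
Implicit Types (v xi f g : R -> R) (t s r a b : R).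

Lemma integrable_realD (D : set R) f g : measurable D ->
  mu.-integrable D (EFin \o f) -> mu.-integrable D (EFin \o g) ->
  mu.-integrable D (EFin \o (fun x => f x + g x)).
Proof. by move=> mD; exact: integrableD. Qed.

Lemma integrable_realB (D : set R) f g : measurable D ->
  mu.-integrable D (EFin \o f) -> mu.-integrable D (EFin \o g) ->
  mu.-integrable D (EFin \o (fun x => f x - g x)).
Proof. by move=> mD; exact: integrableB. Qed.

Lemma integrable_realZ (D : set R) f k : measurable D ->
  mu.-integrable D (EFin \o f) -> mu.-integrable D (EFin \o (fun x => k * f x)).
Proof. by move=> mD; exact: integrableZl. Qed.

Lemma L1_ifP (i : interval R) f :
  L1 (fun x => if x \in i then f x else 0) <-> mu.-integrable [set` i] (EFin \o f).
Proof.
rewrite /L1 (_ : EFin \o _ = (EFin \o f) \_ [set` i]).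
  exact: iff_sym (integrable_mkcond _ _).
by apply/funext => x /=; rewrite patchE mem_setE; case: ifP.
Qed.

Lemma bounded_integrable f C a b : measurable_fun setT f ->
  (forall x, `|f x| <= C) -> mu.-integrable `[a, b] (EFin \o f).
Proof.
move=> mf fC; apply/L1_ifP; apply: L1_dominated (L1_itv C a b) _.
  by apply: measurable_if_real => //; exact: measurable_mem_itv.
move=> x; rewrite indicE mem_setE; case: ifP => _; rewrite ?mulr1// normr0 mulr0.
by [].
Qed.

Lemma Int_itv_cst C a b : a <= b -> \int[mu]_(x in `[a, b]) C = C * (b - a).
Proof.
move=> ab; rewrite -Int_itv// IntE; apply: eq_Rintegral => x _.
by rewrite indicE mem_setE; case: ifP; rewrite ?mulr1 ?mulr0.
Qed.

Lemma Int_itv_bounds f m M a b : measurable_fun setT f ->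
  (forall x, m <= f x <= M) -> a <= b ->
  m * (b - a) <= \int[mu]_(x in `[a, b]) f x <= M * (b - a).
Proof.
move=> mf fmM ab; rewrite -!Int_itv_cst//.
have I1 : mu.-integrable `[a, b] (EFin \o f).
  apply: (@bounded_integrable f (`|m| + `|M|)) => // x.
  have /andP[h1 h2] := fmM x; rewrite ler_norml.
  have := ler_norm M; have := ler_norm (- m); rewrite normrN.
  have := normr_ge0 m; have := normr_ge0 M => *; apply/andP; split; lra.
have I2 C : mu.-integrable `[a, b] (EFin \o (fun=> C)).
  exact: (@bounded_integrable (fun=> C) `|C|).
apply/andP; split.
  by apply: le_Rintegral => // x _; case/andP: (fmM x).
by apply: le_Rintegral => // x _; case/andP: (fmM x).
Qed.

Lemma Int_itv_split f C a s t : measurable_fun setT f ->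
  (forall x, `|f x| <= C) -> a <= s -> s <= t ->
  \int[mu]_(x in `[a, t]) f x - \int[mu]_(x in `[a, s]) f x =
  \int[mu]_(x in `[s, t]) f x.
Proof.
move=> mf fC as_ st; have I1 := @bounded_integrable f C _ _ mf fC.
rewrite Rintegral_itvB ?bnd_simp// Rintegral_itv_obnd_cbnd//.
by apply: integrableS (I1 s t) => //; apply: subset_itvr; rewrite bnd_simp.
Qed.

Lemma le_half_pow (a b C : R) : (forall n, a <= b + C / 2 ^+ n) -> a <= b.
Proof.
move=> H; apply/ler_addgt0Pr => e e0.
have [n] : exists n, `|C| / e < n%:R.
  by exists (Num.bound (`|C| / e)); rewrite archi_boundP// divr_ge0// ltW.
move=> hn; apply: (le_trans (H n)); rewrite lerD2l ler_pdivrMr ?exprn_gt0//.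
apply: (le_trans (ler_norm _)); rewrite mulrC -ler_pdivrMr//.
apply: (le_trans (ltW hn)); rewrite -natrX ler_nat; exact/ltnW/ltn_expl.
Qed.

(** The sequences [x n - 2 C / 2^n] and [x n + 2 C / 2^n] are adjacent. *)
Lemma geometric_limit (x : nat -> R) C :
  (forall n, `|x n.+1 - x n| <= C / 2 ^+ n) ->
  exists y, forall n, `|y - x n| <= 2 * C / 2 ^+ n.
Proof.
move=> H; pose u n := x n - 2 * C / 2 ^+ n; pose w n := x n + 2 * C / 2 ^+ n.
have pS n : 2 * C / 2 ^+ n.+1 = C / 2 ^+ n :> R by rewrite exprS; field; rewrite expf_neq0.
have C0 : 0 <= C by have := H 0; rewrite expr0 divr1; exact: le_trans.
have C2 n : 0 <= C / 2 ^+ n by rewrite divr_ge0// exprn_ge0.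
have uS n : u n <= u n.+1.
  rewrite /u pS; have := H n; rewrite ler_norml => /andP[h _].
  by rewrite -mulrA; have := C2 n; lra.
have wS n : w n.+1 <= w n.
  rewrite /w pS; have := H n; rewrite ler_norml => /andP[_ h].
  by rewrite -mulrA; have := C2 n; lra.
have um p q : (p <= q)%N -> u p <= u q.
  by apply: (@homo_leq _ u (fun a b => a <= b)) => // a b c; exact: le_trans.
have wm p q : (p <= q)%N -> w q <= w p.
  by apply: (@homo_leq _ w (fun a b => b <= a)) => // a b c ab bc; exact: le_trans bc ab.
have uw p q : u p <= w q.
  apply: (le_trans (um _ _ (leq_maxl p q))); apply: le_trans (wm _ _ (leq_maxr p q)).
  by rewrite /u /w -mulrA; have := C2 (maxn p q); lra.
exists (sup (range u)) => n.
have s1 : u n <= sup (range u).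
  apply: ub_le_sup; last by exists n.
  by exists (w 0); move=> _ [k _ <-].
have s2 : sup (range u) <= w n.
  by apply: ge_sup; [exists (u 0), 0%N|move=> _ [k _ <-]].
by rewrite ler_norml; move: s1 s2; rewrite /u /w => s1 s2; apply/andP; split; lra.
Qed.

(** The distance covered at speed [g] from time 0 on, and at unit speed
    before, so that [trajectory g t = t] for [t <= 0] and a label [r <= 0]
    is minus an initial position. *)
Definition trajectory (g : R -> R) t := Num.min t 0 + \int[mu]_(s in `[0, t]) g s.

Lemma trajectory_neg g t : t <= 0 -> trajectory g t = t.
Proof.
move=> t0; rewrite /trajectory min_l//; move: t0; rewrite le_eqVlt.
move=> /predU1P[->|t0]; first by rewrite set_itv1 Rintegral_set1 addr0.
by rewrite set_itv_ge ?bnd_simp -?ltNge// Rintegral_set0 addr0.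
Qed.

Lemma trajectory_pos g t : 0 <= t -> trajectory g t = \int[mu]_(s in `[0, t]) g s.
Proof. by move=> t0; rewrite /trajectory min_r// add0r. Qed.

(** The conditions [m <= 1 <= M] come from the unit speed before time 0. *)
Lemma trajectory_bilip g m M : 0 <= m -> m <= 1 -> 1 <= M -> measurable_fun setT g ->
  (forall s, m <= g s <= M) -> bilip m M (trajectory g).
Proof.
move=> m0 m1 M1 mg bg s t st.
have ng x : `|g x| <= M.
  by have /andP[h1 h2] := bg x; rewrite ger0_norm// (le_trans m0).
have [t0|/ltW t0] := leP t 0.
  rewrite !trajectory_neg ?(le_trans st)//.
  by rewrite ler_piMl ?subr_ge0//= ler_peMl ?subr_ge0.
have [s0|/ltW s0] := leP s 0; last first.
  rewrite !trajectory_pos// (Int_itv_split mg ng)//.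
  exact: Int_itv_bounds.
rewrite trajectory_pos// trajectory_neg//.
have /andP[] := Int_itv_bounds mg bg t0; rewrite subr0 => h1 h2.
have e1 : m * - s <= - s by rewrite ler_piMl ?oppr_ge0.
have e2 : - s <= M * - s by rewrite ler_peMl ?oppr_ge0.
by apply/andP; split; lra.
Qed.

Lemma trajectory_derive g (C : R) t : continuous g -> (forall x, `|g x| <= C) -> 0 < t ->
  is_derive t (1 : R) (trajectory g) (g t).
Proof.
move=> cg gC t0; have mg : measurable_fun setT g by exact: continuous_measurable_fun.
pose F x := \int[mu]_(s in `[0, x]) g s.
have [dF F'] : derivable F t 1 /\ (F^`())%classic t = g t.
  apply: (@continuous_FTC1_closed _ g 0 t (t + 1)) => //.
  - by rewrite ltrDl.
  - exact: bounded_integrable mg gC.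
  - exact: cg.
have FE : \near t, F t = trajectory g t.
  near=> x; rewrite trajectory_pos//; near: x.
  by apply: filterS (lt_nbhsr t0) => x /ltW.
have e : 'D_(1 : R) F t = g t by rewrite -derive1E.
exact: (near_eq_is_derive FE (DeriveDef dF e)).
Unshelve. all: by end_near. Qed.

Variables (lam : R -> R) (m M L : R).
Hypotheses (m0 : 0 < m) (m1 : m <= 1) (M1 : 1 <= M) (L0 : 0 <= L).
Hypothesis lam_bounds : forall w, m <= lam w <= M.
Hypothesis lam_lip : forall w w', `|lam w - lam w'| <= L * `|w - w'|.

Lemma lam_continuous : continuous lam.
Proof.
move=> x; apply/cvgrPdist_lt => e e0; have Lp : 0 < L + 1 by rewrite ltr_wpDl.
near=> y; apply: (le_lt_trans (lam_lip _ _)).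
apply: (@le_lt_trans _ _ ((L + 1) * `|x - y|)).
  by apply: ler_wpM2r => //; lra.
rewrite mulrC -ltr_pdivlMr//.
near: y; apply: (@cvgr_dist_lt _ R^o); rewrite ?divr_gt0//.
Unshelve. all: by end_near. Qed.

Definition speed v xi s := lam (mass v xi s).

Definition flow v xi := trajectory (speed v xi).

Variables (T E : R).

Lemma mass_continuous v xi : influx T E v -> bilip m M xi ->
  continuous (mass v xi).
Proof.
move=> iv xib x.
have cp := prim_continuous (influx_L2 iv) (influx_L1 iv).
apply: continuousB; first exact: cp.
apply: continuous_comp; last exact: cp.
have M0 := bilip_gt0 m0 xib.
by apply: (bilip_continuous _ (back_bilip m0 xib)); rewrite mulr_gt0 ?invr_gt0.
Qed.

Lemma speed_continuous v xi : influx T E v -> bilip m M xi ->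
  continuous (speed v xi).
Proof.
move=> iv xib x; apply: continuous_comp; first exact: mass_continuous.
exact: lam_continuous.
Qed.

Lemma speed_measurable v xi : influx T E v -> bilip m M xi ->
  measurable_fun setT (speed v xi).
Proof. by move=> iv xib; apply: continuous_measurable_fun; exact: speed_continuous. Qed.

Lemma speed_norm v xi s : `|speed v xi s| <= M.
Proof.
have /andP[h1 h2] := lam_bounds (mass v xi s).
by rewrite ger0_norm// (le_trans (ltW m0)).
Qed.

Lemma flow_neg v xi t : t <= 0 -> flow v xi t = t.
Proof. exact: trajectory_neg. Qed.

Lemma flow_pos v xi t : 0 <= t -> flow v xi t = \int[mu]_(s in `[0, t]) speed v xi s.
Proof. exact: trajectory_pos. Qed.

Lemma flow_bilip v xi : influx T E v -> bilip m M xi -> bilip m M (flow v xi).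
Proof.
move=> iv xib; apply: trajectory_bilip => //.
- exact: ltW.
- exact: speed_measurable.
- by move=> s; exact: lam_bounds.
Qed.

Lemma Int_speed_dist v1 v2 xi1 xi2 t : influx T E v1 -> influx T E v2 ->
  bilip m M xi1 -> bilip m M xi2 ->
  `|\int[mu]_(s in `[0, t]) speed v1 xi1 s - \int[mu]_(s in `[0, t]) speed v2 xi2 s|
  <= L * \int[mu]_(s in `[0, t]) `|mass v1 xi1 s - mass v2 xi2 s|.
Proof.
move=> i1 i2 b1 b2.
have S1 := bounded_integrable 0 t (speed_measurable i1 b1) (speed_norm v1 xi1).
have S2 := bounded_integrable 0 t (speed_measurable i2 b2) (speed_norm v2 xi2).
rewrite -RintegralB//.
have LB : mu.-integrable `[0, t] (EFin \o (fun x => speed v1 xi1 x - speed v2 xi2 x)).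
  exact: integrable_realB.
apply: (le_trans (le_normr_Rintegral _ LB)) => //.
have Lm : mu.-integrable `[0, t] (EFin \o (fun s => `|mass v1 xi1 s - mass v2 xi2 s|)).
  apply: continuous_compact_integrable; first exact: segment_compact.
  apply: continuous_subspaceT => x.
  by apply: cvg_norm; apply: cvgB; exact: mass_continuous.
rewrite -RintegralZl//; apply: le_Rintegral => //.
- exact: integrable_norm.
- exact: integrable_realZ.
- by move=> x _; exact: lam_lip.
Qed.

Variable k : R.
Hypothesis k0 : 0 < k.
Hypothesis kE : L * (2 / m * Num.sqrt (E * M / (2 * k * m))) <= 1 / 2.

(** By [kE] the constant of [mass_contraction] is at most [1 / 2]. *)
Lemma flow_contraction v xi1 xi2 N t : influx T E v -> 0 <= N ->
  bilip m M xi1 -> bilip m M xi2 ->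
  (forall s, s <= t -> `|xi1 s - xi2 s| <= N * expR (k * s)) ->
  L * \int[mu]_(s in `[0, t]) `|mass v xi1 s - mass v xi2 s| <= N / 2 * expR (k * t).
Proof.
move=> iv N0 b1 b2 H.
have /(ler_wpM2l L0) h := mass_contraction iv m0 N0 k0 b1 b2 H.
apply: (le_trans h); rewrite mulrA.
have P : 0 <= N * expR (k * t) by rewrite mulr_ge0 ?expR_ge0.
by have := ler_wpM2r P kE; lra.
Qed.

(** The fixed points of [flow], up to time [S]: the speed of a given weak
    solution is known on a bounded interval of time only. *)
Definition characteristic v xi S := [/\ bilip m M xi,
  forall t, t <= 0 -> xi t = t &
  forall t, 0 <= t <= S -> xi t = \int[mu]_(s in `[0, t]) speed v xi s].

(** Picard iteration from the identity: by [flow_contraction], each step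
    halves the distance for the norm [sup_t exp (- k t) |xi t|]. The
    bi-Lipschitz bounds are closed under pointwise limits. *)
Lemma characteristic_exists v : influx T E v ->
  exists xi, forall S, characteristic v xi S.
Proof.
move=> iv; pose x n := iter n (flow v) (id : R -> R).
have xb n : bilip m M (x n).
  elim: n => [s t st|n IH]; last exact: flow_bilip.
  by rewrite /x /= ler_piMl ?subr_ge0//= ler_peMl ?subr_ge0.
have xS p s : x p.+1 s = flow v (x p) s by [].
pose N0 := (M + 1) / k.
have M10 : 0 <= M + 1 by rewrite addr_ge0 ?(le_trans _ M1).
have N00 : 0 <= N0 by rewrite divr_ge0// ltW.
(* the first step moves by at most (M + 1) t, and k t <= exp (k t) *)
have step n t : `|x n.+1 t - x n t| <= N0 * expR (k * t) / 2 ^+ n.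
  elim: n t => [|n IH] t.
    rewrite expr0 divr1 /x /=.
    have [t0|/ltW t0] := leP t 0.
      by rewrite flow_neg// subrr normr0 mulr_ge0 ?expR_ge0.
    have bS y : m <= speed v id y <= M := lam_bounds _.
    have /andP[] := Int_itv_bounds (speed_measurable iv (xb 0)) bS t0.
    rewrite flow_pos// subr0 => h1 h2.
    have e := expR_ge1Dx (k * t).
    apply: (@le_trans _ _ ((M + 1) * t)).
      have := mulr_ge0 (ltW m0) t0.
      by rewrite ler_norml; move=> ?; apply/andP; split; lra.
    rewrite /N0 -mulrA ler_wpM2l// mulrC ler_pdivlMr// mulrC.
    by apply: le_trans e; rewrite lerDr.
  have -> : N0 * expR (k * t) / 2 ^+ n.+1 = N0 / 2 ^+ n / 2 * expR (k * t).
    by rewrite exprS; field; rewrite expf_neq0.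
  have P : 0 <= N0 / 2 ^+ n by rewrite divr_ge0// exprn_ge0.
  have [t0|/ltW t0] := leP t 0.
    by rewrite !xS !flow_neg// subrr normr0 mulr_ge0 ?expR_ge0// divr_ge0.
  rewrite (xS n.+1) [X in _ - X](xS n) !flow_pos//.
  apply: le_trans (Int_speed_dist t iv iv (xb _) (xb _)) _.
  apply: flow_contraction => // s _.
  by have := IH s; rewrite mulrAC.
have lims t : exists y, forall n, `|y - x n t| <= 2 * (N0 * expR (k * t)) / 2 ^+ n.
  by apply: geometric_limit => n; exact: step.
have [xi xiP] := choice lims.
have xib : bilip m M xi.
  move=> s t st.
  have Q n : m * (t - s) <= x n t - x n s <= M * (t - s) := xb n _ _ st.
  pose C := 2 * (N0 * expR (k * t)) + 2 * (N0 * expR (k * s)).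
  have D n : `|(xi t - xi s) - (x n t - x n s)| <= C / 2 ^+ n.
    rewrite /C mulrDl (_ : _ - _ = (xi t - x n t) - (xi s - x n s)); last by ring.
    by apply: (le_trans (ler_normB _ _)); apply: lerD.
  apply/andP; split; apply: (@le_half_pow _ _ C) => n.
    by have := D n; have := Q n; rewrite ler_norml => /andP[? ?] /andP[? ?]; lra.
  by have := D n; have := Q n; rewrite ler_norml => /andP[? ?] /andP[? ?]; lra.
have fix_ t : flow v xi t = xi t.
  apply/eqP; rewrite -subr_eq0 -normr_le0.
  apply: (@le_half_pow _ _ (2 * (N0 * expR (k * t)))) => n; rewrite add0r.
  have h1 : `|flow v xi t - x n.+1 t| <= N0 / 2 ^+ n * expR (k * t).
    have P : 0 <= N0 / 2 ^+ n by rewrite divr_ge0// exprn_ge0.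
    have [t0|/ltW t0] := leP t 0.
      by rewrite !xS !flow_neg// subrr normr0 mulr_ge0 ?expR_ge0// divr_ge0.
    rewrite xS !flow_pos//.
    apply: le_trans (Int_speed_dist t iv iv xib (xb _)) _.
    have -> : N0 / 2 ^+ n * expR (k * t) = (2 * (N0 / 2 ^+ n)) / 2 * expR (k * t).
      by field; rewrite expf_neq0.
    apply: flow_contraction => //; first by rewrite mulr_ge0.
    by move=> s _; have := xiP s n; rewrite [2 * (_ * expR _)]mulrA mulrAC mulrA.
  have h2 := xiP t n.+1.
  have e : 2 * (N0 * expR (k * t)) / 2 ^+ n.+1 = N0 * expR (k * t) / 2 ^+ n :> R.
    by rewrite exprS; field; rewrite expf_neq0.
  rewrite e in h2.
  rewrite (_ : flow v xi t - xi t = (flow v xi t - x n.+1 t) - (xi t - x n.+1 t)); last by ring.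
  apply: (le_trans (ler_normB _ _)).
  have : N0 / 2 ^+ n * expR (k * t) = N0 * expR (k * t) / 2 ^+ n by ring.
  by lra.
exists xi => S; split=> // t; first by move=> t0; rewrite -fix_ flow_neg.
by move=> /andP[t0 _]; rewrite -fix_ flow_pos.
Qed.

(** The difference is the effect of changing the characteristic, which is
    contracted by [1 / 2], plus that of changing the primitive of [v], which
    is at most [D] up to the weight. A bound [N] thus improves to [N / 2 +
    D]; iterated from the crude bound [2 M S], this leaves [2 D]. *)
Lemma characteristic_stable v1 v2 xi1 xi2 S d : 0 <= S -> 0 <= d ->
  influx T E v1 -> influx T E v2 ->
  (forall t, `|prim v1 t - prim v2 t| <= d) ->
  characteristic v1 xi1 S -> characteristic v2 xi2 S ->
  forall t, t <= S -> `|xi1 t - xi2 t| <= 4 * L * S * d * expR (k * t).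
Proof.
move=> S0 d0 i1 i2 vd [b1 z1 e1] [b2 z2 e2] t tS.
have kt s : 0 <= s -> 1 <= expR (k * s).
  by move=> s0; apply: le_trans (expR_ge1Dx _); rewrite lerDl mulr_ge0// ltW.
pose D := 2 * L * S * d.
have D0 : 0 <= D by rewrite /D !mulr_ge0.
have md s : `|mass v1 xi2 s - mass v2 xi2 s| <= 2 * d.
  rewrite /mass (_ : _ - _ = (prim v1 s - prim v2 s) -
    (prim v1 (back xi2 s) - prim v2 (back xi2 s))); last by ring.
  by apply: (le_trans (ler_normB _ _)); have := vd s; have := vd (back xi2 s); lra.
have mi w xi w' xi' t' : influx T E w -> bilip m M xi -> influx T E w' -> bilip m M xi' ->
    mu.-integrable `[0, t'] (EFin \o (fun s => `|mass w xi s - mass w' xi' s|)).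
  move=> iw bx iw' bx'.
  apply: continuous_compact_integrable; first exact: segment_compact.
  apply: continuous_subspaceT => x.
  by apply: cvg_norm; apply: cvgB; exact: mass_continuous.
have step N : 0 <= N -> (forall s, s <= S -> `|xi1 s - xi2 s| <= N * expR (k * s)) ->
    forall s, s <= S -> `|xi1 s - xi2 s| <= (N / 2 + D) * expR (k * s).
  move=> N0 H s sS.
  have [s0|/ltW s0] := leP s 0.
    by rewrite z1// z2// subrr normr0 mulr_ge0 ?expR_ge0// addr_ge0// divr_ge0.
  rewrite e1 ?s0// e2 ?s0//; apply: (le_trans (Int_speed_dist s i1 i2 b1 b2)).
  have c1 : L * \int[mu]_(r in `[0, s]) `|mass v1 xi1 r - mass v1 xi2 r| <= N / 2 * expR (k * s).
    by apply: flow_contraction => // r rs; apply: H; exact: le_trans sS.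
  have c2 : \int[mu]_(r in `[0, s]) `|mass v1 xi2 r - mass v2 xi2 r| <= 2 * d * s.
    rewrite -[s in leRHS]subr0 -Int_itv_cst//; apply: le_Rintegral => //.
      exact: mi.
    exact: (@bounded_integrable (fun=> 2 * d) `|2 * d|).
  have c3 : \int[mu]_(r in `[0, s]) `|mass v1 xi1 r - mass v2 xi2 r| <=
     \int[mu]_(r in `[0, s]) `|mass v1 xi1 r - mass v1 xi2 r| +
     \int[mu]_(r in `[0, s]) `|mass v1 xi2 r - mass v2 xi2 r|.
    rewrite -RintegralD//; [|exact: mi|exact: mi].
    apply: le_Rintegral => //; first exact: mi.
      by apply: integrable_realD => //; exact: mi.
    move=> r _; rewrite (_ : mass v1 xi1 r - mass v2 xi2 r = (mass v1 xi1 r - mass v1 xi2 r) +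
       (mass v1 xi2 r - mass v2 xi2 r)); last by ring.
    exact: ler_normD.
  apply: (le_trans (ler_wpM2l L0 c3)); rewrite mulrDr mulrDl lerD//.
  apply: (le_trans (ler_wpM2l L0 c2)); rewrite /D.
  have q : L * (2 * d * s) <= 2 * L * S * d.
    by rewrite (_ : L * (2 * d * s) = 2 * L * d * s) 1?(_ : 2 * L * S * d = 2 * L * d * S);
      [rewrite ler_wpM2l// !mulr_ge0|ring|ring].
  by apply: (le_trans q); rewrite ler_peMr ?kt// !mulr_ge0.
have base s : s <= S -> `|xi1 s - xi2 s| <= (2 * M * S) * expR (k * s).
  move=> sS; have [s0|/ltW s0] := leP s 0.
    by rewrite z1// z2// subrr normr0 mulr_ge0 ?expR_ge0// !mulr_ge0 ?(le_trans _ M1).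
  have /andP[h1 h2] := b1 _ _ s0; have /andP[h3 h4] := b2 _ _ s0.
  move: h1 h2 h3 h4; rewrite (z1 0)// (z2 0)// !subr0 => h1 h2 h3 h4.
  apply: (@le_trans _ _ (2 * M * S)); last first.
    by rewrite ler_peMr ?kt// !mulr_ge0 ?(le_trans _ M1).
  have := mulr_ge0 (ltW m0) s0.
  have : M * s <= M * S by rewrite ler_wpM2l ?(le_trans _ M1).
  by move=> *; rewrite ler_norml; apply/andP; split; lra.
have it n s : s <= S -> `|xi1 s - xi2 s| <= (2 * M * S / 2 ^+ n + 2 * D) * expR (k * s).
  elim: n s => [|n IH] s sS.
    rewrite expr0 divr1; apply: (le_trans (base s sS)).
    by rewrite ler_wpM2r ?expR_ge0// lerDl mulr_ge0.
  have P : 0 <= 2 * M * S / 2 ^+ n + 2 * D.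
    by rewrite addr_ge0 ?mulr_ge0 ?invr_ge0 ?exprn_ge0 ?(le_trans _ M1).
  have := step _ P IH s sS; move/le_trans; apply.
  rewrite ler_wpM2r ?expR_ge0// exprS.
  rewrite (_ : 2 * M * S / (2 * 2 ^+ n) = 2 * M * S / 2 ^+ n / 2); first lra.
  by field; rewrite expf_neq0.
apply: (@le_half_pow _ _ (2 * M * S * expR (k * t))) => n.
apply: (le_trans (it n t tS)); rewrite /D.
rewrite (_ : 2 * M * S * expR (k * t) / 2 ^+ n = 2 * M * S / 2 ^+ n * expR (k * t)); last by ring.
lra.
Qed.

(** The first term compares two primitives at the same labels. The second
    compares one primitive at the two labels [back xi1 t] and [back xi2 t],
    which [characteristic_stable] makes close. *)
Lemma characteristic_mass_stable v1 v2 xi1 xi2 S d : 0 <= S -> 0 <= d ->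
  influx T E v1 -> influx T E v2 ->
  (forall t, `|prim v1 t - prim v2 t| <= d) ->
  characteristic v1 xi1 S -> characteristic v2 xi2 S ->
  forall t, t <= S -> `|mass v1 xi1 t - mass v2 xi2 t| <=
    2 * d + Num.sqrt (E * (2 / m * (4 * L * S * expR (k * S))) * d).
Proof.
move=> S0 d0 i1 i2 vd c1 c2 t tS.
have st := characteristic_stable S0 d0 i1 i2 vd c1 c2.
have [b1 z1 e1] := c1; have [b2 z2 e2] := c2.
set D := 4 * L * S * expR (k * S).
have stD s : s <= S -> `|xi1 s - xi2 s| <= D * d.
  move=> sS; apply: (le_trans (st s sS)); rewrite /D.
  rewrite -mulrA [X in _ * X]mulrC mulrA ler_wpM2r// ler_wpM2l ?mulr_ge0//.
  by rewrite ler_expR ler_wpM2l// ltW.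
have a1 := xi_back m0 b1 t; have a2 := xi_back m0 b2 t.
have bd : `|back xi1 t - back xi2 t| <= 2 / m * D * d.
  have /andP[h _] := bilip_dist (back xi2 t) (back xi1 t) m0 b1.
  rewrite -(ler_pM2l m0); apply: (le_trans h).
  rewrite (_ : m * (2 / m * D * d) = 2 * (D * d)); last by field; rewrite gt_eqF.
  rewrite (_ : xi1 (back xi1 t) - xi1 (back xi2 t) = (xi1 t - xi2 t) -
     (xi1 (back xi2 t) - xi2 (back xi2 t))); last by rewrite a1 a2; ring.
  apply: (le_trans (ler_normB _ _)).
  have := stD t tS; have := stD _ (le_trans (back_le m0 b2 t) tS); lra.
rewrite /mass (_ : _ - _ = ((prim v1 t - prim v2 t) -
    (prim v1 (back xi2 t) - prim v2 (back xi2 t))) +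
    (prim v1 (back xi2 t) - prim v1 (back xi1 t))); last by ring.
apply: (le_trans (ler_normD _ _)); apply: lerD.
  apply: (le_trans (ler_normB _ _)).
  by have := vd t; have := vd (back xi2 t); lra.
have E0 : 0 <= E.
  by apply: le_trans (influx_le i1); apply: Int_ge0 => x; exact: sqr_ge0.
have D0 : 0 <= D by rewrite /D !mulr_ge0 ?expR_ge0.
have P : 0 <= E * (2 / m * D) * d by rewrite !mulr_ge0 ?invr_ge0// ltW.
apply: (bounded_primC (influx_L2 i1) (influx_L1 i1) (influx_le i1)) => //.
rewrite sqr_sqrtr// -!mulrA ler_wpM2l// distrC.
by move: bd; rewrite -!mulrA distrC.
Qed.

End Flow.

(** The left-hand side is of order [k^(-1/2)]. *)
Lemma rate_exists (R : realType) (L m M E : R) : 0 < m -> 1 <= M -> 0 <= L -> 0 <= E ->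
  exists2 k, 0 < k & L * (2 / m * Num.sqrt (E * M / (2 * k * m))) <= 1 / 2.
Proof.
move=> m0 M1 L0 E0; pose c := (4 * L / m) ^+ 2 * (E * M / (2 * m)).
have c0 : 0 <= c by rewrite mulr_ge0 ?sqr_ge0// divr_ge0 ?mulr_ge0 ?(ltW m0)//; lra.
have k0 : 0 < c + 1 by lra.
exists (c + 1) => //.
have h : 4 * L / m * Num.sqrt (E * M / (2 * (c + 1) * m)) <= 1.
  rewrite -(ler_pXn2r (_ : 0 < 2)%N)//; last 2 first.
  - by rewrite nnegrE !mulr_ge0 ?invr_ge0// ltW.
  - by rewrite nnegrE.
  rewrite exprMn sqr_sqrtr ?expr1n; last first.
    by rewrite divr_ge0 ?mulr_ge0 ?(ltW m0) ?(ltW k0)//; lra.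
  have -> d : (4 * L / m) ^+ 2 * (E * M / (2 * d * m)) = c / d.
    by rewrite /c !invfM; ring.
  by rewrite ler_pdivrMr//; lra.
have -> : L * (2 / m * Num.sqrt (E * M / (2 * (c + 1) * m))) =
  (4 * L / m * Num.sqrt (E * M / (2 * (c + 1) * m))) / 2 by field; rewrite gt_eqF.
lra.
Qed.

(** * Lebesgue spaces and the glued data *)

Section LpTools.
Context {R : realType}.
Local Notation mu := (@lebesgue_measure R).
Implicit Types (f g : R -> R) (t s r a b c e C : R) (D : set R).

Lemma in_L1P D f : measurable D ->
  in_Lp 1%:E D f <-> mu.-integrable D (EFin \o f).
Proof.
move=> mD; rewrite /in_Lp Lfun1_integrable -restrict_EFin.
by apply: iff_sym; exact: integrable_mkcond.
Qed.

Lemma in_L2P D f : measurable D -> in_Lp 2%:E D f <-> L2 (f \_ D).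
Proof.
move=> mD; split=> [|[mf Lf]].
  move=> h; split; last exact: Lfun2_integrable_sqr.
  by move: h; rewrite /in_Lp inE => /andP[]; rewrite inE.
rewrite /in_Lp inE; apply/andP; split; rewrite inE//=.
rewrite /finite_norm unlock poweR_lty//.
have /integrableP[_] := Lf; apply: le_lt_trans.
rewrite le_eqVlt; apply/orP; left; apply/eqP; apply: eq_integral => x _ /=.
by rewrite -[2]/(2%:R) powR_mulrn// normrX.
Qed.

Lemma Lnorm2E f : L2 f ->
  ('N[mu]_2%:E[EFin \o f] = (Num.sqrt (\int[mu]_x f x ^+ 2))%:E)%E.
Proof.
move=> [mf Lf]; rewrite unlock.
rewrite (_ : (\int[mu]_x _)%E = (\int[mu]_x f x ^+ 2)%:E).
  by rewrite poweR_EFin -powR12_sqrt//; apply: Int_ge0 => x; exact: sqr_ge0.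
rewrite /Rintegral fineK; last exact: (integrable_fin_num measurableT Lf).
apply: eq_integral => x _ /=.
by rewrite -[2]/(2%:R) powR_mulrn// -normrX ger0_norm// sqr_ge0.
Qed.

Lemma Int_sqr_patch D f : \int[mu]_(x in D) f x ^+ 2 = \int[mu]_x (f \_ D) x ^+ 2.
Proof.
rewrite Rintegral_mkcond; apply: eq_Rintegral => x _; rewrite !patchE.
by case: ifP => // _; rewrite expr0n.
Qed.

Lemma integrableM_bounded D f g C : measurable D -> mu.-integrable D (EFin \o f) ->
  measurable_fun D g -> (forall x, D x -> `|g x| <= C) ->
  mu.-integrable D (EFin \o (fun x => f x * g x)).
Proof.
move=> mD If mg gC.
apply: (@le_integrable _ _ _ mu D mD _ (EFin \o (fun x => C * `|f x|))).
- apply/measurable_EFinP; apply: measurable_funM => //.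
  by have /measurable_int/measurable_EFinP := If.
- move=> x Dx /=; rewrite lee_fin normrM mulrC.
  have C0 : 0 <= C by apply: le_trans (gC x Dx).
  by rewrite [leRHS]ger0_norm ?mulr_ge0// ler_wpM2r// gC.
- by apply: integrable_realZ => //; exact: integrable_norm.
Qed.

Lemma Int_normM_le D f g C : measurable D -> mu.-integrable D (EFin \o f) ->
  measurable_fun D g -> (forall x, D x -> `|g x| <= C) ->
  `|\int[mu]_(x in D) (f x * g x)| <= C * \int[mu]_(x in D) `|f x|.
Proof.
move=> mD If mg gC; have I := integrableM_bounded mD If mg gC.
apply: (le_trans (le_normr_Rintegral _ I)) => //.
rewrite -RintegralZl//; last exact: integrable_norm.
apply: le_Rintegral => //.
- exact: integrable_norm.
- by apply: integrable_realZ => //; exact: integrable_norm.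
- by move=> x Dx; rewrite normrM mulrC ler_wpM2r// gC.
Qed.

Lemma C0_L1_near (A D : set R) (g : R -> R -> R) s0 e : measurable D ->
  C0_Lp 1%:E A D g -> A s0 -> 0 < e ->
  \forall s \near within A (nbhs s0), \int[mu]_(x in D) `|g s x - g s0 x| < e.
Proof.
move=> mD [gL gC] As0 e0; have := gC _ As0.
move=> /fine_cvgP[fin /cvgrPdist_lt /(_ _ e0)].
apply: filterS => s; rewrite /= sub0r normrN -[1%:E]/1%E Lnorm1 => h.
apply: le_lt_trans h; apply: le_trans (ler_norm _).
rewrite Rintegral_mkcond /Rintegral le_eqVlt; apply/orP; left; apply/eqP; congr fine.
apply: eq_integral => x _; rewrite /= !patchE; case: ifP => _ //.
by rewrite normr0.
Qed.

Lemma C0_L2_near (A D : set R) (g : R -> R -> R) s0 e : measurable D ->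
  C0_Lp 2%:E A D g -> A s0 -> 0 < e ->
  \forall s \near within A (nbhs s0), A s ->
    \int[mu]_(x in D) (g s x - g s0 x) ^+ 2 < e.
Proof.
move=> mD [gL gC] As0 e0; have := gC _ As0.
have se0 : 0 < Num.sqrt e by rewrite sqrtr_gt0.
move=> /fine_cvgP[fin /cvgrPdist_lt /(_ _ se0)].
apply: filterS => s; rewrite sub0r normrN /= => h As.
have L : L2 ((fun x => g s x - g s0 x) \_ D).
  rewrite (_ : _ \_ D = (fun x => (g s \_ D) x - (g s0 \_ D) x)).
    by apply: L2B; apply/in_L2P => //; exact: gL.
  by apply/funext => x; rewrite !patchE; case: ifP => // _; rewrite subr0.
move: h; rewrite Lnorm2E// /= ger0_norm ?sqrtr_ge0// ltr_sqrt//.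
by rewrite -Int_sqr_patch.
Qed.

Lemma ae_neq c : {ae mu, forall x, x != c}.
Proof.
exists [set c]; split => //; first exact: lebesgue_measure_set1.
by move=> x /= /negP; rewrite negbK => /eqP.
Qed.

Lemma Int_pow (j : nat) a : 0 <= a ->
  \int[mu]_(x in `[0, a]) (j.+1%:R * x ^+ j) = a ^+ j.+1.
Proof.
move=> a0; have [->|a1] := eqVneq a 0.
  by rewrite set_itv1 Rintegral_set1 expr0n.
have {a0 a1}a0 : 0 < a by rewrite lt_def a1.
have d (x : R) : is_derive x (1 : R) (fun y : R => y ^+ j.+1) (j.+1%:R * x ^+ j).
  rewrite (_ : (fun y : R => y ^+ j.+1) = (id : R -> R) ^+ j.+1); last first.
    by apply/funext => y; rewrite exprfctE.
  apply: (is_derive_eq (is_deriveX j.+1 (is_derive_id x 1))).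
  by rewrite /GRing.scale/= mulr1.
rewrite /Rintegral (@continuous_FTC2 _ _ (fun y : R => y ^+ j.+1))//.
- by rewrite -EFinB/= expr0n subr0.
- apply: continuous_subspaceT => x; apply: cvgM; first exact: cvg_cst.
  exact: exprn_continuous.
- split.
  + by move=> x _; case: (d x).
  + apply: cvg_at_right_filter; exact: exprn_continuous.
  + apply: cvg_at_left_filter; exact: exprn_continuous.
- by move=> x _; rewrite derive1E; case: (d x).
Qed.

(** The in-flux and the initial density as a function of the label. The
    positive parts make it nonnegative everywhere, and change data that are
    nonnegative almost everywhere on a negligible set only. *)
Definition vin (T : R) (rho0 u : R -> R) (r : R) : R :=
  if 0 < r <= T then Num.max (u r) 0
  else if -1 <= r <= 0 then Num.max (rho0 (- r)) 0 else 0.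

Let mN : measurable_fun setT (-%R : R -> R).
Proof. exact: measurable_funN. Qed.

Let reflE a b : a <= b -> (\int[mu]_(x in -%R @^-1` `]a, b]) 1%:E = (b - a)%:E)%E.
Proof.
move=> ab; rewrite opp_preimage_itvbndbnd/=.
transitivity (mu `[- b, - a[); first by rewrite integral_cst// mul1e.
rewrite lebesgue_measure_itv/=.
rewrite lte_fin ltrN2; move: ab; rewrite le_eqVlt => /predU1P[->|->].
  by rewrite ltxx subrr.
by rewrite opprK addrC.
Qed.

Lemma Int_reflect f : L1 f -> \int[mu]_x f x = \int[mu]_x f (- x).
Proof.
move=> Lf; rewrite (@Int_cov R (fun=> 1) _ _ -%R mN reflE f Lf)//.
by apply: eq_Rintegral => x _; rewrite mulr1.
Qed.

Lemma L1_reflect f : L1 f -> L1 (fun x => f (- x)).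
Proof.
move=> Lf; have m1 : measurable_fun setT (fun _ : R => 1 : R) by [].
have := (@L1_cov R (fun=> 1) m1 (fun=> ler01) -%R mN reflE f (L1_measurable Lf)).2 Lf.
by under eq_fun do rewrite mulr1; apply.
Qed.

Lemma vin_supp (T : R) (rho0 u : R -> R) r : 0 < T -> ~~ (-1 <= r <= T) ->
  vin T rho0 u r = 0.
Proof.
move=> T0; rewrite /vin => h; case: ifPn => [/andP[h1 h2]|_].
  by exfalso; move: h; rewrite h2 andbT -ltNge; lra.
case: ifPn => // /andP[h1 h2].
by exfalso; move: h; rewrite h1 /= -ltNge; lra.
Qed.

Section Vin.
Variables (T : R) (rho0 u : R -> R).
Hypotheses (T0 : 0 < T) (uL : in_Lp 2%:E `[0, T] u) (u0 : ae_nonneg `[0, T] u).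
Hypotheses (rL : in_Lp 2%:E `[0, 1] rho0) (r0 : ae_nonneg `[0, 1] rho0).

Let ub := u \_ `[0, T].
Let rb := rho0 \_ `[0, 1].
Let Lub : L2 ub. Proof. exact/in_L2P. Qed.
Let Lrb : L2 rb. Proof. exact/in_L2P. Qed.

Let vinE r : vin T rho0 u r =
  if 0 < r <= T then Num.max (ub r) 0
  else if -1 <= r <= 0 then Num.max (rb (- r)) 0 else 0.
Proof.
rewrite /vin; case: ifPn => [/andP[h1 h2]|_].
  by rewrite /ub patchE mem_setE in_itv/= (ltW h1) h2.
case: ifPn => // /andP[h1 h2].
by rewrite /rb patchE mem_setE in_itv/= ifT//; apply/andP; split; lra.
Qed.

Lemma vin_ge0 r : 0 <= vin T rho0 u r.
Proof. by rewrite /vin; case: ifP => _; [|case: ifP => _ //]; rewrite le_max lexx orbT. Qed.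

Let mub : measurable_fun setT (fun r => Num.max (ub r) 0).
Proof. by apply: measurable_maxr => //; case: Lub. Qed.

Let mrb : measurable_fun setT (fun r => Num.max (rb (- r)) 0).
Proof.
apply: measurable_maxr => //; apply: measurableT_comp mN; by case: Lrb.
Qed.

Lemma vin_measurable : measurable_fun setT (vin T rho0 u).
Proof.
rewrite (_ : vin T rho0 u = (fun r => if 0 < r <= T then Num.max (ub r) 0
  else if -1 <= r <= 0 then Num.max (rb (- r)) 0 else 0)); last exact/funext/vinE.
apply: measurable_if_real => //; first exact: measurable_between_lt.
by apply: measurable_if_real => //; exact: measurable_between.
Qed.

Let vin_sq r : vin T rho0 u r ^+ 2 <= ub r ^+ 2 + rb (- r) ^+ 2.
Proof.
have P (x y : R) : 0 <= y -> Num.max x 0 ^+ 2 <= x ^+ 2 + y.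
  by move=> y0; case: (leP x 0) => _; [rewrite expr0n addr_ge0// sqr_ge0|rewrite lerDl].
rewrite vinE; case: ifP => _; first by apply: P; exact: sqr_ge0.
case: ifP => _; first by rewrite addrC; apply: P; exact: sqr_ge0.
by rewrite expr0n addr_ge0// sqr_ge0.
Qed.

Lemma vin_influx E : \int[mu]_(t in `[0, T]) u t ^+ 2 + \int[mu]_(x in `[0, 1]) rho0 x ^+ 2 <= E ->
  influx T E (vin T rho0 u).
Proof.
move=> hE.
have e2 : \int[mu]_(t in `[0, 1]) rho0 t ^+ 2 = \int[mu]_r rb (- r) ^+ 2.
  rewrite -(@Int_reflect (fun x => rb x ^+ 2)); last by case: Lrb.
  exact: Int_sqr_patch.
have Lr : L1 (fun r => rb (- r) ^+ 2).
  by apply: (@L1_reflect (fun x => rb x ^+ 2)); case: Lrb.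
have Lu : L1 (fun r => ub r ^+ 2) by case: Lub.
have Lv : L1 (fun r => vin T rho0 u r ^+ 2).
  apply: L1_dominated (L1D Lu Lr) _.
    by apply: measurable_funX; exact: vin_measurable.
  by move=> r; rewrite ger0_norm ?sqr_ge0.
split => //.
- exact: vin_measurable.
- exact: vin_ge0.
- by move=> r; exact: vin_supp.
- apply: le_trans hE; rewrite (Int_sqr_patch _ u) e2 -RintegralD//.
  by apply: Int_le => //; exact: L1D.
Qed.

(** The boundary terms of the weak formulation become one integral over the
    labels, for a test function carried to the labels by [F t = phi t 0] and
    [F (- x) = phi 0 x]. *)
Lemma vin_pairing tau (F : R -> R) C : 0 <= tau <= T -> measurable_fun setT F ->
  (forall r, `|F r| <= C) ->
  \int[mu]_(t in `[0, tau]) (u t * F t) + \int[mu]_(x in `[0, 1]) (rho0 x * F (- x)) =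
  \int[mu]_r (if r <= tau then vin T rho0 u r * F r else 0).
Proof.
move=> /andP[tau0 tauT] mF FC.
have iv := vin_influx (lexx _).
have Lv := influx_L1 iv.
have Lub1 := L2_supported_L1 Lub (@patch_supported _ _ _ _).
have Lrb1 := L2_supported_L1 Lrb (@patch_supported _ _ _ _).
pose A r := if 0 < r <= tau then vin T rho0 u r * F r else 0.
pose B r := if -1 <= r <= 0 then vin T rho0 u r * F r else 0.
have LvF := L1M_bounded Lv mF FC.
have LA : L1 A by apply: L1_if => //; exact: measurable_between_lt.
have LB : L1 B by apply: L1_if => //; exact: measurable_between.
have -> : \int[mu]_r (if r <= tau then vin T rho0 u r * F r else 0) = \int[mu]_r A r + \int[mu]_r B r.
  rewrite -RintegralD//; apply: eq_Rintegral => r _; rewrite /A /B.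
  have [r1|r1] := leP r 0; rewrite /= ?andbT.
    rewrite (le_trans r1 tau0) add0r; case: ifPn => // h.
    by rewrite (influx_supp iv) ?mul0r// (negbTE h).
  by rewrite andbF addr0.
congr (_ + _).
  rewrite IntE; apply: Int_ae_eq.
  - rewrite (_ : (fun r => _) = (fun r => if r \in `[0, tau] then ub r * F r else 0)).
      apply: measurable_if_real => //; first exact: measurable_mem_itv.
      by apply: measurable_funM => //; exact: L1_measurable.
    apply/funext => r; rewrite in_itv/=; case: ifPn => // /andP[h1 h2].
    by rewrite /ub patchE mem_setE in_itv/= h1 (le_trans h2 tauT).
  - exact: L1_measurable.
  - apply: aeS (ae_and u0 (ae_neq 0)) => r [ur rn0].
    rewrite in_itv/= /A; have [r1|r1] := leP r 0 => /=.
      by case: ifP => // /andP[r2 _]; case/eqP: rn0; apply/le_anti; rewrite r1 r2.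
    rewrite (ltW r1) /=; case: ifP => // r2.
    rewrite /vin r1 (le_trans r2 tauT)/= max_l//; apply: ur.
    by rewrite /= in_itv/= (ltW r1) (le_trans r2 tauT).
rewrite (Int_reflect LB) IntE; apply: Int_ae_eq.
- rewrite (_ : (fun r => _) = (fun r => if r \in `[0, 1] then rb r * F (- r) else 0)).
    apply: measurable_if_real => //; first exact: measurable_mem_itv.
    apply: measurable_funM => //; first exact: L1_measurable.
    exact: measurableT_comp mN.
  by apply/funext => r; rewrite /rb patchE mem_setE; case: ifP.
- exact: L1_measurable (L1_reflect LB).
- apply: aeS (ae_and r0 (ae_neq 0)) => r [rr rn0].
  rewrite in_itv/= /B /vin.
  have -> : (-1 <= - r <= 0) = (0 <= r <= 1).
    by apply/idP/idP => /andP[h1 h2]; apply/andP; split; lra.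
  case: ifPn => // h; have /andP[h1 h2] := h.
  rewrite ifF; last by apply/negbTE/negP => /andP[]; lra.
  rewrite opprK max_l//; apply: rr; by rewrite /= in_itv.
Qed.

End Vin.

(** The weights [(n + 1) x^n / a^(n + 1)] have integral 1 on [[0, a]] and
    concentrate at [a]: the average of [a - x] for them is [a / (n + 2)]. *)
Lemma power_concentration (P : R -> R) (a : R) : 0 < a ->
  {within `[0, a], continuous P} ->
  (\int[mu]_(x in `[0, a]) (P x * (n.+1%:R * x ^+ n / a ^+ n.+1))) @[n --> \oo] --> P a.
Proof.
move=> a0 cP.
have [c ca cM] := EVT_max (ltW a0) cP; have [d da dm] := EVT_min (ltW a0) cP.
pose B := `|P c| + `|P d|.
have PB x : x \in `[0, a] -> `|P x| <= B.
  move=> xa; have := cM _ xa; have := dm _ xa; rewrite /B ler_norml.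
  have := ler_norm (P c); have := ler_norm (- P d); rewrite normrN.
  have := normr_ge0 (P c); have := normr_ge0 (P d) => *.
  by apply/andP; split; lra.
pose w (n : nat) (x : R) := n.+1%:R * x ^+ n / a ^+ n.+1.
have an0 n : a ^+ n != 0 by rewrite expf_neq0// gt_eqF.
have cw n : continuous (w n).
  move=> x; apply: cvgM; last exact: cvg_cst.
  apply: cvgM; first exact: cvg_cst.
  exact: exprn_continuous.
have w0 n x : 0 <= x -> 0 <= w n x.
  by move=> x0; rewrite /w divr_ge0 ?mulr_ge0 ?exprn_ge0// ltW.
have Iw n : mu.-integrable `[0, a] (EFin \o w n).
  apply: continuous_compact_integrable; first exact: segment_compact.
  exact: continuous_subspaceT.
have w1 n : \int[mu]_(x in `[0, a]) w n x = 1.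
  rewrite /w RintegralZr//; last first.
    apply: continuous_compact_integrable; first exact: segment_compact.
    apply: continuous_subspaceT => x.
    by apply: cvgM; [exact: cvg_cst|exact: exprn_continuous].
  by rewrite Int_pow ?ltW// divff.
have Iwx n : mu.-integrable `[0, a] (EFin \o (fun x => w n x * (a - x))).
  apply: continuous_compact_integrable; first exact: segment_compact.
  apply: continuous_subspaceT => x; apply: cvgM; first exact: cw.
  by apply: cvgB; [exact: cvg_cst|exact: cvg_id].
have wx n : \int[mu]_(x in `[0, a]) (w n x * (a - x)) = a / n.+2%:R.
  have -> : \int[mu]_(x in `[0, a]) (w n x * (a - x)) =
     \int[mu]_(x in `[0, a]) (a * w n x - a * n.+1%:R / n.+2%:R * w n.+1 x).
    apply: eq_Rintegral => x _; rewrite /w [x ^+ n.+1]exprS [a ^+ n.+2]exprS.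
    by field; rewrite an0 gt_eqF//= pnatr_eq0.
  rewrite RintegralB//; [|exact: integrable_realZ|exact: integrable_realZ].
  rewrite !RintegralZl// !w1 !mulr1 -[n.+2%:R]natr1.
  have : n.+1%:R + 1 != 0 :> R by rewrite natr1 pnatr_eq0.
  by set N := n.+1%:R => N0; field.
have IPw n : mu.-integrable `[0, a] (EFin \o (fun x => (P x - P a) * w n x)).
  apply: continuous_compact_integrable; first exact: segment_compact.
  move=> x; apply: cvgM; first by apply: cvgB; [exact: cP|exact: cvg_cst].
  by apply: continuous_subspaceT; exact: cw.
have IP n : mu.-integrable `[0, a] (EFin \o (fun x => P x * w n x)).
  apply: continuous_compact_integrable; first exact: segment_compact.
  move=> x; apply: cvgM; first exact: cP.
  by apply: continuous_subspaceT; exact: cw.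
apply/cvgrPdist_le => e e0.
have e20 : 0 < e / 2 by lra.
have /subspace_continuousP/(_ a) := cP.
rewrite /= in_itv/= (ltW a0) lexx => /(_ isT)/cvgrPdist_lt/(_ _ e20).
move=> /nbhs_ballP[/= del del0 hdel].
(* near a by continuity of P at a, elsewhere by its boundedness *)
have Pd x : x \in `[0, a] -> `|P x - P a| <= e / 2 + 2 * B / del * (a - x).
  move=> xa; have := xa; rewrite in_itv/= => /andP[x0 x1].
  have B0 : 0 <= B by rewrite addr_ge0.
  have [h|h] := ltP (a - x) del.
    apply: (@le_trans _ _ (e / 2)).
      rewrite distrC ltW//; apply: hdel => //=.
      by rewrite /ball/= ger0_norm// subr_ge0.
    by rewrite lerDl mulr_ge0 ?subr_ge0// divr_ge0 ?mulr_ge0// ltW.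
  apply: (@le_trans _ _ (2 * B)).
    apply: (le_trans (ler_normB _ _)).
    have := PB _ xa; have : `|P a| <= B by apply: PB; rewrite in_itv/= (ltW a0) lexx.
    by lra.
  apply: (@le_trans _ _ (2 * B / del * (a - x))); last by lra.
  by rewrite mulrAC ler_pdivlMr// ler_wpM2l// mulr_ge0.
have key n : `|P a - \int[mu]_(x in `[0, a]) (P x * w n x)| <= e / 2 + 2 * B / del * (a / n.+2%:R).
  have -> : P a - \int[mu]_(x in `[0, a]) (P x * w n x) =
      - \int[mu]_(x in `[0, a]) ((P x - P a) * w n x).
    have -> : \int[mu]_(x in `[0, a]) ((P x - P a) * w n x) =
       \int[mu]_(x in `[0, a]) (P x * w n x - P a * w n x).
      by apply: eq_Rintegral => x _; ring.
    rewrite RintegralB//; last exact: integrable_realZ.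
    by rewrite RintegralZl// w1; ring.
  rewrite normrN; apply: (le_trans (le_normr_Rintegral _ (IPw n))) => //.
  have -> : e / 2 = e / 2 * \int[mu]_(x in `[0, a]) w n x by rewrite w1 mulr1.
  rewrite -wx -!RintegralZl// -RintegralD//; last 2 first.
  - exact: integrable_realZ.
  - exact: integrable_realZ.
  apply: le_Rintegral => //.
  - exact: integrable_norm.
  - by apply: integrable_realD => //; exact: integrable_realZ.
  move=> x xa; have xa' : x \in `[0, a] := xa.
  have x0 : 0 <= x by move: xa'; rewrite in_itv/= => /andP[].
  rewrite normrM (ger0_norm (w0 n _ x0)).
  apply: le_trans (ler_wpM2r (w0 n _ x0) (Pd _ xa')) _.
  by rewrite le_eqVlt; apply/orP; left; apply/eqP; rewrite /=; ring.
pose K := 2 * (2 * B / del * a) / e.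
near=> n; apply: (le_trans (key n)).
have hn : K <= n%:R by near: n; exact: nbhs_infty_ger.
have n2 : n%:R <= n.+2%:R :> R by rewrite ler_nat ltnW.
have : 2 * B / del * (a / n.+2%:R) <= e / 2.
  rewrite mulrA ler_pdivrMr ?ltr0n//.
  have : K * e <= n.+2%:R * e by rewrite ler_wpM2r ?(ltW e0)// (le_trans hn).
  by rewrite /K divfK ?gt_eqF//; lra.
by move=> h; rewrite [leRHS]splitr lerD2l.
Unshelve. all: by end_near. Qed.

End LpTools.

(** * Cut-offs and smooth ramps *)

Lemma lip1_continuous (R : realType) (f : R -> R) :
  (forall s t, `|f s - f t| <= `|s - t|) -> continuous f.
Proof.
move=> fL x; apply/cvgrPdist_lt => e e0; near=> y.
apply: (le_lt_trans (fL x y)); near: y.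
exact: (@nbhsx_ballx _ R^o x e e0).
Unshelve. all: by end_near. Qed.

Lemma min_lip (R : realDomainType) (x y c : R) :
  `|Num.min x c - Num.min y c| <= `|x - y|.
Proof.
have A := ler_norm (x - y); have := ler_norm (y - x); rewrite distrC => B.
by case: (leP x c) => ?; case: (leP y c) => ?; rewrite ler_norml; apply/andP; split; lra.
Qed.

Lemma max_lip (R : realDomainType) (x y c : R) :
  `|Num.max x c - Num.max y c| <= `|x - y|.
Proof.
have A := ler_norm (x - y); have := ler_norm (y - x); rewrite distrC => B.
by case: (leP x c) => ?; case: (leP y c) => ?; rewrite ler_norml; apply/andP; split; lra.
Qed.

Definition clip (R : realDomainType) (K w : R) := Num.min (Num.max w 0) K.

Lemma clip_itv (R : realDomainType) (K w : R) : 0 <= K -> 0 <= clip K w <= K.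
Proof. by move=> K0; rewrite /clip le_min ge_min le_max !lexx !orbT K0. Qed.

Lemma clip_id (R : realDomainType) (K w : R) : 0 <= w <= K -> clip K w = w.
Proof. by move=> /andP[h1 h2]; rewrite /clip max_l// min_l. Qed.

Lemma clip_lip (R : realDomainType) (K s t : R) : `|clip K s - clip K t| <= `|s - t|.
Proof. exact: le_trans (min_lip _ _ _) (max_lip _ _ _). Qed.

Lemma clip_continuous (R : realType) (K : R) : continuous (clip K).
Proof. by apply: lip1_continuous => s t; exact: clip_lip. Qed.

Lemma continuous_fst_comp (R : realType) (f : R -> R) : continuous f ->
  continuous (fun z : R * R => f z.1).
Proof.
move=> cf z; apply: (@continuous_comp _ _ _ fst f z); last exact: cf.
exact: cvg_fst.
Qed.

Section Ramp.
Context {R : realType}.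
Implicit Types (x y z h a : R).

Lemma is_derive_eps (f : R -> R) x d :
  (forall e, 0 < e -> exists2 del, 0 < del &
    forall h, `|h| < del -> `|f (x + h) - f x - d * h| <= e * `|h|) ->
  is_derive x (1 : R) f d.
Proof.
move=> H; have L : (fun h => h^-1 *: (f (h *: (1 : R) + x) - f x)) @ 0^' --> d.
  apply/cvgrPdist_le => e e0; have [del del0 hdel] := H e e0.
  near=> h.
  have h0 : h != 0 by near: h; exact: nbhs_dnbhs_neq.
  have hs : `|h| < del by near: h; apply: dnbhs0_lt.
  have -> : d - h^-1 *: (f (h *: 1 + x) - f x) = - (h^-1 * (f (x + h) - f x - d * h)).
    by rewrite /GRing.scale/= mulr1 [h + x]addrC; field.
  rewrite normrN normrM normfV mulrC ler_pdivrMr ?normr_gt0//.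
  exact: hdel.
by apply: DeriveDef; [apply/cvg_ex; exists d|apply/cvg_lim].
Unshelve. all: by end_near. Qed.

Definition pos_sq x : R := Num.max x 0 ^+ 2.

Lemma pos_sq_derive x : is_derive x (1 : R) pos_sq (2 * Num.max x 0).
Proof.
apply: is_derive_eps => e e0; exists e => // h he.
apply: (@le_trans _ _ (h ^+ 2)); last first.
  by rewrite -(real_normK (num_real h)) expr2 ler_wpM2r// ltW.
rewrite /pos_sq ler_norml.
by case: (leP x 0) => ?; case: (leP (x + h) 0) => ?; apply/andP; split; nra.
Qed.

(** Functions of class C^1 that increase with the parameter [a] to the
    indicator of the positive half-line: they cut test functions along a
    characteristic. *)
Definition ramp a x : R := 1 - (1 + a * pos_sq x)^-1.
Definition ramp' a x : R := a * (2 * Num.max x 0) / (1 + a * pos_sq x) ^+ 2.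

Lemma ramp_den a x : 0 <= a -> 1 <= 1 + a * pos_sq x.
Proof. by move=> a0; rewrite lerDl mulr_ge0// sqr_ge0. Qed.

Lemma ramp_derive a x : 0 <= a -> is_derive x (1 : R) (ramp a) (ramp' a x).
Proof.
move=> a0; have d := pos_sq_derive x.
have D1 : is_derive x (1 : R) (cst 1 + a \*: pos_sq) (0 + a *: (2 * Num.max x 0)).
  by apply: is_deriveD.
have n0 : (cst 1 + a \*: pos_sq) x != 0.
  rewrite !fctE /= gt_eqF// (lt_le_trans ltr01)//; exact: ramp_den.
have D2 := is_deriveV n0 D1.
have := is_deriveB (is_derive_cst (1 : R) x 1) D2.
rewrite (_ : _ - _ = ramp a); last by apply/funext.
move=> h; apply: (is_derive_eq h).
rewrite !fctE /= /ramp' /GRing.scale/= !add0r.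
by rewrite mulNr opprK mulrC.
Qed.

Lemma ramp01 a x : 0 <= a -> 0 <= ramp a x <= 1.
Proof.
move=> a0; have := ramp_den x a0 => h; have h0 := lt_le_trans ltr01 h.
by rewrite /ramp subr_ge0 gerBl invr_ge0 (ltW h0) invf_le1// h.
Qed.

Lemma ramp_eq0 a x : x <= 0 -> ramp a x = 0.
Proof. by move=> x0; rewrite /ramp /pos_sq max_r// expr0n mulr0 addr0 invr1 subrr. Qed.

(** The slope of [pos_sq] is at most [2 B] below [B]. *)
Lemma ramp_lip a x y B : 0 <= a -> x <= B -> y <= B -> 0 <= B ->
  `|ramp a x - ramp a y| <= a * (2 * B) * `|x - y|.
Proof.
move=> a0 xB yB B0; have hx := ramp_den x a0; have hy := ramp_den y a0.
have hx0 := lt_le_trans ltr01 hx; have hy0 := lt_le_trans ltr01 hy.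
have -> : ramp a x - ramp a y = a * (pos_sq x - pos_sq y) / ((1 + a * pos_sq x) * (1 + a * pos_sq y)).
  by rewrite /ramp; field; rewrite !gt_eqF.
rewrite normrM normfV (ger0_norm (_ : 0 <= (1 + a * pos_sq x) * (1 + a * pos_sq y))); last first.
  by rewrite mulr_ge0// ltW.
apply: (@le_trans _ _ `|a * (pos_sq x - pos_sq y)|).
  rewrite ler_pdivrMr ?mulr_gt0// ler_peMr//.
  by rewrite -[leLHS]mulr1 ler_pM.
rewrite normrM (ger0_norm a0) -mulrA ler_wpM2l// /pos_sq.
have -> : Num.max x 0 ^+ 2 - Num.max y 0 ^+ 2 =
  (Num.max x 0 + Num.max y 0) * (Num.max x 0 - Num.max y 0) by ring.
rewrite normrM ler_pM//; last exact: max_lip.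
rewrite ger0_norm ?addr_ge0 ?le_max ?lexx ?orbT//.
by rewrite (_ : 2 * B = B + B); [rewrite lerD// ge_max ?xB ?yB B0|ring].
Qed.

Lemma ramp_cvg x : ramp n%:R x @[n --> \oo] --> (if 0 < x then 1 else 0 : R).
Proof.
case: ltP => x0; last by under eq_fun do rewrite ramp_eq0//; exact: cvg_cst.
rewrite -[X in _ --> X]subr0 /ramp; apply: cvgB; first exact: cvg_cst.
apply/gtr0_cvgV0.
  by apply: nearW => n; rewrite (lt_le_trans ltr01)//; exact: ramp_den.
have p0 : 0 < pos_sq x by rewrite /pos_sq max_l ?(ltW x0)// exprn_gt0.
apply/cvgryPge => A; near=> n.
have : A / pos_sq x <= n%:R by near: n; exact: nbhs_infty_ger.
rewrite ler_pdivrMr//; lra.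
Unshelve. all: by end_near. Qed.

Lemma pos_sq_continuous : continuous pos_sq.
Proof.
move=> x; rewrite /pos_sq; apply: (@continuous_comp _ _ _ (fun y => Num.max y 0) (fun y => y ^+ 2)).
  by apply: lip1_continuous => s t; exact: max_lip.
exact: exprn_continuous.
Qed.

Lemma ramp'_continuous a : 0 <= a -> continuous (ramp' a).
Proof.
have cmax : continuous (fun y : R => Num.max y 0).
  by apply: lip1_continuous => s t; exact: max_lip.
move=> a0 x; have cd : continuous (fun x => 1 + a * pos_sq x).
  move=> y; apply: cvgD; first exact: cvg_cst.
  by apply: cvgM; [exact: cvg_cst|exact: pos_sq_continuous].
apply: cvgM.
  apply: cvgM; first exact: cvg_cst.
  by apply: cvgM; [exact: cvg_cst|exact: cmax].
apply: cvgV; first by rewrite expf_neq0// gt_eqF// (lt_le_trans ltr01)// ramp_den.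
apply: (@continuous_comp _ _ _ (fun y => 1 + a * pos_sq y) (fun y => y ^+ 2)); first exact: cd.
exact: exprn_continuous.
Qed.

Lemma ramp_continuous a : 0 <= a -> continuous (ramp a).
Proof.
move=> a0 x; apply: cvgB; first exact: cvg_cst.
apply: cvgV; first by rewrite gt_eqF// (lt_le_trans ltr01)// ramp_den.
apply: cvgD; first exact: cvg_cst.
by apply: cvgM; [exact: cvg_cst|exact: pos_sq_continuous].
Qed.

End Ramp.

(** * Mass and out-flux of a weak solution *)

Section FromWeakSolution.
Context {R : realType}.
Local Notation mu := (@lebesgue_measure R).
Implicit Types (t s r x : R).
Variables (lam : R -> R) (T : R) (rho0 u : R -> R) (rho : R -> R -> R).
Hypotheses (clam : continuous lam) (lam_pos : forall w, 0 < lam w) (T0 : 0 < T).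
Hypotheses (uL : in_Lp 2%:E `[0, T] u) (u0 : ae_nonneg `[0, T] u).
Hypotheses (rL : in_Lp 2%:E `[0, 1] rho0) (r0 : ae_nonneg `[0, 1] rho0).
Hypothesis sol : is_weak_solution lam T rho0 u rho.

Let iv := vin_influx T0 uL rL (lexx _).
Let v := vin T rho0 u.

Lemma sol_integrable t : 0 <= t <= T -> mu.-integrable `[0, 1] (EFin \o rho t).
Proof.
move=> tT; case: sol => _ [L _] _; apply/in_L1P => //; apply: L.
by rewrite /= in_itv.
Qed.

Lemma sol_near t e : 0 <= t <= T -> 0 < e ->
  \forall s \near within `[0, T] (nbhs t),
    \int[mu]_(x in `[0, 1]) `|rho s x - rho t x| < e.
Proof.
move=> tT; case: sol => _ C _; apply: (C0_L1_near _ C) => //.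
Qed.

Lemma pairing_cvg_W t (w : nat -> R -> R) : 0 <= t <= T ->
  (forall n, measurable_fun setT (w n)) ->
  (forall n x, 0 <= x <= 1 -> `|w n x| <= 1) ->
  (forall x, 0 <= x < 1 -> w n x @[n --> \oo] --> (1 : R)) ->
  (\int[mu]_(x in `[0, 1]) (rho t x * w n x)) @[n --> \oo] --> W rho t.
Proof.
move=> tT mw w1 wc.
have Lr : L1 (fun x => if x \in `[0, 1] then rho t x else 0).
  by apply/L1_ifP; exact: sol_integrable.
rewrite /W IntE; under eq_fun do rewrite IntE.
apply: (@Int_cvg_ae _ _ _ (fun x => `|if x \in `[0, 1] then rho t x else 0|)).
- move=> n; rewrite (_ : (fun x => _) = (fun x => (if x \in `[0, 1] then rho t x else 0) * w n x)).
    by apply: measurable_funM; [exact: L1_measurable|exact: mw].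
  by apply/funext => x; case: ifP; rewrite ?mul0r.
- exact: L1_measurable.
- apply: aeS (ae_neq 1) => x x1; case: ifP => [|_]; last exact: cvg_cst.
  rewrite in_itv/= => /andP[x0 xle]; rewrite -[X in _ --> X]mulr1.
  apply: cvgM; first exact: cvg_cst.
  by apply: wc; rewrite x0 lt_neqAle x1.
- exact: L1_norm.
- move=> n x; case: ifP => [|_]; last by rewrite normr0.
  by rewrite in_itv/= => x01; rewrite normrM ler_piMr// w1.
Qed.

(** The change of [rho] in time is small in L^1, against a bounded [f]; the
    change of [f] is Lipschitz, against an integrable [rho]. *)
Lemma pairing_continuous (f : R -> R -> R) (C : R) :
  (forall t, measurable_fun setT (f t)) ->
  (forall t x, 0 <= t <= T -> 0 <= x <= 1 -> `|f t x| <= C) ->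
  (forall s t x, 0 <= s <= T -> 0 <= t <= T -> 0 <= x <= 1 ->
    `|f s x - f t x| <= C * `|s - t|) ->
  {within `[0, T], continuous (fun t => \int[mu]_(x in `[0, 1]) (rho t x * f t x))}.
Proof.
move=> mf fC fL; apply/subspace_continuousP => t; rewrite /= in_itv/= => tT.
have C0 : 0 <= C by apply: le_trans (fC t 0 tT _); rewrite // lexx ler01.
pose N := \int[mu]_(x in `[0, 1]) `|rho t x|.
have N0 : 0 <= N by apply: Rintegral_ge0.
apply/cvgrPdist_lt => e e0.
have K0 : 0 < C * (1 + N) + 1 by rewrite ltr_wpDl// mulr_ge0// addr_ge0.
pose d := e / (C * (1 + N) + 1).
have d0 : 0 < d by rewrite divr_gt0.
have dE : C * d + C * d * N < e.
  have : d * (C * (1 + N) + 1) = e by rewrite /d divfK// gt_eqF.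
  by nra.
near=> s.
have sT : 0 <= s <= T.
  have : `[0, T]%classic s by near: s; exact: withinT.
  by rewrite /= in_itv.
have h1 : \int[mu]_(x in `[0, 1]) `|rho s x - rho t x| < d.
  by near: s; exact: sol_near.
have h2 : `|s - t| < d.
  near: s; apply: cvg_within; apply: filterS (@nbhsx_ballx _ R^o t d d0) => y.
  by rewrite /ball/= distrC.
have m' : measurable_fun `[(0:R), 1] (f s) by exact: measurable_funTS.
have m'' : measurable_fun `[(0:R), 1] (f t) by exact: measurable_funTS.
have m3 : measurable_fun `[(0:R), 1] (fun x => f s x - f t x) by exact: measurable_funB.
have is_ := sol_integrable sT; have it_ := sol_integrable tT.
have b1 (y : R) : `[0, 1]%classic y -> `|f s y| <= C by rewrite /= in_itv/= => yy; exact: fC.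
have b2 (y : R) : `[0, 1]%classic y -> `|f t y| <= C by rewrite /= in_itv/= => yy; exact: fC.
have b3 (y : R) : `[0, 1]%classic y -> `|f s y - f t y| <= C * `|s - t|.
  by rewrite /= in_itv/= => yy; exact: fL.
have id : mu.-integrable `[0, 1] (EFin \o (fun x => rho s x - rho t x)).
  exact: integrable_realB.
have j1 := integrableM_bounded (measurable_itv _) id m' b1.
have j2 := integrableM_bounded (measurable_itv _) it_ m3 b3.
have k1 := Int_normM_le (measurable_itv _) id m' b1.
have k2 := Int_normM_le (measurable_itv _) it_ m3 b3.
rewrite distrC -RintegralB//; [|exact: integrableM_bounded b1|exact: integrableM_bounded b2].
have -> : \int[mu]_(x in `[0, 1]) (rho s x * f s x - rho t x * f t x) =
    \int[mu]_(x in `[0, 1]) ((rho s x - rho t x) * f s x + rho t x * (f s x - f t x)).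
  by apply: eq_Rintegral => x _; ring.
rewrite RintegralD//; apply: (le_lt_trans (ler_normD _ _)); apply: le_lt_trans dE.
apply: lerD.
  by apply: (le_trans k1); rewrite ler_wpM2l// ltW.
by apply: (le_trans k2); rewrite -/N ler_wpM2r// ler_wpM2l// ltW.
Unshelve. all: by end_near. Qed.

Lemma W_continuous : {within `[0, T], continuous (W rho)}.
Proof.
have := @pairing_continuous (fun _ _ => 1) 1.
have -> : (fun t => \int[mu]_(x in `[0, 1]) (rho t x * 1)) = W rho.
  by apply/funext => t; apply: eq_Rintegral => x _; rewrite mulr1.
apply=> // [t x _ _|s t x _ _ _]; first by rewrite normr1.
by rewrite subrr normr0 mul1r.
Qed.

(** The speed of the solution, frozen outside [[0, T]] to be continuous on
    the whole line. *)
Definition cspeed t := lam (W rho (clip T t)).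

Lemma cspeed_continuous : continuous cspeed.
Proof.
move=> x; apply: continuous_comp; last exact: clam.
have /subspace_continuousP/(_ (clip T x)) := W_continuous.
rewrite /= in_itv/= => /(_ (clip_itv x (ltW T0))) cW; apply: cvg_comp cW.
move=> P hP; have : nbhs x (clip T @^-1` (fun t => t \in `[0, T] -> P t)).
  exact: clip_continuous hP.
apply: (@filterS _ (nbhs x)) => y /= h; apply: h.
by rewrite in_itv/= (clip_itv _ (ltW T0)).
Qed.

Lemma cspeed_bounds : exists m M, [/\ 0 < m, m <= 1, 1 <= M & forall t, m <= cspeed t <= M].
Proof.
have cw : {within `[0, T], continuous cspeed} by exact: continuous_subspaceT cspeed_continuous.
have [a aT aM] := EVT_max (ltW T0) cw.
have [b bT bm] := EVT_min (ltW T0) cw.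
have cE t : cspeed t = cspeed (clip T t).
  by rewrite /cspeed (clip_id (clip_itv t (ltW T0))).
exists (Num.min (cspeed b) 1), (Num.max (cspeed a) 1); split.
- by rewrite lt_min ltr01 lam_pos.
- by rewrite ge_min lexx orbT.
- by rewrite le_max lexx orbT.
- move=> t; have ct : clip T t \in `[0, T] by rewrite in_itv/= (clip_itv _ (ltW T0)).
  by rewrite ge_min le_max (cE t) (bm _ ct) (aM _ ct).
Qed.

Definition xi := trajectory cspeed.

Lemma xi_neg t : t <= 0 -> xi t = t.
Proof. exact: trajectory_neg. Qed.

Lemma xi_continuous : continuous xi.
Proof.
have [m [M [m0 m1 M1 b]]] := cspeed_bounds.
have mc : measurable_fun setT cspeed.
  by apply: continuous_measurable_fun; exact: cspeed_continuous.
exact: bilip_continuous m0 (trajectory_bilip (ltW m0) m1 M1 mc b).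
Qed.

Lemma xi_derive t : 0 < t -> is_derive t (1 : R) xi (cspeed t).
Proof.
have [m [M [m0 m1 M1 b]]] := cspeed_bounds; move=> t0.
apply: (@trajectory_derive _ _ M) => //; first exact: cspeed_continuous.
by move=> x; have /andP[h1 h2] := b x; rewrite ger0_norm// (le_trans (ltW m0)).
Qed.

(** Test functions vanish at the final time, so the weak formulation is
    applied to [mun n t psi t x], where [mun n t = 1 - (t / tau)^(n + 1)].
    As [n] grows, [mun n] tends to 1 before [tau], and minus its derivative
    concentrates at [tau], which yields the pairing of [rho tau] with [psi
    tau]. The derivative of [psi] along the characteristics is assumed to
    split into the speed and a function [kap] of the position; [F] is the
    trace of [psi] on the labels. *)
Lemma evolution (tau : R) (psi psit psix : R -> R -> R) (kap F : R -> R) (C : R) :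
  0 < tau <= T ->
  continuous (fun z : R * R => psi z.1 z.2) ->
  continuous (fun z : R * R => psit z.1 z.2) ->
  continuous (fun z : R * R => psix z.1 z.2) ->
  (forall t x, 0 < t -> is_derive t (1 : R) (fun s => psi s x) (psit t x) /\
     is_derive x (1 : R) (fun y => psi t y) (psix t x)) ->
  (forall t, 0 <= t <= tau -> psi t 1 = 0) ->
  (forall t x, 0 <= t <= tau -> 0 <= x <= 1 ->
    psit t x + cspeed t * psix t x = cspeed t * kap x) ->
  measurable_fun setT kap -> (forall x, 0 <= x <= 1 -> `|kap x| <= C) ->
  (forall t x, 0 <= t <= T -> 0 <= x <= 1 -> `|psi t x| <= C) ->
  (forall s t x, 0 <= s <= T -> 0 <= t <= T -> 0 <= x <= 1 ->
    `|psi s x - psi t x| <= C * `|s - t|) ->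
  measurable_fun setT F -> (forall r, `|F r| <= C) ->
  (forall t, 0 <= t <= tau -> F t = psi t 0) ->
  (forall x, 0 <= x <= 1 -> F (- x) = psi 0 x) ->
  \int[mu]_(x in `[0, 1]) (rho tau x * psi tau x) =
  \int[mu]_(t in `[0, tau]) (cspeed t * \int[mu]_(x in `[0, 1]) (rho t x * kap x)) +
  \int[mu]_r (if r <= tau then v r * F r else 0).
Proof.
move=> /andP[tau0 tauT] cpsi cpsit cpsix dpsi psi1 eqpsi mkap kapC psiC psiL mF FC Ft F0.
have tT t : 0 <= t <= tau -> 0 <= t <= T.
  by move=> /andP[-> h]; exact: le_trans tauT.
pose G t := \int[mu]_(x in `[0, 1]) (rho t x * psi t x).
pose K t := \int[mu]_(x in `[0, 1]) (rho t x * kap x).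
have mpsi t : measurable_fun setT (psi t).
  apply: continuous_measurable_fun => x.
  apply: (@continuous_comp _ _ _ (fun y => (t, y)) (fun z => psi z.1 z.2) x); last exact: cpsi.
  exact: (cvg_pair (cvg_cst _) cvg_id).
have sub : (`[0, tau] `<=` `[(0 : R), T])%classic.
  by move=> t; rewrite /= !in_itv/=; exact: tT.
have cG : {within `[0, tau], continuous G}.
  by apply: continuous_subspaceW sub _; exact: pairing_continuous psiC psiL.
have cK : {within `[0, tau], continuous K}.
  apply: continuous_subspaceW sub _.
  apply: (@pairing_continuous (fun _ => kap) C) => //.
    by move=> _ x _; exact: kapC.
  move=> s t x _ _ x01; rewrite subrr normr0 mulr_ge0//.
  exact: le_trans (kapC x x01).
pose mun n t := 1 - t ^+ n.+1 / tau ^+ n.+1.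
pose w n t := n.+1%:R * t ^+ n / tau ^+ n.+1.
have taun n : tau ^+ n != 0 by rewrite expf_neq0// gt_eqF.
have dmun n (t : R) : is_derive t (1 : R) (mun n) (- w n t).
  rewrite (_ : mun n = (cst 1 : R -> R) - (tau ^+ n.+1)^-1 \*: ((id : R -> R) ^+ n.+1)); last first.
    by apply/funext => y; rewrite /mun /= !fctE /= mulrC.
  apply: (is_derive_eq (is_deriveB _ (is_deriveZ _ (is_deriveX n.+1 (is_derive_id t 1))))).
  by rewrite /w /GRing.scale/= sub0r mulr1 mulrC.
have cmun n : continuous (mun n).
  move=> x; apply: cvgB; first exact: cvg_cst.
  by apply: cvgM; [exact: exprn_continuous|exact: cvg_cst].
have cw n : continuous (w n).
  move=> x; apply: cvgM; last exact: cvg_cst.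
  by apply: cvgM; [exact: cvg_cst|exact: exprn_continuous].
have mun01 n t : 0 <= t <= tau -> 0 <= mun n t <= 1.
  move=> /andP[t0 t1]; rewrite /mun subr_ge0 gerBl divr_ge0 ?exprn_ge0 ?(ltW tau0)//.
  rewrite ler_pdivrMr ?exprn_gt0// mul1r andbT.
  by apply: lerXn2r; rewrite ?nnegrE ?(ltW tau0).
pose cl t := clip tau t.
have clE t : 0 <= t <= tau -> cl t = t by exact: clip_id.
have clI t : 0 <= cl t <= tau by apply: clip_itv; exact: ltW.
have mcl : measurable_fun setT cl by apply: measurable_minr => //; exact: measurable_maxr.
pose Fn n r := mun n (cl r) * F r.
have mcmun n : measurable_fun setT (mun n).
  by apply: continuous_measurable_fun; exact: cmun.
have mFn n : measurable_fun setT (Fn n).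
  by apply: measurable_funM => //; exact: measurableT_comp mcl.
have C0 : 0 <= C by apply: le_trans (FC 0).
have FnC n r : `|Fn n r| <= C.
  rewrite /Fn normrM; have /andP[h1 h2] := mun01 n _ (clI r).
  rewrite ger0_norm//; apply: le_trans (FC r).
  by rewrite ler_piMl.
have cc := cspeed_continuous.
have ccK : {within `[0, tau], continuous (fun t => cspeed t * K t)}.
  by move=> x; apply: cvgM; [apply: continuous_subspaceT; exact: cc|exact: cK].
have icmp (f : R -> R) : {within `[0, tau], continuous f} ->
    mu.-integrable `[0, tau] (EFin \o f).
  by move=> cf; apply: continuous_compact_integrable => //; exact: segment_compact.
have iGw n : mu.-integrable `[0, tau] (EFin \o (fun t => G t * w n t)).
  by apply: icmp => x; apply: cvgM; [exact: cG|apply: continuous_subspaceT; exact: cw].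
have imcK n : mu.-integrable `[0, tau] (EFin \o (fun t => mun n t * (cspeed t * K t))).
  by apply: icmp => x; apply: cvgM; [apply: continuous_subspaceT; exact: cmun|exact: ccK].
have weak n : \int[mu]_(t in `[0, tau]) (G t * w n t) =
    \int[mu]_(t in `[0, tau]) (mun n t * (cspeed t * K t)) +
    \int[mu]_r (if r <= tau then v r * Fn n r else 0).
  have C1 : C1_rect tau (fun t x => mun n t * psi t x)
      (fun t x => - w n t * psi t x + mun n t * psit t x)
      (fun t x => mun n t * psix t x).
    split.
    - apply: continuous_subspaceT => z; apply: cvgM; last exact: cpsi.
      exact: continuous_fst_comp (cmun n) z.
    - apply: continuous_subspaceT => z; apply: cvgD; apply: cvgM.
      + by apply: cvgN; exact: continuous_fst_comp (cw n) z.
      + exact: cpsi.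
      + exact: continuous_fst_comp (cmun n) z.
      + exact: cpsit.
    - apply: continuous_subspaceT => z; apply: cvgM; last exact: cpsix.
      exact: continuous_fst_comp (cmun n) z.
    - move=> t x /andP[t0 _] _; have [d1 d2] := dpsi t x t0; split.
        apply: (is_derive_eq (is_deriveM (dmun n t) d1)).
        by rewrite /GRing.scale/=; ring.
      exact: (is_deriveZ (mun n t) d2).
  have munt : mun n tau = 0 by rewrite /mun divff ?subrr.
  have z1 (x : R) : 0 <= x <= 1 -> mun n tau * psi tau x = 0 by rewrite munt mul0r.
  have z2 (t : R) : 0 <= t <= tau -> mun n t * psi t 1 = 0.
    by move=> tt; rewrite psi1// mulr0.
  case: sol => _ _ /(_ tau); rewrite (ltW tau0) tauT => /(_ isT _ _ _ C1 z1 z2) H.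
  have e1 : \int[mu]_(t in `[0, tau]) (u t * (mun n t * psi t 0)) =
      \int[mu]_(t in `[0, tau]) (u t * Fn n t).
    apply: eq_Rintegral => t; rewrite inE/= in_itv/= => tt.
    by rewrite /Fn clE// Ft.
  have e2 : \int[mu]_(x in `[0, 1]) (rho0 x * (mun n 0 * psi 0 x)) =
      \int[mu]_(x in `[0, 1]) (rho0 x * Fn n (- x)).
    apply: eq_Rintegral => x; rewrite inE/= in_itv/= => xx.
    rewrite /Fn F0//; congr (_ * (mun n _ * _)).
    have /andP[x0 _] := xx.
    by rewrite /cl /clip max_r ?oppr_le0// min_l// ltW.
  have tau0T : 0 <= tau <= T by rewrite (ltW tau0).
  have p := vin_pairing T0 uL u0 rL r0 tau0T (mFn n) (FnC n).
  move: H; rewrite e1 e2 -addrA p.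
  have e3 : \int[mu]_(t in `[0, tau]) \int[mu]_(x in `[0, 1])
      (rho t x * ((- w n t * psi t x + mun n t * psit t x) + lam (W rho t) * (mun n t * psix t x))) =
      \int[mu]_(t in `[0, tau]) (mun n t * (cspeed t * K t) - G t * w n t).
    apply: eq_Rintegral => t; rewrite inE/= in_itv/= => tt.
    have tT' := tT t tt.
    have ir := sol_integrable tT'.
    have i1 : mu.-integrable `[0, 1] (EFin \o (fun x => rho t x * psi t x)).
      apply: (integrableM_bounded (C := C)) => //; first exact: measurable_funTS.
      by move=> x; rewrite /= in_itv/=; exact: psiC.
    have i2 : mu.-integrable `[0, 1] (EFin \o (fun x => rho t x * kap x)).
      apply: (integrableM_bounded (C := C)) => //; exact: measurable_funTS.
    rewrite /G /K mulrA -[in RHS]RintegralZl// -[in X in _ - X]RintegralZr//.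
    rewrite -RintegralB//; [|exact: integrable_realZ|]; last first.
      have := @integrable_realZ R `[0, 1] _ (w n t) (measurable_itv _) i1.
      by apply: eq_integrable => // x _ /=; rewrite mulrC.
    apply: eq_Rintegral => x; rewrite inE/= in_itv/= => xx.
    have := eqpsi t x tt xx; rewrite {1}/cspeed (clip_id tT').
    move=> eq1; rewrite (_ : mun n t * cspeed t * (rho t x * kap x) =
       mun n t * rho t x * (cspeed t * kap x)); last by ring.
    by rewrite -eq1; ring.
  rewrite e3 RintegralB//; move=> H.
  by apply/eqP; rewrite -subr_eq0 -oppr_eq0 -[X in _ == X]H; apply/eqP; ring.
have lim1 := power_concentration tau0 cG.
have munl (t : R) : 0 <= t <= tau -> t != tau -> mun n t @[n --> \oo] --> (1 : R).
  move=> /andP[t0 t1] tn.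
  have tlt : `|t / tau| < 1.
    rewrite ger0_norm ?divr_ge0 ?(ltW tau0)// ltr_pdivrMr// mul1r.
    by rewrite lt_neqAle tn.
  have -> : (fun n => mun n t) = (fun n => 1 - (t / tau) ^+ n.+1).
    by apply/funext => n; rewrite /mun expr_div_n.
  rewrite -[X in _ --> X]subr0; apply: cvgB; first exact: cvg_cst.
  by have := cvg_expr tlt; rewrite -(cvg_shiftS (fun n => (t / tau) ^+ n)).
have lim2 : (\int[mu]_(t in `[0, tau]) (mun n t * (cspeed t * K t))) @[n --> \oo] -->
    \int[mu]_(t in `[0, tau]) (cspeed t * K t).
  rewrite IntE; under eq_fun do rewrite IntE.
  have LcK : L1 (fun t => if t \in `[0, tau] then cspeed t * K t else 0).
    by apply/L1_ifP; exact: icmp.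
  apply: (@Int_cvg_ae _ _ _ (fun t => `|if t \in `[0, tau] then cspeed t * K t else 0|)).
  - by move=> n; apply: L1_measurable; apply/L1_ifP; exact: imcK.
  - exact: L1_measurable.
  - apply: aeS (ae_neq tau) => t tn; rewrite in_itv/=; case: ifP => tt; last exact: cvg_cst.
    rewrite -[X in _ --> X]mul1r; apply: cvgM; last exact: cvg_cst.
    exact: munl.
  - exact: L1_norm.
  - move=> n t; rewrite in_itv/=; case: ifP => tt; last by rewrite normr0.
    by rewrite normrM; have /andP[h1 h2] := mun01 n _ tt; rewrite ger0_norm// ler_piMl.
have Lv := influx_L1 iv.
have lim3 : (\int[mu]_r (if r <= tau then v r * Fn n r else 0)) @[n --> \oo] -->
    \int[mu]_r (if r <= tau then v r * F r else 0).
  have mle : measurable_fun setT (fun r => r <= tau) by exact: measurable_fun_ler.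
  have mv := L1_measurable Lv.
  apply: (@Int_cvg_ae _ _ _ (fun r => C * `|v r|)).
  - by move=> n; apply: measurable_if_real => //; exact: measurable_funM.
  - by apply: measurable_if_real => //; exact: measurable_funM.
  - apply: aeS (ae_neq tau) => r rn; case: ifP => rt; last exact: cvg_cst.
    apply: cvgM; first exact: cvg_cst.
    rewrite -[X in _ --> X]mul1r /Fn; apply: cvgM; last exact: cvg_cst.
    apply: munl; first exact: clI.
    by apply: contraNN rn; rewrite /cl /clip; case: (leP r 0) => r1; rewrite ?min_l// ?(ltW tau0)// => /eqP h; move: tau0; rewrite -h ltxx.
  - exact/L1Z/L1_norm.
  - move=> n r; case: ifP => _; last by rewrite normr0 mulr_ge0.
    by rewrite normrM mulrC ler_wpM2r.
have lim4 := cvgD lim2 lim3.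
have lim5 : (\int[mu]_(t in `[0, tau]) (mun n t * (cspeed t * K t)) +
    \int[mu]_r (if r <= tau then v r * Fn n r else 0)) @[n --> \oo] --> G tau.
  by under eq_fun do rewrite -weak; exact: lim1.
exact: (cvg_unique (@Rhausdorff R) lim5 (lim4 _)).
Qed.

Lemma xi_bilip : exists m M, [/\ 0 < m, m <= 1, 1 <= M, bilip m M xi &
   forall t, m <= cspeed t <= M].
Proof.
have [m [M [m0 m1 M1 b]]] := cspeed_bounds.
have mc : measurable_fun setT cspeed.
  by apply: continuous_measurable_fun; exact: cspeed_continuous.
by exists m, M; split => //; exact: trajectory_bilip (ltW m0) m1 M1 mc b.
Qed.

(** A function of [xi t - x] is constant along the characteristics. With a
    ramp of [xi t - x - z0], where [z0 = xi tau - 1], the test function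
    vanishes at [x = 1] up to time [tau], and [evolution] has no interior
    term. As the ramps tend to the indicator of the positive half-line, the
    left-hand side tends to the mass at time [tau], and the right-hand side
    to the integral of [v] over the labels [r <= tau] with [xi r > xi tau -
    1]. *)
Lemma sol_mass tau : 0 < tau <= T -> W rho tau = mass v xi tau.
Proof.
move=> tT; have /andP[tau0 tauT] := tT.
have [m [M [m0 m1 M1 xib cb]]] := xi_bilip.
set z0 := xi tau - 1.
have xT : 0 <= xi T.
  by rewrite -(xi_neg (lexx 0)) (bilip_leE _ _ m0 xib) ltW.
have xitau0 : 0 <= xi tau.
  by rewrite -(xi_neg (lexx 0)) (bilip_leE _ _ m0 xib) ltW.
have cx := xi_continuous; have cc := cspeed_continuous.
pose arg (z : R * R) := xi z.1 - z.2 - z0.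
have carg : continuous arg.
  move=> z; apply: cvgB; last exact: cvg_cst.
  by apply: cvgB; [exact: continuous_fst_comp cx z|exact: cvg_snd].
have mxi : measurable_fun setT xi by apply: continuous_measurable_fun; exact: cx.
have H n : \int[mu]_(x in `[0, 1]) (rho tau x * ramp n%:R (1 - x)) =
    \int[mu]_r (if r <= tau then v r * ramp n%:R (xi r - z0) else 0).
  have n0 : 0 <= n%:R :> R by [].
  pose B := 1 + xi T.
  have B0 : 0 <= B by rewrite addr_ge0.
  pose C := 1 + n%:R * (2 * B) * M.
  have C1 : 1 <= C by rewrite lerDl !mulr_ge0// (le_trans _ M1).
  have := @evolution tau (fun t x => ramp n%:R (xi t - x - z0))
    (fun t x => ramp' n%:R (xi t - x - z0) * cspeed t)
    (fun t x => - ramp' n%:R (xi t - x - z0)) (fun=> 0)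
    (fun r => ramp n%:R (xi r - z0)) C tT.
  have -> : \int[mu]_(t in `[0, tau]) (cspeed t * \int[mu]_(x in `[0, 1]) (rho t x * 0)) = 0.
    rewrite -[RHS](@Rintegral_set0 _ _ _ mu (fun=> 0 : R)).
    rewrite Rintegral_mkcond [RHS]Rintegral_mkcond; apply: eq_Rintegral => t _.
    rewrite !patchE !in_set0; case: ifP => // _.
    under eq_Rintegral do rewrite mulr0.
    by rewrite Rintegral_cst// mul0r mulr0.
  rewrite add0r => h; rewrite -h; clear h.
  - by apply: eq_Rintegral => x _; congr (_ * ramp _ _); rewrite /z0; ring.
  - by move=> z; apply: (continuous_comp (carg z)); exact: ramp_continuous.
  - move=> z; apply: cvgM; last exact: continuous_fst_comp cc z.
    by apply: (continuous_comp (carg z)); exact: ramp'_continuous.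
  - move=> z; apply: cvgN.
    by apply: (continuous_comp (carg z)); exact: ramp'_continuous.
  - move=> t x t0; have dr := ramp_derive (xi t - x - z0) n0; split.
      have dg : is_derive t (1 : R) (fun s => xi s - x - z0) (cspeed t).
        have := is_deriveB (is_deriveB (xi_derive t0) (is_derive_cst x t 1)) (is_derive_cst z0 t 1).
        by move=> d; apply: (is_derive_eq d); rewrite !subr0.
      exact: (@is_derive1_comp R (ramp n%:R) (fun s => xi s - x - z0) t _ _ dr dg).
    have dg : is_derive x (1 : R) (fun y => xi t - y - z0) (-1).
      have := is_deriveB (is_deriveB (is_derive_cst (xi t) x 1) (is_derive_id x 1)) (is_derive_cst z0 x 1).
      by move=> d; apply: (is_derive_eq d); rewrite subr0 sub0r.
    have d := @is_derive1_comp R (ramp n%:R) (fun y => xi t - y - z0) x _ _ dr dg.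
    by apply: (is_derive_eq d); rewrite mulrN1.
  - move=> t /andP[_ tt]; rewrite ramp_eq0// /z0.
    have := bilip_leE t tau m0 xib; rewrite tt => h; move: h; lra.
  - by move=> t x _ _; ring.
  - exact: measurable_cst.
  - by move=> x _; rewrite normr0 (le_trans _ C1).
  - move=> t x _ _; have /andP[h1 h2] := ramp01 (xi t - x - z0) n0.
    by rewrite ger0_norm// (le_trans h2).
  - have argB (r x : R) : 0 <= r <= T -> 0 <= x <= 1 -> xi r - x - z0 <= B.
      move=> /andP[_ rT] /andP[x0 _]; rewrite /B /z0.
      by have : xi r <= xi T; [rewrite (bilip_leE _ _ m0 xib)|lra].
    move=> s t x sT tT' x01.
    apply: (le_trans (ramp_lip n0 (argB s x sT x01) (argB t x tT' x01) B0)).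
    have -> : xi s - x - z0 - (xi t - x - z0) = xi s - xi t by ring.
    have /andP[_ h] := bilip_dist t s m0 xib.
    apply: (@le_trans _ _ (n%:R * (2 * B) * (M * `|s - t|))).
      by rewrite ler_wpM2l// !mulr_ge0.
    by rewrite [leLHS]mulrA ler_wpM2r// /C lerDr.
  - apply: continuous_measurable_fun => r.
    apply: (@continuous_comp _ _ _ (fun r => xi r - z0) (ramp n%:R)); last exact: ramp_continuous.
    by apply: cvgB; [exact: cx|exact: cvg_cst].
  - move=> r; have /andP[h1 h2] := ramp01 (xi r - z0) n0.
    by rewrite ger0_norm// (le_trans h2).
  - by move=> t _; rewrite subr0.
  - move=> x /andP[x0 _]; rewrite (xi_neg (lexx 0)) (@xi_neg (- x)) ?oppr_le0//.
    by rewrite sub0r.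
have Lv := influx_L1 iv; have mv := L1_measurable Lv.
have mramp n (f : R -> R) : measurable_fun setT f -> measurable_fun setT (fun x => ramp n%:R (f x)).
  by move=> mf; apply: measurableT_comp mf; apply: continuous_measurable_fun; exact: ramp_continuous.
have rampC n (y : R) : `|ramp n%:R y| <= 1.
  by have /andP[h1 h2] := @ramp01 R n%:R y (ler0n _ _); rewrite ger0_norm.
have lim1 : (\int[mu]_(x in `[0, 1]) (rho tau x * ramp n%:R (1 - x))) @[n --> \oo] --> W rho tau.
  apply: pairing_cvg_W => [|n|n x _|x /andP[_ x1]]; first by rewrite (ltW tau0).
  - by apply: mramp; exact: measurable_funB.
  - exact: rampC.
  - by have := @ramp_cvg R (1 - x); rewrite subr_gt0 x1.
have lim2 : (\int[mu]_r (if r <= tau then v r * ramp n%:R (xi r - z0) else 0)) @[n --> \oo] -->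
    mass v xi tau.
  have mle : measurable_fun setT (fun r => r <= tau) by exact: measurable_fun_ler.
  rewrite /mass primB//; last exact: (back_le m0 xib).
  apply: (Int_cvg _ _ (L1_norm Lv) _).2.
  - move=> n; apply: measurable_if_real => //; apply: measurable_funM => //.
    by apply: mramp; exact: measurable_funB.
  - move=> r; rewrite andbC; case: (r <= tau) => /=; last exact: cvg_cst.
    rewrite (_ : (if _ then _ else _) = v r * (if 0 < xi r - z0 then 1 else 0)); last first.
      rewrite subr_gt0 /z0 -(xi_back m0 xib) (bilip_ltE _ _ m0 xib).
      by case: ifP => _; rewrite ?mulr1 ?mulr0.
    by apply: cvgM; [exact: cvg_cst|exact: ramp_cvg].
  - move=> n r; case: ifP => _; last by rewrite normr0.
    by rewrite normrM ler_piMr.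
have E := funext H; move: lim1; rewrite E => lim1.
exact: (cvg_unique (@Rhausdorff R) lim1 lim2).
Qed.

(** The L^1 norm of the solution is continuous on the compact interval [[0,
    T]]. *)
Lemma sol_norm_bound : exists B, forall t, 0 <= t <= T ->
  \int[mu]_(x in `[0, 1]) `|rho t x| <= B.
Proof.
have cN : {within `[0, T], continuous (fun t => \int[mu]_(x in `[0, 1]) `|rho t x|)}.
  apply/subspace_continuousP => t; rewrite /= in_itv/= => tT.
  apply/cvgrPdist_lt => e e0; near=> s.
  have sT : 0 <= s <= T.
    have : `[0, T]%classic s by near: s; exact: withinT.
    by rewrite /= in_itv.
  have h1 : \int[mu]_(x in `[0, 1]) `|rho s x - rho t x| < e.
    by near: s; exact: sol_near.
  have is_ := sol_integrable sT; have it_ := sol_integrable tT.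
  have nis := integrable_norm is_; have nit := integrable_norm it_.
  rewrite -RintegralB//; apply: le_lt_trans h1.
  have id : mu.-integrable `[0, 1] (EFin \o (fun x => `|rho t x| - `|rho s x|)).
    exact: integrable_realB.
  have id' : mu.-integrable `[0, 1] (EFin \o (fun x => rho s x - rho t x)).
    exact: integrable_realB.
  apply: (le_trans (le_normr_Rintegral _ id)) => //.
  apply: le_Rintegral => //; [exact: integrable_norm|exact: integrable_norm|].
  by move=> x _ /=; rewrite [leRHS]distrC; exact: ler_dist_dist.
have [c _ H] := EVT_max (ltW T0) cN.
by exists (\int[mu]_(x in `[0, 1]) `|rho c x|) => t tT; apply: H; rewrite in_itv.
Unshelve. all: by end_near. Qed.

Lemma L2M_bounded (f g : R -> R) C : L2 f -> measurable_fun setT g ->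
  (forall x, `|g x| <= C) -> L2 (fun x => f x * g x).
Proof.
move=> [mf Lf] mg gC; split; first exact: measurable_funM.
rewrite (_ : (fun x => _) = (fun x => f x ^+ 2 * g x ^+ 2)); last first.
  by apply/funext => x; rewrite exprMn.
apply: (@L1M_bounded _ _ _ (C ^+ 2)) => //; first exact: measurable_funX.
move=> x; rewrite normrX; apply: lerXn2r => //; rewrite ?nnegrE//.
exact: le_trans (gC x).
Qed.

Lemma cspeed_measurable : measurable_fun setT cspeed.
Proof. by apply: continuous_measurable_fun; exact: cspeed_continuous. Qed.

Hypothesis sec : has_sections T rho.

Lemma section_L2 x : 0 <= x <= 1 -> L2 ((fun t => rho t x) \_ `[0, T]).
Proof.
move=> x01; case: sec => /(_ x) h _; apply/in_L2P => //; apply: h.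
by rewrite /= in_itv.
Qed.

Lemma flux_L2 : L2 ((fun t => rho t 1 * lam (W rho t)) \_ `[0, T]).
Proof.
have [m [M [m0 m1 M1 _ b]]] := xi_bilip.
have := @L2M_bounded _ cspeed M (@section_L2 1 _) cspeed_measurable.
rewrite ler01 lexx => /(_ isT); rewrite (_ : (fun x => _) = (fun t => rho t 1 * lam (W rho t)) \_ `[0, T]).
  apply=> x; have /andP[h1 h2] := b x; rewrite ger0_norm//.
  exact: le_trans (ltW m0) h1.
apply/funext => t; rewrite !patchE mem_setE in_itv/=; case: ifP => [tT|_]; last by rewrite mul0r.
by rewrite /cspeed clip_id.
Qed.

Lemma section_integrable tau x : 0 < tau <= T -> 0 <= x <= 1 ->
  mu.-integrable `[0, tau] (EFin \o (fun t => cspeed t * rho t x)).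
Proof.
move=> /andP[tau0 tauT] x01; have [m [M [m0 m1 M1 _ b]]] := xi_bilip.
have L2s := section_L2 x01; have ms := L2s.1.
have i1 : mu.-integrable `[0, tau] (EFin \o (fun t => (fun t => rho t x) \_ `[0, T] t)).
  exact: L1_itv_integrable (L2_supported_L1 L2s (@patch_supported _ _ _ _)).
have := @integrableM_bounded _ _ _ cspeed M (measurable_itv _) i1 (measurable_funTS cspeed_measurable) _.
move=> /(_ _)/(eq_integrable _ _ _) h; apply: h => //; last first.
  by move=> t _; have /andP[h1 h2] := b t; rewrite ger0_norm// (le_trans (ltW m0) h1).
move=> t; rewrite inE /= in_itv/= patchE mem_setE in_itv/= => /andP[t0 tt].
by rewrite t0 (le_trans tt tauT) mulrC.
Qed.

(** Cauchy-Schwarz, and the continuity of [x |-> rho (., x)] in L^2. *)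
Lemma section_flux_continuous tau : 0 < tau <= T ->
  {within `[0, 1], continuous (fun x => \int[mu]_(t in `[0, tau]) (cspeed t * rho t x))}.
Proof.
move=> /andP[tau0 tauT]; have [m [M [m0 m1 M1 _ b]]] := xi_bilip.
pose f t := if t \in `[0, tau] then cspeed t else 0.
have L2one : L2 (fun t => if t \in `[0, tau] then 1 else 0 : R).
  split; first by apply: measurable_if_real => //; exact: measurable_mem_itv.
  rewrite (_ : (fun x => _) = (fun t => if t \in `[0, tau] then 1 else 0)); last first.
    by apply/funext => t; case: ifP; rewrite ?expr1n ?expr0n.
  by apply/L1_ifP; exact: bounded_integrable.
have Lf : L2 f.
  rewrite (_ : f = (fun t => (if t \in `[0, tau] then 1 else 0) * cspeed t)); last first.
    by apply/funext => t; rewrite /f; case: ifP; rewrite ?mul1r ?mul0r.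
  apply: (L2M_bounded (C := M)) => //; first exact: cspeed_measurable.
  move=> x; have /andP[h1 h2] := b x; rewrite ger0_norm//.
  exact: le_trans (ltW m0) h1.
have P x : 0 <= x <= 1 -> L1 (fun t => f t * ((fun t => rho t x) \_ `[0, T]) t) /\
    \int[mu]_(t in `[0, tau]) (cspeed t * rho t x) =
    \int[mu]_t (f t * ((fun t => rho t x) \_ `[0, T]) t).
  move=> x01; split; first by apply: L2M => //; exact: section_L2.
  rewrite IntE; apply: eq_Rintegral => t _; rewrite /f patchE mem_setE !in_itv/=.
  case: ifP => [/andP[t0 tt]|_]; last by rewrite mul0r.
  by rewrite t0 (le_trans tt).
apply/subspace_continuousP => x; rewrite /= in_itv/= => x01.
apply/cvgrPdist_lt => e e0.
pose A := \int[mu]_t f t ^+ 2.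
have A0 : 0 <= A by apply: Int_ge0 => t; exact: sqr_ge0.
have d0 : 0 < e ^+ 2 / (A + 1) by rewrite divr_gt0 ?exprn_gt0// ltr_wpDl.
near=> y.
have y01 : `[0, 1]%classic y by near: y; exact: withinT.
have h1 : \int[mu]_(t in `[0, T]) (rho t y - rho t x) ^+ 2 < e ^+ 2 / (A + 1).
  have h : `[0, 1]%classic y -> \int[mu]_(t in `[0, T]) (rho t y - rho t x) ^+ 2 < e ^+ 2 / (A + 1).
    by near: y; apply: (C0_L2_near _ sec).
  exact: h.
move: y01; rewrite /= in_itv/= => y01.
have [Lx Ex] := P x x01; have [Ly Ey] := P y y01.
rewrite /from_subspace Ex Ey.
rewrite distrC -RintegralB//.
have Lg := L2B (section_L2 y01) (section_L2 x01).
have := cauchy_schwarz Lf Lg.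
rewrite (_ : \int[mu]_t (_ - _) ^+ 2 = \int[mu]_(t in `[0, T]) (rho t y - rho t x) ^+ 2); last first.
  rewrite IntE; apply: eq_Rintegral => t _; rewrite !patchE mem_setE.
  by case: ifP => // _; rewrite subrr expr0n.
rewrite (_ : \int[mu]_t (f t * (_ - _)) = \int[mu]_t (f t * ((fun t => rho t y) \_ `[0, T]) t - f t * ((fun t => rho t x) \_ `[0, T]) t)); last first.
  by apply: eq_Rintegral => t _; rewrite mulrBr.
rewrite -/A => cs.
have lt2 : (\int[mu]_t (f t * ((fun t => rho t y) \_ `[0, T]) t - f t * ((fun t => rho t x) \_ `[0, T]) t)) ^+ 2 < e ^+ 2.
  apply: le_lt_trans cs _.
  move: h1; rewrite ltr_pdivlMr; last by rewrite ltr_wpDl.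
  apply: le_lt_trans; rewrite mulrC ler_wpM2l//.
    by apply: Rintegral_ge0 => t _; exact: sqr_ge0.
  by rewrite lerDl.
rewrite -(ltr_pXn2r (n := 2))// ?nnegrE ?(ltW e0)//.
by rewrite real_normK ?num_real.
Unshelve. all: by end_near. Qed.

(** [evolution] with [psi = 1 - x^(n + 1)], which does not depend on time.
    It tends to 1 inside the interval and gives the mass, while minus its
    derivative concentrates at [x = 1] and gives the out-flux, by continuity
    of the flux in [x]. *)
Lemma sol_flux tau : 0 < tau <= T ->
  \int[mu]_(t in `[0, tau]) (rho t 1 * lam (W rho t)) = prim v tau - W rho tau.
Proof.
move=> tT; have /andP[tau0 tauT] := tT.
have [m [M [m0 m1 M1 _ cb]]] := xi_bilip.
have cM t : `|cspeed t| <= M.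
  by have /andP[h1 h2] := cb t; rewrite ger0_norm// (le_trans (ltW m0) h1).
have M0 : 0 <= M := le_trans ler01 M1.
have [B rhoB] := sol_norm_bound.
have Lv := influx_L1 iv; have mv := L1_measurable Lv.
pose P x := \int[mu]_(t in `[0, tau]) (cspeed t * rho t x).
(* the position at time 0 of the label r, which is the boundary 0 for the
   labels that enter later *)
pose c01 (r : R) := clip 1 (- r).
have c01I r : 0 <= c01 r <= 1 by exact: clip_itv.
have mc01 : measurable_fun setT c01.
  by apply: measurable_minr => //; apply: measurable_maxr => //; exact: measurable_funN.
pose kap n x := - (n.+1%:R * x ^+ n) : R.
pose F n r := 1 - c01 r ^+ n.+1.
have mX n : measurable_fun setT (fun x : R => x ^+ n) by exact: measurable_funX.
have mkap n : measurable_fun setT (kap n).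
  by apply: measurable_funN; exact: measurable_funM.
have mF n : measurable_fun setT (F n) by apply: measurable_funB => //; exact: measurable_funX.
have X01 n (x : R) : 0 <= x <= 1 -> 0 <= x ^+ n <= 1.
  by move=> /andP[x0 x1]; rewrite exprn_ge0// exprn_ile1.
have oneX01 n (x : R) : 0 <= x <= 1 -> `|1 - x ^+ n| <= 1.
  by move=> /(X01 n)/andP[h1 h2]; rewrite ger0_norm ?subr_ge0// gerBl.
have FC n r : `|F n r| <= 1 by exact: oneX01.
have kapC n (x : R) : 0 <= x <= 1 -> `|kap n x| <= n.+2%:R.
  move=> x01; have /andP[h1 h2] := X01 n x x01.
  rewrite normrN normrM !ger0_norm// (@le_trans _ _ n.+1%:R)// ?ler_nat//.
  by rewrite ler_piMr.
have H n : \int[mu]_(x in `[0, 1]) (rho tau x * (1 - x ^+ n.+1)) =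
    \int[mu]_(t in `[0, tau]) (cspeed t * \int[mu]_(x in `[0, 1]) (rho t x * kap n x)) +
    \int[mu]_r (if r <= tau then v r * F n r else 0).
  have n2 : (1 : R) <= n.+2%:R by rewrite ler1n.
  have cX k : continuous (fun z : R * R => z.2 ^+ k).
    move=> z; apply: (@continuous_comp _ _ _ snd (fun y : R => y ^+ k) z); first exact: cvg_snd.
    exact: exprn_continuous.
  apply: (@evolution tau (fun _ x => 1 - x ^+ n.+1) (fun _ _ => 0) (fun _ => kap n) (kap n) (F n) n.+2%:R) => //.
  - by move=> z; apply: cvgB; [exact: cvg_cst|exact: cX].
  - by move=> z; exact: cvg_cst.
  - by move=> z; apply: cvgN; apply: cvgM; [exact: cvg_cst|exact: cX].
  - move=> t x t0; split; first exact: is_derive_cst.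
    have d := is_deriveB (is_derive_cst (1 : R) x 1) (is_deriveX n.+1 (is_derive_id x (1 : R))).
    rewrite (_ : (fun y : R => 1 - y ^+ n.+1) = (cst 1 : R -> R) - (id : R -> R) ^+ n.+1); last first.
      by apply/funext => y; rewrite !fctE.
    apply: (is_derive_eq d); rewrite /kap sub0r /GRing.scale/= mulr1.
    by rewrite -mulr_natl.
  - by move=> t _; rewrite expr1n subrr.
  - by move=> t x _ _; rewrite add0r.
  - by move=> x; exact: kapC.
  - by move=> t x _ x01; exact: le_trans (oneX01 _ _ x01) _.
  - by move=> s t x _ _ _; rewrite subrr normr0 mulr_ge0.
  - by move=> r; exact: le_trans (FC _ _) _.
  - move=> t /andP[t0 _]; rewrite /F /c01 /clip max_r ?oppr_le0// min_l//.
  - by move=> x /andP[x0 x1]; rewrite /F /c01 /clip opprK max_l// min_l.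
have cP := section_flux_continuous tT.
(* the interior term, as an average of the flux P over the positions *)
have Q n : \int[mu]_(t in `[0, tau]) (cspeed t * \int[mu]_(x in `[0, 1]) (rho t x * kap n x)) =
    - \int[mu]_(x in `[0, 1]) (P x * (n.+1%:R * x ^+ n / 1 ^+ n.+1)).
  pose G (z : R * R) := (if z.1 \in `[0, tau] then cspeed z.1 else 0) *
    (((fun z : measurableTypeR R * measurableTypeR R => rho z.1 z.2) \_ (`[0, T] `*` `[0, 1])) z * kap n z.2).
  have GE t x : G (t, x) = if t \in `[0, tau] then
      (if x \in `[0, 1] then cspeed t * (rho t x * kap n x) else 0) else 0.
    rewrite /G /= patchE in_setX !mem_setE /= !in_itv/=.
    case: ifP => [/andP[t0 tt]|_]; last by rewrite mul0r.
    rewrite t0 (le_trans tt tauT)/=; case: ifP => // _; by rewrite mul0r mulr0.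
  have mG : measurable_fun setT G.
    apply: measurable_funM.
      apply: (measurableT_comp (f := fun t => if t \in `[0, tau] then cspeed t else 0)) => //.
      apply: measurable_if_real => //; first exact: measurable_mem_itv.
      exact: cspeed_measurable.
    apply: measurable_funM; last exact: measurableT_comp.
    case: sol => mrho _ _; move/(measurable_restrictT _ _).1 : mrho; apply.
    by apply: measurableX.
  have tT' t : t \in `[0, tau] -> 0 <= t <= T.
    by rewrite in_itv/= => /andP[-> h]; exact: le_trans tauT.
  have ik t : 0 <= t <= T -> mu.-integrable `[0, 1] (EFin \o (fun x => rho t x * kap n x)).
    move=> tt'; apply: (integrableM_bounded (C := n.+2%:R)) => //; first exact: sol_integrable.
      exact: measurable_funTS.
    by move=> x; rewrite /= in_itv/=; exact: kapC.
  have LG t : L1 (fun x => G (t, x)).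
    have [tt|tt] := boolP (t \in `[0, tau]); last first.
      by under eq_fun do rewrite GE (negbTE tt); exact: L1_0.
    under eq_fun do rewrite GE tt; apply/L1_ifP.
    exact: integrable_realZ (ik _ (tT' _ tt)).
  pose C := M * (n.+2%:R * `|B|).
  have LC : L1 (fun t => if t \in `[0, tau] then C else 0).
    by apply/L1_ifP; exact: (@bounded_integrable _ _ `|C|).
  have Gle t : \int[mu]_x `|G (t, x)| <= if t \in `[0, tau] then C else 0.
    have [tt|tt] := boolP (t \in `[0, tau]); last first.
      under eq_Rintegral do rewrite GE (negbTE tt) normr0.
      by rewrite Int0.
    have tT'' := tT' t tt.
    rewrite (_ : \int[mu]_x `|_| = \int[mu]_(x in `[0, 1]) `|cspeed t * (rho t x * kap n x)|); last first.
      rewrite IntE; apply: eq_Rintegral => x _; rewrite GE tt.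
      by case: ifP => //; rewrite normr0.
    have ic := integrable_realZ (cspeed t) (measurable_itv _) (ik t tT'').
    have ir := integrable_norm (sol_integrable tT'').
    apply: (@le_trans _ _ (\int[mu]_(x in `[0, 1]) (M * (n.+2%:R * `|rho t x|)))).
      apply: le_Rintegral => //; first exact: integrable_norm.
        by do 2 apply: integrable_realZ => //.
      move=> x; rewrite /= in_itv/= => x01; rewrite normrM; apply: ler_pM => //.
      by rewrite normrM mulrC; apply: ler_wpM2r => //; exact: kapC.
    rewrite RintegralZl//; last by apply: integrable_realZ.
    rewrite RintegralZl// /C !ler_wpM2l//.
    by apply: le_trans (rhoB t tT'') _; exact: ler_norm.
  have [L1a L1b sw] := Int_fubini mG LG LC Gle.
  transitivity (\int[mu]_t \int[mu]_x G (t, x)).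
    rewrite IntE; apply: eq_Rintegral => t _.
    have [tt|tt] := boolP (t \in `[0, tau]); last first.
      under eq_Rintegral do rewrite GE (negbTE tt).
      by rewrite Int0.
    have ikt := ik _ (tT' _ tt).
    rewrite -RintegralZl; [|exact: measurable_itv|exact: ikt].
    by rewrite IntE; apply: eq_Rintegral => x _; rewrite GE tt.
  rewrite sw; clear L1a L1b sw Gle LC LG; transitivity (\int[mu]_(x in `[0, 1]) (P x * kap n x)).
    rewrite IntE; apply: eq_Rintegral => x _; case: (boolP (x \in `[0, 1])) => x01; last first.
      under eq_Rintegral do rewrite GE (negbTE x01) if_same.
      by rewrite Int0.
    have x01' : 0 <= x <= 1 by move: x01; rewrite in_itv.
    have is_ := section_integrable tT x01'.
    rewrite /P -RintegralZr; [|exact: measurable_itv|exact: is_].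
    rewrite [RHS]IntE; apply: eq_Rintegral => t _; rewrite GE x01.
    by case: ifP => _; [ring|].
  have iP : mu.-integrable `[0, 1] (EFin \o (fun x => P x * (n.+1%:R * x ^+ n / 1 ^+ n.+1))).
    apply: continuous_compact_integrable; first exact: segment_compact.
    have cw : continuous (fun x : R => n.+1%:R * x ^+ n / 1 ^+ n.+1).
      move=> y; apply: cvgM; last exact: cvg_cst.
      by apply: cvgM; [exact: cvg_cst|exact: exprn_continuous].
    have cw' : {within `[0, 1], continuous (fun x : R => n.+1%:R * x ^+ n / 1 ^+ n.+1)}.
      exact: continuous_subspaceT cw.
    by move=> x; apply: cvgM; [exact: cP|exact: cw'].
  rewrite -[RHS]mulN1r -RintegralZl//; apply: eq_Rintegral => x _.
  by rewrite /kap expr1n divr1; ring.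
have lim1 := power_concentration ltr01 cP.
have lim2 : (\int[mu]_(x in `[0, 1]) (rho tau x * (1 - x ^+ n.+1))) @[n --> \oo] --> W rho tau.
  apply: pairing_cvg_W => [|n|n x|x /andP[x0 x1]]; first by rewrite (ltW tau0).
  - exact: measurable_funB.
  - exact: oneX01.
  - rewrite -[X in _ --> X]subr0; apply: cvgB; first exact: cvg_cst.
    have xlt : `|x| < 1 by rewrite ger0_norm.
    by have := cvg_expr xlt; rewrite -(cvg_shiftS (fun n => x ^+ n)).
have lim3 : (\int[mu]_r (if r <= tau then v r * F n r else 0)) @[n --> \oo] --> prim v tau.
  have mle : measurable_fun setT (fun r => r <= tau) by exact: measurable_fun_ler.
  rewrite /prim IntE; apply: (@Int_cvg_ae _ _ _ (fun r => `|v r|)).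
  - by move=> n; apply: measurable_if_real => //; exact: measurable_funM.
  - by apply: measurable_if_real => //; exact: measurable_mem_itv.
  - apply: aeS (ae_neq (-1)) => r r1; rewrite in_itv/=; case: ifP => _; last exact: cvg_cst.
    have [r11|r11] := ltP (-1) r; last first.
      have -> : v r = 0.
        apply: (influx_supp iv); rewrite negb_and -ltNge lt_neqAle r1 r11//.
      by under eq_fun do rewrite mul0r; exact: cvg_cst.
    rewrite -[X in _ --> X]mulr1; apply: cvgM; first exact: cvg_cst.
    rewrite -[X in _ --> X]subr0; apply: cvgB; first exact: cvg_cst.
    have clt : `|c01 r| < 1.
      have /andP[h _] := c01I r; rewrite ger0_norm// /c01 /clip gt_min gt_max ltr01 andbT.
      by rewrite ltrNl r11.
    by have := cvg_expr clt; rewrite -(cvg_shiftS (fun n => c01 r ^+ n)).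
  - exact: L1_norm.
  - move=> n r; case: ifP => _; last by rewrite normr0.
    by rewrite normrM ler_piMr.
have lim4 := cvgD (cvgN lim1) lim3.
have E : (fun n => \int[mu]_(x in `[0, 1]) (rho tau x * (1 - x ^+ n.+1))) =
  (fun n => - (\int[mu]_(x in `[0, 1]) (P x * (n.+1%:R * x ^+ n / 1 ^+ n.+1)))
     + \int[mu]_r (if r <= tau then v r * F n r else 0)).
  by apply/funext => n; rewrite H Q.
move: lim2; rewrite E => lim2.
have -> := cvg_unique (@Rhausdorff R) lim2 (lim4 _ _).
rewrite opprD opprK addrCA subrr addr0 /P; apply: eq_Rintegral => t.
rewrite inE/= in_itv/= => /andP[t0 tt].
by rewrite mulrC /cspeed clip_id// t0 (le_trans tt).
Qed.

End FromWeakSolution.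

(** * The characteristic of a weak solution *)

Section ClippedSpeed.
Context {R : realType}.
Local Notation mu := (@lebesgue_measure R).

Lemma C1_setT_continuous (f : R -> R) : C1_on setT f -> continuous f.
Proof. by move=> [df [cf _ _]]; apply/continuous_subspace_setT. Qed.

(** On the compact interval [[0, K]], [lam] is bounded away from 0 and
    Lipschitz, being of class C^1. Clipping its argument makes these bounds
    global, and does not matter for masses that stay in [[0, K]]. *)
Lemma clipped_speed (lam : R -> R) (K : R) : C1_on setT lam ->
  (forall w, 0 < lam w) -> 0 <= K ->
  exists m M L, [/\ [/\ 0 < m, m <= 1, 1 <= M & 0 <= L],
    forall w, m <= lam (clip K w) <= M &
    forall w w', `|lam (clip K w) - lam (clip K w')| <= L * `|w - w'|].
Proof.
move=> lC1 lp K0; have cl := C1_setT_continuous lC1.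
have [dl [_ cdl dlE]] := lC1.
have {}cdl : continuous dl by apply/continuous_subspace_setT.
have cw : {within `[0, K], continuous lam} by exact: continuous_subspaceT cl.
have cnd : continuous (fun x => `|dl x|) by move=> x; apply: cvg_norm; exact: cdl.
have cw' : {within `[0, K], continuous (fun x => `|dl x|)} by exact: continuous_subspaceT cnd.
have [a aK aM] := EVT_max K0 cw; have [b bK bm] := EVT_min K0 cw.
have [c cK cM] := EVT_max K0 cw'.
have cin w : clip K w \in `[0, K] by rewrite in_itv/= clip_itv.
exists (Num.min (lam b) 1), (Num.max (lam a) 1), `|dl c|; split.
- by rewrite lt_min lp ltr01 ge_min lexx orbT le_max lexx orbT normr_ge0.
- by move=> w; rewrite ge_min le_max bm ?aM.
- move=> w w'.
  have P x y : x <= y -> 0 <= x -> y <= K -> `|lam y - lam x| <= `|dl c| * (y - x).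
    move=> xy x0 yK; have dE (z : R) : is_derive z (1 : R) lam (dl z) by apply: dlE; rewrite interiorT.
    have [z zxy ->] := @MVT_segment R lam dl x y xy (fun z _ => dE z)
      (continuous_subspaceT cl).
    rewrite normrM (ger0_norm (_ : 0 <= y - x)) ?subr_ge0// ler_wpM2r ?subr_ge0//.
    apply: cM; move: zxy; rewrite !in_itv/= => /andP[h1 h2].
    by rewrite (le_trans x0 h1) (le_trans h2 yK).
  apply: (@le_trans _ _ (`|dl c| * `|clip K w - clip K w'|)).
    have /andP[h1 h2] := clip_itv w K0; have /andP[h3 h4] := clip_itv w' K0.
    have [h|/ltW h] := leP (clip K w) (clip K w').
      by rewrite [`|lam _ - _|]distrC [`|clip _ _ - _|]distrC [`|clip _ _ - _|]ger0_norm ?subr_ge0//; exact: P.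
    by rewrite [`|clip _ _ - _|]ger0_norm ?subr_ge0//; exact: P.
  by rewrite ler_wpM2l//; exact: clip_lip.
Qed.

(** The mass is at most the integral of [v], that is an increment of its
    primitive, which [prim_holder] bounds. *)
Lemma mass_bounds (T E m M K : R) (v xi : R -> R) t : influx T E v -> 0 < m ->
  bilip m M xi -> 0 <= K -> 0 <= T -> E * (T + 2) <= K ^+ 2 -> 0 <= mass v xi t <= K.
Proof.
move=> iv m0 xib K0 T0 EK; have Lv := influx_L1 iv.
apply/andP; split.
  by rewrite subr_ge0 prim_le//; [exact: influx_ge0 iv|exact: (back_le m0 xib t)].
have T2 : -2 <= T by apply: le_trans T0; rewrite oppr_le0.
(* the left end is -2 because primitives have increments over half-open
   intervals, and the support contains -1 *)
have := bounded_primC (s := -2) (t := T) (influx_L2 iv) Lv (influx_le iv) K0.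
rewrite (_ : T - -2 = T + 2); last by ring.
rewrite (ger0_norm (addr_ge0 T0 (ler0n R 2))).
move=> /(_ EK); apply: le_trans; apply: le_trans (ler_norm _).
rewrite /mass !primB//; last exact: (back_le m0 xib t).
apply: Int_le; [exact: L1_if (measurable_between_lt _ _) Lv|exact: L1_if (measurable_between_lt _ _) Lv|move=> r].
have v0 := influx_ge0 iv r.
case: ifP => _; last by case: ifP.
case: ifP => // /negP h; rewrite (influx_supp iv)//; apply/negP => /andP[r1 r2]; apply: h.
by rewrite r2 andbT; apply: lt_le_trans r1; rewrite ltrN2 ltr1n.
Qed.

(** By [sol_mass] the speed of the solution is the one prescribed by its own
    characteristic at positive times; the bounds [m] and [M] reach time 0 by
    continuity. *)
Lemma sol_characteristic (lam : R -> R) (T K m M E : R) (rho0 u : R -> R) rho :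
  C1_on setT lam -> (forall w, 0 < lam w) -> 0 < T ->
  in_Lp 2%:E `[0, T] u -> ae_nonneg `[0, T] u ->
  in_Lp 2%:E `[0, 1] rho0 -> ae_nonneg `[0, 1] rho0 ->
  is_weak_solution lam T rho0 u rho ->
  influx T E (vin T rho0 u) ->
  0 <= K -> E * (T + 2) <= K ^+ 2 -> 0 < m -> m <= 1 -> 1 <= M ->
  (forall w, m <= lam (clip K w) <= M) ->
  characteristic (lam \o clip K) m M (vin T rho0 u) (xi lam T rho) T.
Proof.
move=> lC1 lp T0 uL u0 rL r0 sol iv K0 EK m0 m1 M1 mM.
have cl := C1_setT_continuous lC1; set v := vin T rho0 u in iv *.
have [m' [M' [m'0 _ _ xib' _]]] := xi_bilip cl lp T0 sol.
have mb t : 0 <= mass v (xi lam T rho) t <= K.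
  exact: mass_bounds iv m'0 xib' K0 (ltW T0) EK.
have cE t : 0 < t <= T -> cspeed lam T rho t = speed (lam \o clip K) v (xi lam T rho) t.
  move=> tT; have /andP[t0 t1] := tT.
  rewrite /cspeed clip_id ?(ltW t0)// (sol_mass cl lp T0 uL u0 rL r0 sol tT).
  by rewrite /speed /= clip_id.
have cc := cspeed_continuous cl T0 sol.
have cpos t : 0 < t -> m <= cspeed lam T rho t <= M.
  move=> t0; have -> : cspeed lam T rho t = cspeed lam T rho (clip T t).
    by rewrite /cspeed (clip_id (clip_itv t (ltW T0))).
  rewrite cE; first exact: mM.
  have /andP[_ ->] := clip_itv t (ltW T0); rewrite andbT /clip lt_min T0 andbT lt_max t0//.
have cb t : m <= cspeed lam T rho t <= M.
  have [t0|t0] := ltP 0 t; first exact: cpos.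
  have -> : cspeed lam T rho t = cspeed lam T rho 0.
    by rewrite /cspeed /clip !(max_r t0) max_l.
  have c0 : cspeed lam T rho s @[s --> 0^'+] --> cspeed lam T rho 0.
    by apply: cvg_at_right_filter; exact: cc.
  apply/andP; split.
    by apply: (cvgr_to_ge c0); near=> s; have /cpos/andP[] : 0 < s by near: s; exact: nbhs_right_gt.
  by apply: (cvgr_to_le c0); near=> s; have /cpos/andP[] : 0 < s by near: s; exact: nbhs_right_gt.
split.
- apply: trajectory_bilip => //; first exact: ltW.
  by apply: continuous_measurable_fun.
- by move=> t; exact: trajectory_neg.
- move=> t /andP[t0 tT]; rewrite /xi trajectory_pos// -/(xi lam T rho).
  have mc : measurable_fun setT (cspeed lam T rho) by exact: continuous_measurable_fun.
  rewrite !IntE; apply: Int_ae_eq.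
  + by apply: measurable_if_real => //; exact: measurable_mem_itv.
  + apply: measurable_if_real => //; first exact: measurable_mem_itv.
    apply: continuous_measurable_fun => x.
    apply: (@continuous_comp _ _ _ (mass v (xi lam T rho)) (lam \o clip K)).
      exact: (mass_continuous m'0 iv xib').
    by apply: continuous_comp; [exact: clip_continuous|exact: cl].
  + apply: aeS (ae_neq 0) => s s0; rewrite in_itv/=; case: ifP => // /andP[s1 s2].
    by rewrite cE// lt_neqAle eq_sym s0 s1 (le_trans s2).
Unshelve. all: by end_near. Qed.

End ClippedSpeed.

(** * Continuity of translations *)

Section Translation.
Context {R : realType}.
Local Notation mu := (@lebesgue_measure R).
Implicit Types (h g : R -> R) (d x A e : R).

Let shift_cov (d a b : R) : a <= b ->
  (\int[mu]_(x in (fun x => (x + d)%R) @^-1` `]a, b]) (1 : R)%:E = (b - a)%:E)%E.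
Proof.
move=> ab; rewrite (_ : _ @^-1` _ = `]a - d, b - d]%classic); last first.
  by apply/seteqP; split => x; rewrite /= !in_itv/= ltrBlDr lerBrDr.
rewrite integral_cst//= mul1e lebesgue_measure_itv/= lte_fin ltrD2r.
have E : b - d - (a - d) = b - a by ring.
case: ltP => [_|ba]; first by rewrite -EFinD E.
by rewrite (le_anti (introT andP (conj ab ba))) subrr.
Qed.

Lemma Int_shift d h : L1 h -> \int[mu]_x h (x + d) = \int[mu]_x h x.
Proof.
move=> Lh; rewrite [RHS](@Int_cov R (fun=> 1) _ _ (fun x => x + d) _ (shift_cov d) h Lh)//.
  by apply: eq_Rintegral => x _; rewrite mulr1.
exact: measurable_funD.
Qed.

Lemma L1_shift d h : L1 h -> L1 (fun x => h (x + d)).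
Proof.
move=> Lh; have m1 : measurable_fun setT (fun _ : R => 1 : R) by [].
have md : measurable_fun setT (fun x : R => x + d) by exact: measurable_funD.
have := (@L1_cov R (fun=> 1) m1 (fun=> ler01) (fun x => x + d) md (shift_cov d) h (L1_measurable Lh)).2 Lh.
by under eq_fun do rewrite mulr1; apply.
Qed.

(** A function that is continuous on a neighbourhood of the support
    approximates [h] in L^1, and dominated convergence applies to it. *)
Lemma L1_translation h A : L1 h -> 0 <= A -> supported (- A) A h ->
  \int[mu]_x `|h (x + d) - h x| @[d --> 0] --> (0 : R).
Proof.
move=> Lh A0 hA; apply/cvgrPdist_lt => e e0.
(* for shifts of size at most 1, h (x + d) - h x vanishes outside [-(A + 1),
   A + 1], and a point x of this interval has x + d in [-B, B] *)
pose B := A + 2; have BB : - B <= B by rewrite /B; lra.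
have mE : measurable `[- B, B] by exact: measurable_itv.
have [g [cg ig Lg]] : exists g, [/\ continuous g, mu.-integrable `[- B, B] (EFin \o g) &
    \int[mu]_(x in `[- B, B]) `|h x - g x| < e / 4].
  pose I : set R := [set` `[- B, B]].
  have fE : (mu I < +oo)%E.
    by rewrite /I lebesgue_measure_itv/=; case: ifP => // _; rewrite -EFinD ltry.
  have ih : mu.-integrable `[- B, B] (EFin \o h) by exact: L1_itv_integrable.
  have [g_ [cg ig]] := approximation_continuous_integrable mE fE ih.
  have e4 : 0 < e / 4 by rewrite divr_gt0.
  move=> /fine_cvgP[_ /cvgrPdist_lt/(_ _ e4)[n _ /(_ n (leqnn n))]].
  rewrite sub0r normrN => hn; exists (g_ n); split => //.
  apply: le_lt_trans hn; apply: le_trans (ler_norm _).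
  by rewrite /Rintegral /=.
pose cl x := Num.min (Num.max x (- B)) B.
have clE x : - B <= x <= B -> cl x = x.
  by move=> /andP[h1 h2]; rewrite /cl max_l// min_l.
have clI x : cl x \in `[- B, B].
  by rewrite in_itv/= /cl le_min ge_min le_max !lexx !orbT BB.
have ccl : continuous cl.
  apply: lip1_continuous => s t; exact: le_trans (min_lip _ _ _) (max_lip _ _ _).
pose gc x := g (cl x).
have cgc : continuous gc by move=> x; apply: continuous_comp; [exact: ccl|exact: cg].
have mgc : measurable_fun setT gc by exact: continuous_measurable_fun.
have cng : {within `[- B, B], continuous (fun x => `|g x|)}.
  have cng' : continuous (fun x => `|g x|) by move=> x; apply: cvg_norm; exact: cg.
  exact: continuous_subspaceT cng'.
have [b _ gb] := EVT_max BB cng.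
have gcb x : `|gc x| <= `|g b| by apply: gb.
pose H d x := if x \in `[- (A + 1), A + 1] then `|gc (x + d) - gc x| else 0.
have mH d : measurable_fun setT (H d).
  apply: measurable_if_real => //; first exact: measurable_mem_itv.
  apply: measurableT_comp => //; apply: measurable_funB => //.
  by apply: measurableT_comp => //; exact: measurable_funD.
have Hle d x : `|H d x| <= (2 * `|g b|) * \1_`[- (A + 1), A + 1] x.
  rewrite /H indicE mem_setE; case: ifP => _; last by rewrite normr0 mulr0.
  rewrite normr_id mulr1; apply: (le_trans (ler_normB _ _)).
  by have := gcb x; have := gcb (x + d); lra.
have LH d : L1 (H d) := L1_dominated (mH d) (L1_itv _ _ _) (Hle d).
have H0 : \int[mu]_x H d x @[d --> 0] --> (0 : R).
  apply/(@cvg_nbhsP _ R^o) => u u0; rewrite -(@Int0 R).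
  apply: (Int_cvg _ _ (L1_itv (2 * `|g b|) _ _) (fun n x => Hle (u n) x)).2 => // x.
  have [xF|xF] := boolP (x \in `[- (A + 1), A + 1]); last first.
    rewrite (_ : (fun n => H (u n) x) = (fun=> 0)); first exact: cvg_cst.
    by apply/funext => n; rewrite /H (negbTE xF).
  rewrite (_ : (fun n => H (u n) x) = (fun n => `|gc (x + u n) - gc x|)); last first.
    by apply/funext => n; rewrite /H xF.
  rewrite -[X in _ --> X](normr0 R); apply: cvg_norm.
  rewrite -[X in _ --> X](subrr (gc x)); apply: cvgB; last exact: cvg_cst.
  have ux : x + u n @[n --> \oo] --> x.
    by rewrite -[X in _ --> X]addr0; apply: cvgD => //; exact: cvg_cst.
  exact: (cvg_comp _ gc ux (cgc x)).
pose k x := if x \in `[- B, B] then `|h x - g x| else 0.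
have Lk : L1 k.
  by apply/L1_ifP; apply: integrable_norm => //; apply: integrable_realB => //; exact: L1_itv_integrable.
have Ik : \int[mu]_x k x < e / 4 by rewrite /k -IntE.
have e2 : 0 < e / 2 by rewrite divr_gt0.
move/cvgrPdist_lt : (H0) => /(_ _ e2) H0'.
have N1 : \forall d \near nbhs (0 : R), `|d| <= 1.
  have := @nbhsx_ballx _ R^o (0 : R) 1 ltr01; apply: filterS => d.
  by rewrite /ball/= sub0r normrN => /ltW.
near=> d.
have d1 : `|d| <= 1 by near: d.
have Hd : \int[mu]_x H d x < e / 2.
  apply: le_lt_trans (ler_norm _) _; rewrite -normrN -[- _]add0r.
  by near: d.
have pw x : `|h (x + d) - h x| <= k (x + d) + (k x + H d x).
  have k0 y : 0 <= k y by rewrite /k; case: ifP.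
  have H00 : 0 <= H d x by rewrite /H; case: ifP.
  have /andP[d1' d1''] : - 1 <= d <= 1 by rewrite -ler_norml.
  have [xF|xF] := boolP (x \in `[- (A + 1), A + 1]); last first.
    have hx : ~~ (- A <= x <= A).
      by apply: contra xF => /andP[h1 h2]; rewrite in_itv/=; apply/andP; split; lra.
    have hx' : ~~ (- A <= x + d <= A).
      by apply: contra xF => /andP[h1 h2]; rewrite in_itv/=; apply/andP; split; lra.
    by rewrite !hA// subrr normr0 !addr_ge0.
  move: xF; have -> : H d x = (if x \in `[- (A + 1), A + 1] then `|gc (x + d) - gc x| else 0) by [].
  move=> xF; rewrite xF; move: xF; rewrite in_itv/= => /andP[x1 x2].
  have xE : - B <= x <= B by rewrite /B; apply/andP; split; lra.
  have xE' : - B <= x + d <= B by rewrite /B; apply/andP; split; lra.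
  rewrite /k !in_itv/= xE xE' /gc !clE//.
  rewrite (_ : h (x + d) - h x = (h (x + d) - g (x + d)) + ((g (x + d) - g x) - (h x - g x))); last by ring.
  apply: (le_trans (ler_normD _ _)); rewrite lerD2l [leRHS]addrC.
  exact: ler_normB.
have Lh' := L1_norm (L1B (L1_shift d Lh) Lh).
have Lr := L1D (L1_shift d Lk) (L1D Lk (LH d)).
rewrite sub0r normrN ger0_norm; last by apply: Int_ge0.
apply: (le_lt_trans (Int_le Lh' Lr pw)).
rewrite RintegralD//; [|exact: L1_shift|exact: L1D].
rewrite (Int_shift d Lk) RintegralD//; last exact: LH.
have fin (p q : R) : p < e / 4 -> q < e / 2 -> p + (p + q) < e by clear; move=> ? ?; lra.
exact: fin.
Unshelve. all: by end_near. Qed.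

Definition clamp_abs K x := Num.max (Num.min x K) (- K).

Lemma clamp_abs_le K x : 0 <= K -> `|clamp_abs K x| <= K.
Proof.
move=> K0; rewrite /clamp_abs ler_norml le_max lexx orbT ge_max ge_min lexx orbT/=.
by rewrite (le_trans _ K0)// oppr_le0.
Qed.

Lemma sqr_sub_clamp_abs K x : 0 <= K -> (x - clamp_abs K x) ^+ 2 <= x ^+ 2.
Proof.
move=> K0; rewrite /clamp_abs; case: (leP x K) => a1.
  by case: (leP x (- K)) => a2; nra.
by case: (leP K (- K)) => a2; nra.
Qed.

(** Truncated at height [n], [h] is bounded and its translations are
    controlled by [L1_translation]. The remainder has a small L^2 norm,
    which translations preserve. *)
Lemma L2_translation h A : L2 h -> 0 <= A -> supported (- A) A h ->
  \int[mu]_x (h (x + d) - h x) ^+ 2 @[d --> 0] --> (0 : R).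
Proof.
move=> [mh Lh2] A0 hA.
have Lh := L2_supported_L1 (conj mh Lh2) hA.
have h1 := L1_translation Lh A0 hA.
pose r n x := h x - clamp_abs n%:R (h x).
have mc n : measurable_fun setT (fun x => clamp_abs n%:R (h x)).
  by apply: measurable_maxr => //; exact: measurable_minr.
have mr n : measurable_fun setT (r n) by exact: measurable_funB.
have rle n x : `|r n x ^+ 2| <= h x ^+ 2.
  by rewrite ger0_norm ?sqr_ge0//; exact: sqr_sub_clamp_abs.
have Lr n : L1 (fun x => r n x ^+ 2).
  by apply: L1_dominated Lh2 (rle n); exact: measurable_funX.
have R0 : \int[mu]_x r n x ^+ 2 @[n --> \oo] --> (0 : R).
  rewrite -(@Int0 R); apply: (Int_cvg _ _ Lh2 rle).2.
    by move=> n; exact: measurable_funX.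
  move=> x; have c0 : cvg_to (nbhs (fmap (fun n => (0 : R)) \oo)) (nbhs (0 : R)) by exact: cvg_cst.
  apply: cvg_trans c0; apply: near_eq_cvg; near=> n.
  have hn : `|h x| <= n%:R by near: n; exact: nbhs_infty_ger.
  move: hn; rewrite ler_norml => /andP[n1 n2].
  by rewrite /r /clamp_abs min_l// max_l// subrr expr0n.
apply/cvgrPdist_lt => e e0.
have e16 : 0 < e / 16 by rewrite divr_gt0.
have [n _ /(_ n (leqnn n))] := (cvgrPdist_lt _ _).1 R0 _ e16.
rewrite /= sub0r normrN ger0_norm => [rn|]; last by apply: Int_ge0 => x; exact: sqr_ge0.
have K0 : 0 < 8 * (n%:R + 1) :> R by rewrite mulr_gt0// ltr_wpDl.
have eK : 0 < e / (8 * (n%:R + 1)) by rewrite divr_gt0.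
move/cvgrPdist_lt : (h1) => /(_ _ eK) h1'.
near=> d.
have Hd : \int[mu]_x `|h (x + d) - h x| < e / (8 * (n%:R + 1)).
  apply: le_lt_trans (ler_norm _) _; rewrite -normrN -[- _]add0r.
  by near: d.
have clamp_sqr x y : (clamp_abs n%:R x - clamp_abs n%:R y) ^+ 2 <= 2 * n%:R * `|x - y|.
  have n0 : 0 <= n%:R :> R by [].
  rewrite -(real_normK (num_real _)) expr2 ler_pM//.
    have b z : `|clamp_abs n%:R z| <= n%:R :> R by exact: clamp_abs_le.
    by apply: (le_trans (ler_normB _ _)); have := b x; have := b y; lra.
  exact: le_trans (max_lip _ _ _) (min_lip _ _ _).
have pw x : (h (x + d) - h x) ^+ 2 <=
    2 * (2 * n%:R) * `|h (x + d) - h x| + (4 * r n (x + d) ^+ 2 + 4 * r n x ^+ 2).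
  have := clamp_sqr (h (x + d)) (h x); rewrite /r.
  set a := clamp_abs _ _; set b := clamp_abs _ _; set w := `|_|.
  have := sqr_ge0 ((a - b) - ((h (x + d) - a) - (h x - b))).
  have := sqr_ge0 ((h (x + d) - a) + (h x - b)).
  by rewrite /=; nra.
have Ld := L1_norm (L1B (L1_shift d Lh) Lh).
have Lrd := L1_shift d (Lr n).
have Lrhs := L1D (L1Z (2 * (2 * n%:R)) Ld) (L1D (L1Z 4 Lrd) (L1Z 4 (Lr n))).
have msh : measurable_fun setT (fun x => h (x + d)) by apply: L1_measurable; exact: L1_shift.
have Llhs : L1 (fun x => (h (x + d) - h x) ^+ 2).
  apply: L1_dominated Lrhs _; first by apply: measurable_funX; exact: measurable_funB.
  by move=> x; rewrite ger0_norm ?sqr_ge0.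
rewrite sub0r normrN ger0_norm; last by apply: Int_ge0 => x; exact: sqr_ge0.
apply: (le_lt_trans (Int_le Llhs Lrhs pw)).
rewrite RintegralD//; [|exact: L1Z|by apply: L1D; exact: L1Z].
rewrite RintegralD//; [|exact: L1Z|exact: L1Z].
have IS : \int[mu]_x r n (x + d) ^+ 2 = \int[mu]_x r n x ^+ 2 := Int_shift d (Lr n).
have IZ k f : L1 f -> \int[mu]_x (k * f x) = k * \int[mu]_x f x.
  by move=> Lf; rewrite RintegralZl.
rewrite (IZ _ _ Ld) (IZ _ _ Lrd) (IZ _ _ (Lr n)) IS.
move: Hd; rewrite ltr_pdivlMr// => Hd.
have I0 : 0 <= \int[mu]_x `|h (x + d) - h x| by exact: Int_ge0.
clear - I0 Hd rn; move: I0 Hd rn; nra.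
Unshelve. all: by end_near. Qed.

End Translation.

(** * Functions of class C^1 on a rectangle *)

Section Rectangle.
Context {R : realType}.
Local Notation mu := (@lebesgue_measure R).
Implicit Types (t s r x y z a b e : R).

Variables (tau : R) (phi phi_t phi_x : R -> R -> R).
Hypotheses (tau0 : 0 < tau) (phiC1 : C1_rect tau phi phi_t phi_x).

Let Q : set (R * R) := `[0, tau] `*` `[0, 1].

Let QE t x : Q (t, x) <-> 0 <= t <= tau /\ 0 <= x <= 1.
Proof. by rewrite /Q /=; split => -[]; rewrite !in_itv/=. Qed.

Lemma within_comp (F : R -> R -> R) (D : set R) (p q : R -> R) :
  {within Q, continuous (fun w : R * R => F w.1 w.2)} -> continuous p -> continuous q ->
  (forall t, D t -> 0 <= p t <= tau /\ 0 <= q t <= 1) ->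
  {within D, continuous (fun t => F (p t) (q t))}.
Proof.
move=> /subspace_continuousP cF cp cq DQ; apply/subspace_continuousP => t Dt.
have Qt : Q (p t, q t) by apply/QE; exact: DQ.
have := cF _ Qt; apply: cvg_trans => U hU.
have {}hU : nbhs (p t, q t) (fun w : R * R => Q w -> U (F w.1 w.2)) := hU.
change (nbhs t (fun s => D s -> U (F (p s) (q s)))).
have cpq : (fun s => (p s, q s)) @ t --> (p t, q t) by exact: (cvg_pair (cp t) (cq t)).
have hV : nbhs t (fun s => Q (p s, q s) -> U (F (p s) (q s))) := cpq _ hU.
apply: filterS hV => s h Ds; apply: h; apply/QE; exact: DQ.
Qed.

(** Clipping the arguments extends a function given on the rectangle to a
    continuous function on the plane. *)
Lemma clip_comp_continuous (F : R -> R -> R) (p q : R -> R) :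
  {within Q, continuous (fun w : R * R => F w.1 w.2)} -> continuous p -> continuous q ->
  continuous (fun t => F (clip tau (p t)) (clip 1 (q t))).
Proof.
move=> cF cp cq; apply/continuous_subspace_setT.
apply: (within_comp (p := fun t => clip tau (p t)) (q := fun t => clip 1 (q t)) cF).
- by move=> t; apply: continuous_comp; [exact: cp|exact: clip_continuous].
- by move=> t; apply: continuous_comp; [exact: cq|exact: clip_continuous].
- by move=> t _; rewrite !clip_itv// ltW.
Qed.

Lemma within_ball (F : R -> R -> R) t x e :
  {within Q, continuous (fun w : R * R => F w.1 w.2)} -> 0 <= t <= tau -> 0 <= x <= 1 -> 0 < e ->
  exists2 del, 0 < del & forall s y, 0 <= s <= tau -> 0 <= y <= 1 ->
    `|t - s| < del -> `|x - y| < del -> `|F s y - F t x| <= e.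
Proof.
move=> /subspace_continuousP cF tt xx e0.
have Qt : Q (t, x) by apply/QE.
have /cvgrPdist_le /(_ e e0) hU := cF _ Qt.
have : nbhs ((t, x) : R * R) (fun w => Q w -> `|F t x - F w.1 w.2| <= e) := hU.
move=> /nbhs_ballP[del /= del0 hb].
exists del => // s y ss yy ts xy; rewrite distrC.
by apply: (hb (s, y)) => //; apply/QE.
Qed.

(** The increment of the first variable is taken at the moved second
    variable [X s]; the mean value theorem and the joint continuity of
    [phi_t] compare it with [phi_t t (X t)]. *)
Lemma rect_derive t (X : R -> R) d : 0 < t < tau -> 0 < X t < 1 -> continuous X ->
  is_derive t (1 : R) X d ->
  is_derive t (1 : R) (fun s => phi s (X s)) (phi_t t (X t) + d * phi_x t (X t)).
Proof.
move=> tt Xt cX dX; have [c0 c1 c2 dphi] := phiC1.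
have D2 : is_derive t (1 : R) (fun s => phi t (X s)) (d * phi_x t (X t)).
  have [_ dx] := dphi t (X t) tt Xt.
  have dd := @is_derive1_comp R (phi t) X t _ _ dx dX.
  by apply: (is_derive_eq dd); rewrite mulrC.
have D1 : is_derive t (1 : R) (fun s => phi s (X s) - phi t (X s)) (phi_t t (X t)).
  apply: is_derive_eps => e e0.
  have tt' : 0 <= t <= tau by case/andP: tt => h1 h2; rewrite !ltW.
  have XX' : 0 <= X t <= 1 by case/andP: Xt => h1 h2; rewrite !ltW.
  have [del del0 hdel] := within_ball c1 tt' XX' e0.
  pose d1 := Num.min del (Num.min t (tau - t)).
  have d10 : 0 < d1 by case/andP: tt => h1 h2; rewrite !lt_min del0 h1 subr_gt0 h2.
  pose d2 := Num.min del (Num.min (X t) (1 - X t)).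
  have d20 : 0 < d2 by case/andP: Xt => h1 h2; rewrite !lt_min del0 h1 subr_gt0 h2.
  have /cvgrPdist_lt/(_ _ d20)/nbhs_ballP[d3 /= d30 h3] := cX t.
  exists (Num.min d1 d3); first by rewrite lt_min d10.
  move=> h; rewrite lt_min => /andP[hd1 hd3].
  have := h3 (t + h); rewrite /ball/= opprD addrA subrr sub0r normrN => /(_ hd3) hX.
  move: hX; rewrite !lt_min => /and3P[X1 X2 X3].
  move: hd1; rewrite !lt_min => /and3P[t1 t2 t3].
  have Xs : 0 < X (t + h) < 1.
    move: X2 X3; rewrite !ltr_norml => /andP[? ?] /andP[? ?]; apply/andP; split; lra.
  have Xs' : 0 <= X (t + h) <= 1 by case/andP: Xs => q1 q2; rewrite !ltW.
  have inside z : `|z| <= `|h| -> 0 < t + z < tau.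
    move=> zh; have := le_lt_trans zh t2; have := le_lt_trans zh t3.
    rewrite !ltr_norml => /andP[? ?] /andP[? ?]; apply/andP; split; lra.
  set y := X (t + h) in X1 X2 X3 Xs Xs' *.
  have mvt a b : a <= b -> (forall z, a <= z <= b -> 0 < z < tau /\ `|t - z| <= `|h|) ->
      `|phi b y - phi a y - phi_t t (X t) * (b - a)| <= e * (b - a).
    move=> ab hz.
    have dE z : a <= z <= b -> is_derive z (1 : R) (phi^~ y) (phi_t z y).
      by move=> zab; exact: (dphi z y (hz z zab).1 Xs).1.
    have cc : {within `[a, b], continuous (phi^~ y)}.
      apply: derivable_within_continuous => z; rewrite in_itv/= => zab.
      by have [] := dE z zab.
    have dE' z : z \in `]a, b[ -> is_derive z (1 : R) (phi^~ y) (phi_t z y).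
      by rewrite in_itv/= => /andP[z1 z2]; apply: dE; rewrite !ltW.
    have [z zab ->] := @MVT_segment R (phi^~ y) (phi_t^~ y) a b ab dE' cc.
    rewrite -mulrBl normrM (ger0_norm (_ : 0 <= b - a)) ?subr_ge0//.
    rewrite ler_wpM2r ?subr_ge0//; have [z1 z2] := hz z zab.
    apply: hdel => //; last exact: le_lt_trans z2 t1.
    by case/andP: z1 => q1 q2; rewrite !ltW.
  have E1 : t + h - t = h by ring.
  have E2 : t - (t + h) = - h by ring.
  rewrite subrr subr0; have [h0|/ltW h0] := leP 0 h.
    have := mvt t (t + h); rewrite E1 (ger0_norm h0); apply; first by rewrite lerDl.
    move=> z /andP[z1 z2]; rewrite distrC ger0_norm ?subr_ge0//.
    split; last by rewrite lerBlDl.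
    have -> : z = t + (z - t) by ring.
    by apply: inside; rewrite !ger0_norm ?subr_ge0// lerBlDl.
  have := mvt (t + h) t; rewrite E2 (ler0_norm h0).
  rewrite -(normrN (phi (t + h) y - _ - _)).
  rewrite (_ : - (_ - _ - _) = phi t y - phi (t + h) y - phi_t t (X t) * - h); last by ring.
  apply; first by rewrite gerDl.
  move=> z /andP[z1 z2]; rewrite ger0_norm ?subr_ge0//.
  split; last by rewrite lerBlDl -lerBlDr opprK.
  have -> : z = t + (z - t) by ring.
  by apply: inside; rewrite distrC ger0_norm ?subr_ge0// ler0_norm// lerBlDl -lerBlDr opprK.
have := is_deriveD D1 D2.
rewrite (_ : _ + _ = (fun s => phi s (X s))); last by apply/funext => s; rewrite !fctE subrK.
by [].
Qed.

(** The path may touch the boundary of the rectangle at its end points,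
    where continuity replaces differentiability. *)
Lemma rect_FTC (X X' : R -> R) a b : 0 <= a -> a <= b -> b <= tau ->
  continuous X -> continuous X' ->
  (forall t, a < t < b -> is_derive t (1 : R) X (X' t)) ->
  (forall t, a <= t <= b -> 0 <= X t <= 1) -> (forall t, a < t < b -> 0 < X t < 1) ->
  \int[mu]_(t in `[a, b]) (phi_t t (X t) + X' t * phi_x t (X t)) =
  phi b (X b) - phi a (X a).
Proof.
move=> a0 ab btau cX cX' dX X01 Xoo; have [c0 c1 c2 _] := phiC1.
move: ab; rewrite le_eqVlt => /predU1P[->|ab].
  by rewrite set_itv1 Rintegral_set1 subrr.
have DQ t : `[a, b]%classic t -> 0 <= t <= tau /\ 0 <= X t <= 1.
  rewrite /= in_itv/= => tab; split; last exact: X01.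
  by case/andP: tab => h1 h2; rewrite (le_trans a0 h1) (le_trans h2).
have cid_ : continuous (id : R -> R) by move=> t; exact: cvg_id.
have cF := within_comp c0 cid_ cX DQ.
have cf1 := within_comp c1 cid_ cX DQ.
have cf2 := within_comp c2 cid_ cX DQ.
have cf : {within `[a, b], continuous (fun t => phi_t t (X t) + X' t * phi_x t (X t))}.
  have cX'w : {within `[a, b], continuous X'} by exact: continuous_subspaceT cX'.
  by move=> t; apply: cvgD; [exact: cf1|apply: cvgM; [exact: cX'w|exact: cf2]].
have [_ cFa cFb] := (continuous_within_itvP _ ab).1 cF.
have dF t : a < t < b -> is_derive t (1 : R) (fun s => phi s (X s)) (phi_t t (X t) + X' t * phi_x t (X t)).
  move=> tab; apply: rect_derive => //; [|exact: Xoo|exact: dX].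
  by case/andP: tab => h1 h2; rewrite (le_lt_trans a0 h1) (lt_le_trans h2).
have := @continuous_FTC2 R (fun t => phi_t t (X t) + X' t * phi_x t (X t)) (fun s => phi s (X s)) a b ab cf.
rewrite /Rintegral => ->//.
  split => // t; rewrite in_itv/= => tab; by have [] := dF t tab.
move=> t; rewrite in_itv/= => tab; rewrite derive1E; by have [] := dF t tab.
Qed.

Lemma rect_bounded : exists C, forall t x, 0 <= t <= tau -> 0 <= x <= 1 ->
  [/\ `|phi t x| <= C, `|phi_t t x| <= C & `|phi_x t x| <= C].
Proof.
have [c0 c1 c2 _] := phiC1.
have cQ : compact Q by apply: compact_setX; exact: segment_compact.
have B (F : R -> R -> R) : {within Q, continuous (fun w : R * R => F w.1 w.2)} ->
    exists C, forall t x, 0 <= t <= tau -> 0 <= x <= 1 -> `|F t x| <= C.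
  move=> cF; have /compact_bounded[N [_ hN]] := continuous_compact cF cQ.
  exists (N + 1) => t x tt xx; apply: (hN (N + 1)); first by rewrite ltrDl.
  by exists (t, x) => //; apply/QE.
have [C0 h0] := B _ c0; have [C1 h1] := B _ c1; have [C2 h2] := B _ c2.
exists (Num.max C0 (Num.max C1 C2)) => t x tt xx.
by rewrite !le_max h0// h1// h2// !orbT.
Qed.

End Rectangle.

(** * Existence of a weak solution *)

(** [F] is the pointwise limit of [F (floor (N x) / N) y], each of which is
    made of countably many measurable sections. *)
Lemma measurable_caratheodory (R : realType) (F : R -> R -> R) :
  (forall y, continuous (F^~ y)) -> (forall x, measurable_fun setT (F x)) ->
  measurable_fun setT (fun z : measurableTypeR R * measurableTypeR R => F z.1 z.2).
Proof.
move=> cF mF; pose N (n : nat) : R := n.+1%:R.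
have N0 n : 0 < N n by rewrite ltr0n.
pose q n (x : R) : R := (Num.floor (N n * x))%:~R / N n.
pose h n (z : measurableTypeR R * measurableTypeR R) := F (q n z.1) z.2.
apply: (@measurable_fun_cvg _ _ R setT h).
  move=> n _ B mB; rewrite setTI.
  have -> : h n @^-1` B = \bigcup_(k in [set: int])
      (`[k%:~R / N n, (k + 1)%:~R / N n[%classic `*` (F (k%:~R / N n) @^-1` B)).
    apply/seteqP; split => [[x y] /= Bxy|[x y] [k _ [/= xk yk]]].
      exists (Num.floor (N n * x)) => //; split => //=.
      by rewrite in_itv/= ler_pdivrMr// ltr_pdivlMr// mulrC floor_le_tmp floorD1_gt.
    rewrite /h /q /= (_ : Num.floor (N n * x) = k)//.
    apply: Num.Theory.floor_def; move: xk.
    by rewrite in_itv/= ler_pdivrMr// ltr_pdivlMr// mulrC.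
  apply: countable_bigcupT_measurable; first exact: countableP.
  move=> k; apply: measurableX; first exact: measurable_itv.
  by have := mF (k%:~R / N n) measurableT B mB; rewrite setTI.
move=> [x y] _; rewrite /h /=.
have qx : q n x @[n --> \oo] --> x.
  apply/cvgrPdist_le => e e0; near=> n.
  have f1 : (Num.floor (N n * x))%:~R <= N n * x by exact: floor_le_tmp.
  have f2 : N n * x < (Num.floor (N n * x))%:~R + 1.
    by have := floorD1_gt (N n * x); rewrite intrD.
  have -> : x - q n x = (N n * x - (Num.floor (N n * x))%:~R) / N n.
    by rewrite /q; field; rewrite gt_eqF.
  rewrite normrM normfV (ger0_norm (ltW (N0 n))) ler_pdivrMr//.
  rewrite ger0_norm ?subr_ge0//; apply: (@le_trans _ _ 1); first lra.
  rewrite mulrC -ler_pdivrMr// /N -natr1; apply: (@le_trans _ _ n%:R); last by rewrite lerDl.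
  by near: n; exact: nbhs_infty_ger.
exact: (cvg_comp _ (F^~ y) qx (cF y x)).
Unshelve. all: by end_near. Qed.

Section Existence.
Context {R : realType}.
Local Notation mu := (@lebesgue_measure R).
Implicit Types (t s r x y z a b e : R).
Variables (lam : R -> R) (m M L : R).
Hypotheses (m0 : 0 < m) (m1 : m <= 1) (M1 : 1 <= M) (L0 : 0 <= L).
Hypothesis lam_bounds : forall w, m <= lam w <= M.
Hypothesis lam_lip : forall w w', `|lam w - lam w'| <= L * `|w - w'|.
Variables (T E : R) (v xi : R -> R).
Hypotheses (T0 : 0 < T) (iv : influx T E v).
Hypothesis xic : forall S, characteristic lam m M v xi S.

Let xib : bilip m M xi. Proof. by case: (xic 0). Qed.
Let xi_neg t : t <= 0 -> xi t = t. Proof. by case: (xic 0) => _ + _; apply. Qed.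
Let c := speed lam v xi.
Let cc : continuous c := speed_continuous m0 L0 lam_lip iv xib.
Let mc : measurable_fun setT c := speed_measurable m0 L0 lam_lip iv xib.
Let cM t : `|c t| <= M := speed_norm m0 lam_bounds v xi t.
Let M0 : 0 < M. Proof. exact: lt_le_trans M1. Qed.

Let xi_traj : xi = trajectory c.
Proof.
apply/funext => t; have [t0|/ltW t0] := leP t 0; first by rewrite xi_neg// trajectory_neg.
by rewrite trajectory_pos//; case: (xic t) => _ _; apply; rewrite t0 lexx.
Qed.

Let cxi : continuous xi := bilip_continuous m0 xib.
Let mxi : measurable_fun setT xi. Proof. exact: continuous_measurable_fun cxi. Qed.

(** The derivative of [xi] away from 0. *)
Definition density r := if r <= 0 then 1 else speed lam v xi r.

Lemma density_bounds r : m <= density r <= M.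
Proof. by rewrite /density; case: ifP => _; [rewrite m1 M1|exact: lam_bounds]. Qed.

Let d0 r : 0 < density r.
Proof. by have /andP[h _] := density_bounds r; exact: lt_le_trans h. Qed.

Let dM r : `|density r| <= M.
Proof. by have /andP[_ h] := density_bounds r; rewrite ger0_norm// ltW. Qed.

Lemma density_measurable : measurable_fun setT density.
Proof. by apply: measurable_if_real => //; exact: measurable_fun_ler. Qed.

Let md := density_measurable.

Lemma Int_density s t : s <= t -> \int[mu]_(r in `[s, t]) density r = xi t - xi s.
Proof.
have P a b : 0 <= a -> a <= b -> \int[mu]_(r in `[a, b]) density r = xi b - xi a.
  move=> a0 ab; rewrite xi_traj !trajectory_pos ?(le_trans a0)//.
  rewrite (Int_itv_split mc cM)// !IntE; apply: Int_ae_eq.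
  - by apply: measurable_if_real => //; exact: measurable_mem_itv.
  - by apply: measurable_if_real => //; exact: measurable_mem_itv.
  - apply: aeS (ae_neq 0) => r r0; rewrite in_itv/=; case: ifP => // /andP[h1 h2].
    by rewrite /density leNgt lt_neqAle eq_sym r0 (le_trans a0 h1).
have N a b : a <= b -> b <= 0 -> \int[mu]_(r in `[a, b]) density r = xi b - xi a.
  move=> ab b0; rewrite !xi_neg ?(le_trans ab)// -[RHS]mul1r -Int_itv_cst//.
  apply: eq_Rintegral => r; rewrite inE/= in_itv/= => /andP[_ h].
  by rewrite /density (le_trans h).
move=> st; have [s0|/ltW s0] := leP 0 s; first exact: P.
have [t0|/ltW t0] := leP t 0; first exact: N.
have := Int_itv_split md dM s0 t0; rewrite (P 0 t (lexx _) t0) (N s 0 s0 (lexx _)); lra.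
Qed.

Let theta := binv xi.
Let xiK : cancel xi theta. Proof. by case: (binvP m0 xib). Qed.
Let thetaK : cancel theta xi. Proof. by case: (binvP m0 xib). Qed.
Let mtheta : measurable_fun setT theta.
Proof.
case: (binvP m0 xib) => _ _ bb; apply: continuous_measurable_fun.
by apply: bilip_continuous bb; rewrite invr_gt0.
Qed.

(** The condition under which integrals can be transported from the labels
    by [xi]. *)
Lemma xi_density a b : a <= b ->
  (\int[mu]_(r in xi @^-1` `]a, b]) (density r)%:E = (b - a)%:E)%E.
Proof.
move=> ab; have tab : theta a <= theta b by rewrite -(bilip_leE _ _ m0 xib) !thetaK.
rewrite (_ : _ @^-1` _ = `]theta a, theta b]%classic); last first.
  apply/seteqP; split => r; rewrite /= !in_itv/= -(bilip_ltE (theta a) r m0 xib);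
  by rewrite -(bilip_leE r (theta b) m0 xib) !thetaK.
have I : mu.-integrable `[theta a, theta b] (EFin \o density).
  exact: bounded_integrable md dM.
have I' : mu.-integrable `]theta a, theta b] (EFin \o density).
  by apply: integrableS I => //; apply: subset_itvr; rewrite bnd_simp.
rewrite (Int_EFin (measurable_itv _) I'); congr EFin; transitivity (\int[mu]_(r in `[theta a, theta b]) density r).
  by rewrite -(Rintegral_itv_obnd_cbnd _ (f := density))//.
by rewrite Int_density// !thetaK.
Qed.

(** The density of particles as a function of [z = xi t - x], which is
    constant along the characteristics and equal to [xi r] for the particle
    with label [r]. The flux [v r] at label [r] is this density times the
    speed. *)
Definition profile z := v (theta z) / density (theta z).

Let mv := influx_meas iv.

Lemma profile_measurable : measurable_fun setT profile.
Proof.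
apply: measurable_funM; first exact: measurableT_comp mtheta.
apply: (measurableT_comp (f := fun r => (density r)^-1)) => //.
have -> : (fun r => (density r)^-1) = (fun r => if r <= 0 then 1 else (c r)^-1).
  by apply/funext => r; rewrite /density; case: ifP; rewrite ?invr1.
apply: measurable_if_real => //; first exact: measurable_fun_ler.
apply: continuous_measurable_fun => r; apply: cvgV; last exact: cc.
by rewrite gt_eqF//; have /andP[h _] := lam_bounds (mass v xi r); exact: lt_le_trans h.
Qed.

Let mh := profile_measurable.

Let profile_xi r : profile (xi r) * density r = v r.
Proof. by rewrite /profile xiK divfK// gt_eqF. Qed.

Let d0' r : 0 <= density r := ltW (d0 r).

Lemma profile_L1 : L1 profile.
Proof.
apply: (L1_cov md d0' mxi xi_density mh).1.
by under eq_fun do rewrite profile_xi; exact: influx_L1 iv.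
Qed.

(** Substituting [z = xi r], the integral of [profile^2] becomes that of
    [v^2 / density], and the density is at least [m]. *)
Lemma profile_L2 : L2 profile.
Proof.
split => //; have mh2 := measurable_funX 2 mh.
apply: (L1_cov md d0' mxi xi_density mh2).1.
apply: L1_dominated (L1Z m^-1 (influx_sqr iv)) _.
  by apply: measurable_funM => //; exact: measurableT_comp mh2 mxi.
move=> r; have /andP[dm _] := density_bounds r.
rewrite (ger0_norm (mulr_ge0 (sqr_ge0 _) (d0' r))).
rewrite -(profile_xi r) (_ : m^-1 * _ = profile (xi r) ^+ 2 * (m^-1 * density r ^+ 2)); last by ring.
rewrite ler_wpM2l ?sqr_ge0//.
by rewrite mulrC ler_pdivlMr// expr2 ler_wpM2l.
Qed.

Lemma Int_profile (g : R -> R) C : measurable_fun setT g -> (forall z, `|g z| <= C) ->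
  \int[mu]_z (profile z * g z) = \int[mu]_r (v r * g (xi r)).
Proof.
move=> mg gC; have Lg := L1M_bounded profile_L1 mg gC.
rewrite (Int_cov md d0' mxi xi_density Lg); apply: eq_Rintegral => r _.
by rewrite -(profile_xi r) mulrAC.
Qed.

Let A := 1 + xi T.
Let xi0 : xi 0 = 0. Proof. exact: xi_neg. Qed.
Let xi_ge0 t : 0 <= t -> 0 <= xi t.
Proof. by move=> t0; rewrite -xi0 (bilip_leE _ _ m0 xib). Qed.
Let A0 : 0 <= A. Proof. by rewrite addr_ge0// xi_ge0// ltW. Qed.

Lemma profile_supp : supported (- A) A profile.
Proof.
move=> z zA; rewrite /profile (influx_supp iv) ?mul0r//; apply: contra zA => /andP[h1 h2].
move: h1 h2; rewrite -(bilip_leE (-1) (theta z) m0 xib) -(bilip_leE (theta z) T m0 xib) thetaK.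
rewrite (xi_neg (_ : -1 <= 0)) ?oppr_le0// => h1 h2.
have := xi_ge0 (ltW T0); rewrite /A => h3; apply/andP; split; lra.
Qed.

Definition solution t x := profile (xi t - x).

Lemma L1_solution t : L1 (solution t).
Proof.
have := L1_shift (- xi t) (L1_reflect profile_L1).
by under eq_fun do rewrite opprB.
Qed.

(** The substitution [x = xi t - xi r] leads from the positions at time [t]
    to the labels. *)
Lemma Int_solution t (G : R -> R) C : measurable_fun setT G -> (forall x, `|G x| <= C) ->
  \int[mu]_(x in `[0, 1]) (solution t x * G x) =
  \int[mu]_r (if 0 <= xi t - xi r <= 1 then v r * G (xi t - xi r) else 0).
Proof.
move=> mG GC; have C0 : 0 <= C := le_trans (normr_ge0 _) (GC 0).
pose g z := if xi t - z \in `[0, 1] then G (xi t - z) else 0.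
have mz : measurable_fun setT (fun z => xi t - z) by exact: measurable_funB.
have mg : measurable_fun setT g.
  apply: measurable_if_real => //; last exact: measurableT_comp mz.
  exact: measurable_mem_itv.
have gC z : `|g z| <= C by rewrite /g; case: ifP => _; rewrite ?normr0.
have Lg := L1M_bounded profile_L1 mg gC.
transitivity (\int[mu]_z (profile z * g z)).
  rewrite (Int_reflect Lg) -(Int_shift (- xi t) (L1_reflect Lg)) IntE.
  apply: eq_Rintegral => x _; rewrite opprB /g /solution.
  by rewrite (_ : xi t - (xi t - x) = x); [case: ifP; rewrite ?mulr0|ring].
rewrite (Int_profile mg gC); apply: eq_Rintegral => r _; rewrite /g in_itv/=.
by case: ifP; rewrite ?mulr0.
Qed.

Lemma W_solution t : W solution t = mass v xi t.
Proof.
have := @Int_solution t (fun=> 1) 1 (measurable_cst _) _; rewrite normr1 => /(_ (fun=> lexx _)).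
rewrite /W; under eq_Rintegral do rewrite mulr1.
move=> ->; rewrite /mass primB; [|exact: influx_L1 iv|exact: (back_le m0 xib t)].
apply: Int_ae_eq.
- apply: measurable_if_real => //; last by under eq_fun do rewrite mulr1.
  have := @measurable_mem_itv _ _ _ (fun r => xi t - xi r) `[0, 1].
  have mB : measurable_fun setT (fun r => xi t - xi r) by exact: measurable_funB.
  by move=> /(_ mB); apply: eq_measurable_fun => r _; rewrite in_itv.
- by apply: measurable_if_real => //; exact: measurable_between_lt.
- apply: aeS (ae_neq (back xi t)) => r rn; rewrite mulr1.
  rewrite subr_ge0 (bilip_leE _ _ m0 xib) lerBlDr -lerBlDl -(xi_back m0 xib).
  rewrite (bilip_leE _ _ m0 xib) andbC; congr (if _ && _ then _ else _).
  by rewrite lt_neqAle eq_sym rn.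
Qed.

Lemma solution_measurable (D : set (R * R)) :
  measurable_fun D (fun z : measurableTypeR R * measurableTypeR R => solution z.1 z.2).
Proof.
apply: measurable_funTS; apply: measurableT_comp mh _.
by apply: measurable_funB => //; exact: measurableT_comp mxi _.
Qed.

(** The solution at time [t] is a translate of the reflected profile by [xi
    t]. *)
Lemma solution_C0_L1 : C0_Lp 1%:E `[0, T] `[0, 1] solution.
Proof.
have I t : mu.-integrable `[0, 1] (EFin \o solution t).
  exact: L1_itv_integrable (L1_solution t).
split=> [t _|s0 _]; first by apply/in_L1P.
have Id s : mu.-integrable `[0, 1] (EFin \o (fun x => solution s x - solution s0 x)).
  by apply: integrable_realB.
have NE s : ('N[mu]_1[EFin \o ((fun x => (solution s x - solution s0 x)%R) \_ `[0%R, 1%R])] =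
    (\int[mu]_(x in `[0, 1]) `|solution s x - solution s0 x|)%:E)%E.
  have In : mu.-integrable `[0, 1] (EFin \o (fun x => `|solution s x - solution s0 x|)).
    exact: integrable_norm.
  rewrite Lnorm1 -(Int_EFin (measurable_itv _) In).
  rewrite [RHS]integral_mkcond; apply: eq_integral => x _ /=.
  by rewrite !patchE; case: ifP => //=; rewrite normr0.
under eq_fun do rewrite NE.
apply/fine_cvgP; split; first exact: nearW.
rewrite /= -[fine \o _]/(fun s => \int[mu]_(x in `[0, 1]) `|solution s x - solution s0 x|).
pose K d := \int[mu]_z `|profile (z + d) - profile z|.
have K0 := L1_translation profile_L1 A0 profile_supp.
have K1 : K (xi s - xi s0) @[s --> within `[0, T] (nbhs s0)] --> (0 : R).
  apply: cvg_within_filter.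
  have dx : xi s - xi s0 @[s --> s0] --> (0 : R).
    by rewrite -[X in _ --> X](subrr (xi s0)); apply: cvgB; [exact: cxi|exact: cvg_cst].
  exact: (cvg_comp _ K dx K0).
apply: (squeeze_cvgr _ (cvg_cst 0) K1); apply: nearW => s; apply/andP; split.
  exact: Rintegral_ge0.
have Ld := L1_norm (L1B (L1_shift (xi s - xi s0) profile_L1) profile_L1).
rewrite /K (Int_reflect Ld) -(Int_shift (- xi s0) (L1_reflect Ld)) IntE; apply: Int_le.
- by apply/L1_ifP; exact: integrable_norm.
- exact: L1_shift (L1_reflect Ld).
- move=> x; rewrite /solution; case: ifP => _; last by [].
  by rewrite opprB (_ : xi s0 - x + (xi s - xi s0) = xi s - x); [|ring].
Qed.

(** At position [x] the solution is [profile (xi t - x)]. The substitution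
    [z = xi t] costs at most a factor [m^-1] and leads to the continuity of
    the translations of the profile in L^2. *)
Lemma solution_sections : has_sections T solution.
Proof.
pose H a z := profile (z - a).
have LH a : L2 (H a).
  split; first by apply: measurableT_comp mh _; exact: measurable_funB.
  exact: (L1_shift (- a) profile_L2.2).
have cov (g : R -> R) : L1 g -> (forall z, 0 <= g z) ->
    L1 (fun t => if t \in `[0, T] then g (xi t) else 0) /\
    \int[mu]_(t in `[0, T]) g (xi t) <= m^-1 * \int[mu]_z g z.
  move=> Lg g0; have mg := L1_measurable Lg.
  have Lgd := (L1_cov md d0' mxi xi_density mg).2 Lg.
  have pw t : (if t \in `[0, T] then g (xi t) else 0) <= m^-1 * (g (xi t) * density t).
    have /andP[dm _] := density_bounds t.
    case: ifP => _; last by rewrite !mulr_ge0// invr_ge0 ltW.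
    by rewrite mulrC ler_pdivlMr// ler_wpM2l.
  have L1g : L1 (fun t => if t \in `[0, T] then g (xi t) else 0).
    apply: L1_dominated (L1Z m^-1 Lgd) _.
      by apply: measurable_if_real => //; [exact: measurable_mem_itv|exact: measurableT_comp mxi].
    by move=> t; rewrite ger0_norm//; case: ifP.
  split => //; rewrite IntE (Int_cov md d0' mxi xi_density Lg).
  by rewrite -RintegralZl//; apply: Int_le => //; exact: L1Z.
have L2s x : L2 ((fun t => solution t x) \_ `[0, T]).
  split.
    apply: (measurable_restrictT _ _).1 => //; apply: measurable_funTS.
    by apply: measurableT_comp mh _; exact: measurable_funB.
  have [h _] := cov _ (LH x).2 (fun z => sqr_ge0 _).
  rewrite (_ : (fun t => _) = (fun t => if t \in `[0, T] then H x (xi t) ^+ 2 else 0))//.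
  by apply/funext => t; rewrite patchE mem_setE; case: ifP; rewrite ?expr0n.
split=> [x _|x0 _]; first by apply/in_L2P.
have Ld x := L2B (L2s x) (L2s x0).
have NE x : ('N[mu]_2%:E[EFin \o ((fun t => (solution t x - solution t x0)%R) \_ `[0%R, T])] =
    (Num.sqrt (\int[mu]_(t in `[0, T]) (H x (xi t) - H x0 (xi t)) ^+ 2))%:E)%E.
  rewrite (_ : _ \_ _ = (fun t => ((fun t => solution t x) \_ `[0, T]) t -
      ((fun t => solution t x0) \_ `[0, T]) t)); last first.
    by apply/funext => t; rewrite !patchE; case: ifP => //; rewrite subrr.
  rewrite (Lnorm2E (Ld x)) IntE; congr (Num.sqrt _)%:E; apply: eq_Rintegral => t _.
  by rewrite !patchE mem_setE; case: ifP; rewrite ?subrr ?expr0n.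
under eq_fun do rewrite NE.
apply/fine_cvgP; split; first exact: nearW.
rewrite -[fine \o _]/(fun x => Num.sqrt (\int[mu]_(t in `[0, T]) (H x (xi t) - H x0 (xi t)) ^+ 2)).
pose K d := \int[mu]_z (profile (z + d) - profile z) ^+ 2.
have K0 := L2_translation profile_L2 A0 profile_supp.
have K1 : m^-1 * K (x0 - x) @[x --> within `[0, 1] (nbhs x0)] --> (0 : R).
  apply: cvg_within_filter.
  have dx : x0 - x @[x --> x0] --> (0 : R).
    by rewrite -[X in _ --> X](subrr x0); apply: cvgB; [exact: cvg_cst|exact: cvg_id].
  have h : m^-1 * K (x0 - x) @[x --> x0] --> m^-1 * (0 : R).
    by apply: cvgM; [exact: cvg_cst|exact: (cvg_comp _ K dx K0)].
  by rewrite mulr0 in h.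
have K2 : \int[mu]_(t in `[0, T]) (H x (xi t) - H x0 (xi t)) ^+ 2
    @[x --> within `[0, 1] (nbhs x0)] --> (0 : R).
  apply: (squeeze_cvgr _ (cvg_cst 0) K1); apply: nearW => x; apply/andP; split.
    by apply: Rintegral_ge0 => t _; exact: sqr_ge0.
  have LL := L2B (LH x) (LH x0).
  have [_ le] := cov _ LL.2 (fun z => sqr_ge0 _).
  have IS := Int_shift x0 LL.2.
  have KE : K (x0 - x) = \int[mu]_z (H x (z + x0) - H x0 (z + x0)) ^+ 2.
    by apply: eq_Rintegral => z _; rewrite /H addrA addrK.
  by rewrite KE IS.
rewrite -[X in _ --> X](sqrtr0 R); apply: (cvg_comp _ _ K2); exact: sqrt_continuous.
Qed.

(** In terms of labels, and with the integrals exchanged, the inner integral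
    runs over the times that the particle [r] spends in the interval, and
    its integrand is the derivative of [phi t (xi t - xi r)]. At the end of
    this time [phi] vanishes, either since the particle is at 1 or since the
    time is [tau]. At its beginning [phi] is evaluated at the entrance of
    the particle: at time [r] and position 0 if [r >= 0], at time 0 and
    position [- r] otherwise. *)
Lemma solution_weak tau (phi phi_t phi_x : R -> R -> R) : 0 < tau ->
  C1_rect tau phi phi_t phi_x -> (forall x, 0 <= x <= 1 -> phi tau x = 0) ->
  (forall t, 0 <= t <= tau -> phi t 1 = 0) ->
  \int[mu]_(t in `[0, tau]) (\int[mu]_(x in `[0, 1])
    (solution t x * (phi_t t x + c t * phi_x t x))) =
  - \int[mu]_r (if r <= tau then v r * phi (clip tau r) (clip 1 (- r)) else 0).
Proof.
move=> tau0 phiC1 phitau phi1; have [C hC] := rect_bounded phiC1.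
have [c0 c1 c2 _] := phiC1.
have ct t : 0 <= clip tau t <= tau by apply: clip_itv; exact: ltW.
have cx (x : R) : 0 <= clip 1 x <= 1 by exact: clip_itv.
have C0 : 0 <= C by have [h _ _] := hC _ _ (ct 0) (cx 0); exact: le_trans h.
pose G t x := phi_t (clip tau t) (clip 1 x) + c t * phi_x (clip tau t) (clip 1 x).
pose C' := C + M * C.
have GC t x : `|G t x| <= C'.
  have [_ h1 h2] := hC _ _ (ct t) (cx x); apply: (le_trans (ler_normD _ _)).
  by rewrite /C' lerD// normrM ler_pM.
have C'0 : 0 <= C' := le_trans (normr_ge0 _) (GC 0 0).
pose X r t := xi t - xi r.
have cX r : continuous (X r) by move=> t; apply: cvgB; [exact: cxi|exact: cvg_cst].
have cX2 t : continuous (fun r => X r t) by move=> r; apply: cvgB; [exact: cvg_cst|exact: cxi].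
have ccomp := clip_comp_continuous tau0.
have cid_ : continuous (id : R -> R) by move=> t; exact: cvg_id.
have ccst (k : R) : continuous (fun _ : R => k) by move=> t; exact: cvg_cst.
have cGX r : continuous (fun t => G t (X r t)).
  move=> t; apply: cvgD; first exact: (ccomp phi_t id (X r)).
  by apply: cvgM; [exact: cc|exact: (ccomp phi_x id (X r))].
have cG2 t (q : R -> R) : continuous q -> continuous (fun r => G t (q r)).
  move=> cq r; apply: cvgD; first exact: (ccomp phi_t (fun=> t) q).
  by apply: cvgM; [exact: cvg_cst|exact: (ccomp phi_x (fun=> t) q)].
have mGt t : measurable_fun setT (G t) by apply: continuous_measurable_fun; exact: cG2.
pose F r := phi (clip tau r) (clip 1 (- r)).
have mF : measurable_fun setT F.
  apply: continuous_measurable_fun; apply: (ccomp phi id) => // r.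
  by apply: cvgN; exact: cvg_id.
have FC r : `|F r| <= C by have [] := hC _ _ (ct r) (cx (- r)).
pose Fk (z : measurableTypeR R * measurableTypeR R) :=
  if (z.1 \in `[0, tau]) && (X z.2 z.1 \in `[0, 1]) then v z.2 * G z.1 (X z.2 z.1) else 0.
have mXX : measurable_fun setT (fun z : measurableTypeR R * measurableTypeR R => X z.2 z.1).
  by apply: measurable_funB; exact: measurableT_comp mxi _.
have mFk : measurable_fun setT Fk.
  apply: measurable_if_real => //.
    by apply: measurable_and; [exact: measurable_mem_itv|exact: measurable_mem_itv].
  apply: measurable_funM; first exact: measurableT_comp mv _.
  apply: (measurable_caratheodory (F := fun t r => G t (X r t))) => // t.
  by apply: continuous_measurable_fun; exact: cG2.
have v0 := influx_ge0 iv; have Lv := influx_L1 iv.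
have LC : L1 (fun t => if t \in `[0, tau] then C' else 0).
  by apply/L1_ifP; exact: (@bounded_integrable _ _ `|C'|).
have Fkle t r : `|Fk (t, r)| <= (if t \in `[0, tau] then C' else 0) * v r.
  rewrite /Fk /=; case: (t \in _) => /=; last by rewrite normr0 mul0r.
  case: ifP => _; last by rewrite normr0 mulr_ge0.
  by rewrite normrM (ger0_norm (v0 r)) mulrC ler_wpM2r.
have f0 t : 0 <= (if t \in `[0, tau] then C' else 0) by case: ifP.
have [LF1 LF2 _ _ sw] := Int_fubini_prod mFk LC Lv f0 v0 Fkle.
transitivity (\int[mu]_t \int[mu]_r Fk (t, r)).
  rewrite IntE; apply: eq_Rintegral => t _; rewrite /Fk /=.
  case: (boolP (t \in `[0, tau])) => tt; last by under eq_Rintegral do rewrite /=; rewrite Int0.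
  rewrite in_itv/= in tt.
  transitivity (\int[mu]_(x in `[0, 1]) (solution t x * G t x)).
    apply: eq_Rintegral => x; rewrite inE/= in_itv/= => xx.
    by rewrite /G !clip_id.
  rewrite (Int_solution t (mGt t) (GC t)); apply: eq_Rintegral => r _.
  by rewrite in_itv/=.
have LvF : L1 (fun r => if r <= tau then v r * F r else 0).
  apply: L1_if; first exact: measurable_fun_ler.
  exact: L1M_bounded Lv mF FC.
rewrite sw -[RHS]mulN1r -RintegralZl; [|exact: measurableT|exact: LvF].
apply: eq_Rintegral => r _.
clear sw LF1 LF2 LvF.
have [vr0|vr0] := eqVneq (v r) 0.
  under eq_Rintegral do rewrite /Fk /= vr0 mul0r if_same.
  by rewrite Int0 vr0 mul0r if_same mulr0.
have /andP[r1 rT] : -1 <= r <= T.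
  by apply: contraNT vr0 => h; rewrite (influx_supp iv h).
have Xge t : (0 <= X r t) = (r <= t) by rewrite /X subr_ge0 (bilip_leE _ _ m0 xib).
have Xle t : (X r t <= 1) = (t <= fwd xi r).
  by rewrite /X lerBlDl -(bilip_leE t _ m0 xib) (xi_fwd m0 xib).
have Xgt t : (0 < X r t) = (r < t) by rewrite /X subr_gt0 (bilip_ltE _ _ m0 xib).
have Xlt t : (X r t < 1) = (t < fwd xi r).
  by rewrite /X ltrBlDl -(bilip_ltE t _ m0 xib) (xi_fwd m0 xib).
have [rtau|rtau] := leP r tau; last first.
  rewrite mulr0 -[RHS](@Int0 R); apply: eq_Rintegral => t _; rewrite /Fk /= !in_itv/= Xge.
  case: (leP r t) => [rt|]; last by rewrite andbF.
  by rewrite (leNgt t tau) (lt_le_trans rtau rt) andbF.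
(* the particle r is in the interval between the times a and b *)
pose a := Num.max 0 r; pose b := Num.min tau (fwd xi r).
have rf := le_fwd m0 xib r.
have f00 : 0 <= fwd xi r.
  rewrite -(bilip_leE 0 _ m0 xib) (xi_fwd m0 xib) xi0.
  have : xi (-1) <= xi r by rewrite (bilip_leE _ _ m0 xib).
  by rewrite (xi_neg (_ : -1 <= 0)) ?oppr_le0//; lra.
have ab : a <= b by rewrite /a /b ge_max !le_min rtau rf f00 (ltW tau0).
have a0 : 0 <= a by rewrite /a le_max lexx.
have ra : r <= a by rewrite /a le_max lexx orbT.
have btau : b <= tau by rewrite /b ge_min lexx.
have bf : b <= fwd xi r by rewrite /b ge_min lexx orbT.
have FkE t : Fk (t, r) = if t \in `[a, b] then v r * G t (X r t) else 0.
  rewrite /Fk /= !in_itv/= Xge Xle /a /b ge_max le_min.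
  congr (if _ then _ else _).
  by case: (0 <= t); case: (r <= t); case: (t <= tau); case: (t <= fwd xi r).
under eq_Rintegral do rewrite FkE.
rewrite -IntE RintegralZl//; last first.
  apply: bounded_integrable (fun t => GC t (X r t)).
  by apply: continuous_measurable_fun; exact: cGX.
rewrite mulrCA; congr (_ * _).
have X01 t : a <= t <= b -> 0 <= X r t <= 1.
  by move=> /andP[h1 h2]; rewrite Xge Xle (le_trans ra h1) (le_trans h2 bf).
transitivity (\int[mu]_(t in `[a, b]) (phi_t t (X r t) + c t * phi_x t (X r t))).
  apply: eq_Rintegral => t; rewrite inE/= in_itv/= => tab.
  rewrite /G !clip_id//; first exact: X01.
  by case/andP: tab => h1 h2; rewrite (le_trans a0 h1) (le_trans h2 btau).
have dX t : a < t < b -> is_derive t (1 : R) (X r) (c t).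
  move=> /andP[h1 h2]; have t0 : 0 < t := le_lt_trans a0 h1.
  have d := is_deriveB (trajectory_derive cc cM t0) (is_derive_cst (xi r) t 1).
  rewrite -xi_traj subr0 in d; exact: d.
have Xoo t : a < t < b -> 0 < X r t < 1.
  by move=> /andP[h1 h2]; rewrite Xgt Xlt (le_lt_trans ra h1) (lt_le_trans h2 bf).
rewrite (rect_FTC phiC1 a0 ab btau (cX r) cc dX X01 Xoo).
have -> : phi b (X r b) = 0.
  have [h|h] := leP tau (fwd xi r).
    have bE : b = tau by rewrite /b min_l.
    have Xb := X01 b; rewrite ab lexx in Xb; rewrite bE in Xb *.
    by rewrite phitau// Xb.
  have bE : b = fwd xi r by rewrite /b min_r// ltW.
  have -> : X r b = 1 by rewrite bE /X (xi_fwd m0 xib); ring.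
  by rewrite phi1// (le_trans a0 ab).
rewrite sub0r mulN1r /F; congr (- _).
have [r0|/ltW r0] := leP r 0.
  have aE : a = 0 by rewrite /a max_l.
  rewrite aE /X xi0 (xi_neg r0) sub0r /clip (max_r r0) (min_l (ltW tau0)).
  by rewrite max_l ?oppr_ge0// min_l// lerNl.
have aE : a = r by rewrite /a max_r.
rewrite aE /X subrr clip_id ?r0//; congr (phi _ _).
by rewrite /clip max_r ?oppr_le0// min_l.
Qed.

End Existence.

Section WeakSolution.
Context {R : realType}.
Local Notation mu := (@lebesgue_measure R).
Implicit Types (t s r x : R).
Variables (lam : R -> R) (T : R) (rho0 u : R -> R).
Hypotheses (lC1 : C1_on setT lam) (lp : forall w, 0 < lam w) (T0 : 0 < T).
Hypotheses (rL : in_Lp 2%:E `[0, 1] rho0) (r0 : ae_nonneg `[0, 1] rho0).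
Hypothesis uP : L2plus T u.

Let uL : in_Lp 2%:E `[0, T] u. Proof. by case: uP. Qed.
Let u0 : ae_nonneg `[0, T] u. Proof. by case: uP. Qed.

(** The characteristic is built for the speed clipped at [K]. By
    [mass_bounds] the mass of the resulting solution never exceeds [K], so
    the solution has the speed prescribed by [lam] itself. *)
Lemma weak_solution_exists :
  exists rho, is_weak_solution lam T rho0 u rho /\ has_sections T rho.
Proof.
have iv := vin_influx T0 uL rL (lexx _); move: iv; set E := (_ + _) => iv.
set v := vin T rho0 u in iv.
have E0 : 0 <= E by apply: le_trans (influx_le iv); apply: Int_ge0 => x; exact: sqr_ge0.
pose K := Num.sqrt (E * (T + 2)).
have K0 : 0 <= K by exact: sqrtr_ge0.
have EK : E * (T + 2) <= K ^+ 2.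
  by rewrite sqr_sqrtr// mulr_ge0// addr_ge0// ltW.
have [m [M [L [[m0 m1 M1 L0] mM Llip]]]] := clipped_speed lC1 lp K0.
have [k k0 kE] := rate_exists m0 M1 L0 E0.
have [xi xic] := characteristic_exists m0 m1 M1 L0 mM Llip k0 kE iv.
have [xib _ _] := xic 0.
exists (solution (lam \o clip K) v xi); split; last first.
  exact: (solution_sections m0 m1 M1 L0 mM Llip T0 iv xic).
have WE t : lam (W (solution (lam \o clip K) v xi) t) = speed (lam \o clip K) v xi t.
  rewrite (W_solution m0 m1 M1 L0 mM Llip iv xic) /speed /=.
  by rewrite clip_id//; exact: mass_bounds iv m0 xib K0 (ltW T0) EK.
split.
- exact: (solution_measurable m0 M1 L0 mM Llip iv xic).
- exact: (solution_C0_L1 m0 m1 M1 L0 mM Llip T0 iv xic).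
move=> tau /andP[tau0 tauT] phi phi_t phi_x phiC1 phitau phi1.
move: tau0; rewrite le_eqVlt => /predU1P[tau0|tau0].
  rewrite -tau0 in phitau *; rewrite !set_itv1 !Rintegral_set1 !add0r.
  rewrite -[RHS](@Int0 R) IntE; apply: eq_Rintegral => x _.
  by rewrite in_itv/=; case: ifP => // xx; rewrite phitau// mulr0.
pose F r := phi (clip tau r) (clip 1 (- r)).
have ct t : 0 <= clip tau t <= tau by apply: clip_itv; exact: ltW.
have cx (x : R) : 0 <= clip 1 x <= 1 by exact: clip_itv.
have [C hC] := rect_bounded phiC1.
have FC r : `|F r| <= C by have [] := hC _ _ (ct r) (cx (- r)).
have mF : measurable_fun setT F.
  have [c0 _ _ _] := phiC1; apply: continuous_measurable_fun.
  have cid : continuous (id : R -> R) by move=> r; exact: cvg_id.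
  have cN : continuous (fun r : R => - r) by move=> r; apply: cvgN; exact: cvg_id.
  exact: (clip_comp_continuous tau0 c0 cid cN).
have tauT' : 0 <= tau <= T by rewrite (ltW tau0).
have p := vin_pairing T0 uL u0 rL r0 tauT' mF FC.
have e1 : \int[mu]_(t in `[0, tau]) (u t * phi t 0) = \int[mu]_(t in `[0, tau]) (u t * F t).
  apply: eq_Rintegral => t; rewrite inE/= in_itv/= => tt.
  rewrite /F clip_id//; congr (_ * phi _ _).
  by case/andP: tt => t0 _; rewrite /clip max_r ?oppr_le0// min_l.
have e2 : \int[mu]_(x in `[0, 1]) (rho0 x * phi 0 x) =
    \int[mu]_(x in `[0, 1]) (rho0 x * F (- x)).
  apply: eq_Rintegral => x; rewrite inE/= in_itv/= => xx.
  rewrite /F opprK [clip 1 x]clip_id//; congr (_ * phi _ _).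
  by case/andP: xx => x0 _; rewrite /clip max_r ?oppr_le0// min_l// ltW.
have e3 : \int[mu]_(t in `[0, tau]) (\int[mu]_(x in `[0, 1])
      (solution (lam \o clip K) v xi t x * (phi_t t x + lam (W (solution (lam \o clip K) v xi) t) * phi_x t x))) =
    \int[mu]_(t in `[0, tau]) (\int[mu]_(x in `[0, 1])
      (solution (lam \o clip K) v xi t x * (phi_t t x + speed (lam \o clip K) v xi t * phi_x t x))).
  by apply: eq_Rintegral => t _; apply: eq_Rintegral => x _; rewrite WE.
rewrite -addrA e1 e2 p e3.
rewrite (solution_weak m0 m1 M1 L0 mM Llip iv xic tau0 phiC1 phitau phi1).
by rewrite addNr.
Qed.

Let rho := weak_solution lam T rho0 u.

Lemma weak_solutionP : is_weak_solution lam T rho0 u rho /\ has_sections T rho.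
Proof.
rewrite /rho /weak_solution; have [rh rhP] := weak_solution_exists.
by case: xgetP => [r _ []|/(_ rh)].
Qed.

Lemma outflux_L2 : L2 (outflux lam T rho0 u \_ `[0, T]).
Proof.
have [sol sec] := weak_solutionP.
exact: (flux_L2 (C1_setT_continuous lC1) lp T0 sol sec).
Qed.

(** The conditions on [K], [m] and [M] involve the control through the bound
    [E] only, so that the characteristics of all controls below this bound
    can be compared. *)
Lemma outflux_characteristic (E K m M : R) : influx T E (vin T rho0 u) ->
  0 <= K -> E * (T + 2) <= K ^+ 2 -> 0 < m -> m <= 1 -> 1 <= M ->
  (forall w, m <= lam (clip K w) <= M) ->
  exists2 xi, characteristic (lam \o clip K) m M (vin T rho0 u) xi T &
    forall tau, 0 < tau <= T -> \int[mu]_(t in `[0, tau]) outflux lam T rho0 u t =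
      prim (vin T rho0 u) tau - mass (vin T rho0 u) xi tau.
Proof.
move=> iv K0 EK m0 m1 M1 mM; have [sol sec] := weak_solutionP.
have cl := C1_setT_continuous lC1.
exists (xi lam T rho).
  exact: (sol_characteristic lC1 lp T0 uL u0 rL r0 sol iv K0 EK m0 m1 M1 mM).
move=> tau tT; rewrite /outflux -/rho.
by rewrite (sol_flux cl lp T0 uL u0 rL r0 sol sec tT) (sol_mass cl lp T0 uL u0 rL r0 sol tT).
Qed.

End WeakSolution.

(** * Weak limits through primitives *)

Section WeakLimit.
Context {R : realType}.
Local Notation mu := (@lebesgue_measure R).
Implicit Types (f g h : R -> R) (a b t x A B C e : R).

(** The monotone limit has a finite integral, hence is finite almost
    everywhere. *)
Lemma beppo_levi (S : nat -> R -> R) B : (forall n, L1 (S n)) ->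
  (forall n x, 0 <= S n x) -> (forall x, nondecreasing_seq (S^~ x)) ->
  (forall n, \int[mu]_x S n x <= B) ->
  exists2 H, L1 H & {ae mu, forall x, forall n, S n x <= H x}.
Proof.
move=> LS S0 Sn SB; pose G x := limn (fun n => (S n x)%:E).
have mS n : measurable_fun setT (fun x => (S n x)%:E).
  by apply/measurable_EFinP; exact: L1_measurable.
have cS x : cvgn (fun n => (S n x)%:E).
  by apply: ereal_nondecreasing_is_cvgn => p q pq; rewrite lee_fin; exact: Sn.
have mG : measurable_fun setT G.
  by apply: (@emeasurable_fun_cvg _ _ R setT (fun n x => (S n x)%:E)).
have G0 x : (0 <= G x)%E by apply: lime_ge => //; apply: nearW => n; rewrite lee_fin.
have GB : (\int[mu]_x G x <= B%:E)%E.
  rewrite monotone_convergence//.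
  - apply: lime_le.
      apply: ereal_nondecreasing_is_cvgn => p q pq.
      rewrite (Int_EFin measurableT (LS p)) (Int_EFin measurableT (LS q)) lee_fin.
      by apply: Int_le; [exact: LS|exact: LS|move=> x; exact: Sn].
    by apply: nearW => n; rewrite (Int_EFin measurableT (LS n)) lee_fin.
  - by move=> n x _; rewrite lee_fin.
  - by move=> x _ p q pq; rewrite lee_fin; exact: Sn.
have IG : mu.-integrable setT G.
  apply/integrableP; split => //; under eq_integral do rewrite gee0_abs//.
  exact: le_lt_trans GB (ltry _).
exists (fine \o G).
  apply/integrableP; split; first exact/measurable_EFinP/measurableT_comp.
  have /integrableP[_] := IG; apply: le_lt_trans; apply: ge0_le_integral => //.
  - by apply: measurableT_comp => //; exact/measurable_EFinP/measurableT_comp.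
  - exact: measurableT_comp.
  - by move=> x _ /=; case: (G x) => [r| |]//=; rewrite normr0 leey.
have := integrable_ae measurableT IG; apply: aeS => x /(_ I) Gx n.
rewrite /= -lee_fin fineK//; apply: (lime_ge (cS x)).
by near=> p; rewrite lee_fin; apply: Sn; near: p; exact: nbhs_infty_ge.
Unshelve. all: by end_near. Qed.

Lemma Int_fatou (h : nat -> R -> R) f A : (forall n, L1 (h n)) ->
  (forall n x, 0 <= h n x) -> (forall x, h n x @[n --> \oo] --> f x) ->
  (forall e, 0 < e -> \forall n \near \oo, \int[mu]_x h n x <= A + e) ->
  L1 f /\ \int[mu]_x f x <= A.
Proof.
move=> Lh h0 hf hA.
have mf : measurable_fun setT f.
  apply: (@measurable_fun_cvg _ _ R setT h) => [n|x _]; last exact: hf.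
  exact: L1_measurable.
have f0 x : 0 <= f x by apply: (cvgr_to_ge (hf x)); exact: nearW.
have bound e : 0 < e -> (\int[mu]_x (f x)%:E <= (A + e)%:E)%E.
  move=> e0; have [N _ hN] := hA e e0.
  have E : (\int[mu]_x (f x)%:E = \int[mu]_x limn_einf (fun n => (h (n + N)%N x)%:E))%E.
    apply: eq_integral => x _; apply/esym; apply: (cvg_limn_einf_sup _).1.
    have hs : h (n + N)%N x @[n --> \oo] --> f x.
      by rewrite (cvg_shiftn N (h^~ x)); exact: hf.
    by apply: cvg_EFin; [exact: nearW|exact: hs].
  rewrite E; apply: le_trans (fatou _ measurableT _ _) _.
  - by move=> n; apply/measurable_EFinP; exact: L1_measurable.
  - by move=> n x _; rewrite lee_fin.
  rewrite limn_einf_lim; apply: lime_le; first exact: is_cvg_einfs.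
  apply: nearW => n; apply: (@le_trans _ _ (\int[mu]_x (h (n + N)%N x)%:E)%E).
    by apply: ereal_inf_lbound; exists n => //=.
  by rewrite (Int_EFin measurableT (Lh _)) lee_fin; apply: hN; rewrite /= leq_addl.
have Lf : L1 f.
  apply/integrableP; split; first exact/measurable_EFinP.
  under eq_integral do rewrite /= ger0_norm//.
  exact: le_lt_trans (bound 1 ltr01) (ltry _).
split => //; apply/ler_addgt0Pr => e e0.
by have := bound e e0; rewrite (Int_EFin measurableT Lf) lee_fin.
Qed.

(** Cauchy-Schwarz against the indicator of the support. *)
Lemma Int_norm_supported a b f : a <= b -> L2 f -> supported a b f ->
  (\int[mu]_x `|f x|) ^+ 2 <= (b - a) * \int[mu]_x f x ^+ 2.
Proof.
move=> ab Lf fs.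
have L2n : L2 (fun x => `|f x|).
  split; first by apply: measurableT_comp => //; exact: Lf.1.
  by under eq_fun do rewrite real_normK ?num_real//; exact: Lf.2.
have e1 : \int[mu]_x (\1_`[a, b] x : R) = b - a.
  by rewrite -[RHS]mul1r -(Int_itv 1 ab); apply: eq_Rintegral => x _; rewrite mul1r.
have sq1 x : (\1_`[a, b] x : R) ^+ 2 = \1_`[a, b] x.
  by rewrite indicE; case: (_ \in _); rewrite ?expr1n ?expr0n.
have L2i : L2 (\1_`[a, b] : R -> R).
  split; first exact: measurable_indic.
  under eq_fun do rewrite sq1.
  by have := L1_itv 1 a b; under eq_fun do rewrite mul1r.
have := cauchy_schwarz L2i L2n.
under [X in _ <= X * _]eq_Rintegral do rewrite sq1.
under [X in _ <= _ * X]eq_Rintegral do rewrite real_normK ?num_real//.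
rewrite e1; congr (_ ^+ 2 <= _); apply: eq_Rintegral => x _.
rewrite indicE mem_setE in_itv/=; case: (boolP (a <= x <= b)) => hx; first by rewrite mul1r.
by rewrite fs// normr0 mulr0.
Qed.

Lemma geometric_series_le C n : 0 <= C -> \sum_(k < n) C / 2 ^+ k <= 2 * C.
Proof.
move=> C0; suff -> : \sum_(k < n) C / 2 ^+ k = 2 * C - 2 * C / 2 ^+ n.
  by rewrite gerBl divr_ge0 ?exprn_ge0// mulr_ge0.
elim: n => [|n IH]; first by rewrite big_ord0 expr0 divr1 subrr.
by rewrite big_ord_recr/= IH exprS; field; rewrite expf_neq0.
Qed.

(** The series of [|g (k + 1) - g k|] has a finite integral, so it converges
    almost everywhere and dominates the sequence by an integrable function.
    Dominated convergence then gives the primitives, and Fatou's lemma the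
    norm. *)
Lemma L2_fast_cauchy (g : nat -> R -> R) a b A C : a <= b -> 0 <= C ->
  (forall k, L2 (g k)) -> (forall k, supported a b (g k)) ->
  (forall k, \int[mu]_x (g k.+1 x - g k x) ^+ 2 <= C / 4 ^+ k) ->
  (forall e, 0 < e -> \forall k \near \oo, \int[mu]_x g k x ^+ 2 <= A + e) ->
  exists f, [/\ L2 f, supported a b f,
    forall t, prim (g k) t @[k --> \oo] --> prim f t & \int[mu]_x f x ^+ 2 <= A].
Proof.
move=> ab C0 Lg gs gC gA.
have L1g k : L1 (g k) := L2_supported_L1 (Lg k) (gs k).
pose d k x := `|g k.+1 x - g k x|.
have Ld k : L1 (d k) by apply: L1_norm; exact: L1B.
have d0 k x : 0 <= d k x by exact: normr_ge0.
pose D := Num.sqrt ((b - a) * C).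
have D0 : 0 <= D by exact: sqrtr_ge0.
have Id k : \int[mu]_x d k x <= D / 2 ^+ k.
  have Lgd := L2B (Lg k.+1) (Lg k).
  have sgd : supported a b (fun x => g k.+1 x - g k x).
    by move=> x hx; rewrite !(gs _ _ hx) subrr.
  have h := Int_norm_supported ab Lgd sgd.
  rewrite -(ler_pXn2r (n := 2))// ?nnegrE ?divr_ge0 ?exprn_ge0//; last exact: Int_ge0.
  apply: (le_trans h); rewrite expr_div_n -exprM mulnC exprM sqr_sqrtr; last first.
    by rewrite mulr_ge0// subr_ge0.
  rewrite -natrX -mulrA ler_wpM2l ?subr_ge0//.
pose S n x := \sum_(k < n) d k x.
have SS n x : S n.+1 x = S n x + d n x by rewrite /S big_ord_recr.
have LS n : L1 (S n).
  elim: n => [|n IH].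
    by rewrite (_ : S 0%N = fun=> 0); [exact: L1_0|apply/funext => x; rewrite /S big_ord0].
  by rewrite (_ : S n.+1 = fun x => S n x + d n x); [exact: L1D|apply/funext => x; exact: SS].
have IS n : \int[mu]_x S n x <= 2 * D.
  apply: le_trans (geometric_series_le n D0).
  elim: n => [|n IH].
    by rewrite big_ord0 -[leRHS](@Int0 R); apply: Int_le; [exact: LS|exact: L1_0|move=> x; rewrite /S big_ord0].
  rewrite big_ord_recr/=; apply: le_trans (lerD IH (Id n)).
  rewrite -RintegralD//; last exact: Ld; last exact: LS.
  by apply: Int_le; [exact: LS|apply: L1D; [exact: LS|exact: Ld]|move=> x; rewrite SS].
have S0 n x : 0 <= S n x by rewrite /S sumr_ge0.
have Snd x : nondecreasing_seq (S^~ x).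
  by apply/nondecreasing_seqP => n; rewrite SS lerDl.
have [H LH aeH] := beppo_levi LS S0 Snd IS.
pose N x := `[< forall n, S n x <= H x >].
have aeN : {ae mu, forall x, N x} by apply: aeS aeH => x h; apply/asboolP.
have mN : measurable_fun setT N.
  apply: (measurable_fun_bool true); rewrite setTI.
  rewrite (_ : _ @^-1` _ = \bigcap_n [set x | S n x <= H x]).
    apply: bigcapT_measurable => n.
    have := measurable_fun_ler (L1_measurable (LS n)) (L1_measurable LH).
    by move=> /(_ measurableT [set true] I); rewrite setTI.
  apply/seteqP; split => x /=; first by move=> /asboolP h n _; exact: h.
  by move=> h; apply/asboolP => n; exact: h.
(* changed on a negligible set, the sequence converges and is dominated
   everywhere *)
pose g' k x := if N x then g k x else 0.
have mg' k : measurable_fun setT (g' k).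
  by apply: measurable_if_real => //; exact: L1_measurable.
have g'E k : {ae mu, forall x, g' k x = g k x} by apply: aeS aeN => x Nx; rewrite /g' Nx.
have gS k x : g k x = g 0%N x + \sum_(j < k) (g j.+1 x - g j x).
  elim: k => [|k IH]; first by rewrite big_ord0 addr0.
  by rewrite big_ord_recr/= addrA -IH addrC subrK.
have g'le k x : `|g' k x| <= `|g 0%N x| + `|H x|.
  rewrite /g'; case: ifPn => [/asboolP Nx|_]; last by rewrite normr0 addr_ge0.
  rewrite gS; apply: (le_trans (ler_normD _ _)); rewrite lerD2l.
  apply: (le_trans (ler_norm_sum _ _ _)); apply: le_trans (ler_norm _).
  exact: Nx k.
have LB : L1 (fun x => `|g 0%N x| + `|H x|) by apply: L1D; exact: L1_norm.
have cg' x : cvgn (g'^~ x).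
  have [Nx|Nx] := boolP (N x); last first.
    rewrite (_ : g'^~ x = fun=> 0); first exact: is_cvg_cst.
    by apply/funext => k; rewrite /g' (negbTE Nx).
  rewrite (_ : g'^~ x = g^~ x); last by apply/funext => k; rewrite /g' Nx.
  move/asboolP in Nx; pose u j := g j.+1 x - g j x.
  have cu : cvgn (series u).
    apply: normed_cvg.
    have -> : [normed series u] = S^~ x by apply/funext => n; exact: big_mkord.
    by apply: nondecreasing_is_cvgn => //; exists (H x) => _ [n _ <-]; exact: Nx n.
  have -> : g^~ x = (fun n => g 0%N x + series u n).
    by apply/funext => n; rewrite gS seriesEord.
  by apply: is_cvgD => //; exact: is_cvg_cst.
pose f x := limn (g'^~ x).
have g'f x : g' k x @[k --> \oo] --> f x by exact: cg'.
have [Lf _] := Int_cvg mg' g'f LB g'le.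
exists f.
have L1g'2 k : L1 (fun x => g' k x ^+ 2).
  apply: (@L1_ae_eq _ (fun x => g k x ^+ 2)).
  - exact: measurable_funX.
  - by apply: aeS (g'E k) => x ->.
  - exact: (Lg k).2.
have [Lf2 If2] : L1 (fun x => f x ^+ 2) /\ \int[mu]_x f x ^+ 2 <= A.
  apply: (Int_fatou L1g'2).
  - by move=> k x; exact: sqr_ge0.
  - by move=> x; apply: (cvg_comp _ (fun y : R => y ^+ 2) (g'f x)); exact: exprn_continuous.
  - move=> e e0; apply: filterS (gA e e0) => k; apply: le_trans.
    rewrite le_eqVlt; apply/orP; left; apply/eqP; apply: Int_ae_eq.
    + exact: measurable_funX.
    + by apply: measurable_funX; exact: L1_measurable.
    + by apply: aeS (g'E k) => x ->.
split => //.
- by split => //; exact: L1_measurable.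
- move=> x hx; apply/cvg_lim => //.
  rewrite (_ : (fun k => g' k x) = fun=> 0); first exact: cvg_cst.
  by apply/funext => k; rewrite /g' gs// if_same.
move=> t.
have pE k : prim (g k) t = \int[mu]_x (if x \in `]-oo, t] then g' k x else 0).
  rewrite /prim IntE; apply: Int_ae_eq.
  - by apply: measurable_if_real => //; [exact: measurable_mem_itv|exact: L1_measurable].
  - by apply: measurable_if_real => //; exact: measurable_mem_itv.
  - by apply: aeS (g'E k) => x ->.
under eq_fun do rewrite pE; rewrite /prim IntE.
apply: (Int_cvg _ _ LB _).2.
- by move=> k; apply: measurable_if_real => //; exact: measurable_mem_itv.
- by move=> x; case: ifP => _; [exact: g'f|exact: cvg_cst].
- by move=> k x; case: ifP => _; [exact: g'le|rewrite normr0 addr_ge0].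
Qed.

Lemma half_pow_near e : 0 < e -> \forall k \near \oo, 1 / 2 ^+ k <= e :> R.
Proof.
move=> e0; have h : `|1 / 2 : R| < 1 by rewrite ger0_norm//; lra.
have /cvgrPdist_le/(_ e e0) := cvg_expr h.
apply: filterS => k; rewrite sub0r normrN expr_div_n expr1n.
exact: le_trans (ler_norm _).
Qed.

Lemma primD f g k t : L1 f -> L1 g -> prim (fun x => f x + k * g x) t = prim f t + k * prim g t.
Proof.
move=> Lf Lg; have If := L1_itv_integrable `]-oo, t] Lf; have Ig := L1_itv_integrable `]-oo, t] Lg.
rewrite /prim RintegralD//; last by apply: integrable_realZ.
by rewrite RintegralZl.
Qed.

(** Weak compactness of balls of L^2, by a projection argument. Let [s] be
    the limit, as [e] tends to 0, of the infimum of [\int g^2] over the [g]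
    with [|prim g - G| <= e]. Near-minimizers for tolerances [e] decreasing
    to 0 form a Cauchy sequence: the midpoint of two of them is again a
    competitor, so the parallelogram identity bounds their distance. The
    primitive of the limit is [G], and its squared norm is at most [s],
    hence at most [A]. *)
Lemma weak_limit (F : set_system nat) (FF : ProperFilter F) (f : nat -> R -> R) (G : R -> R) a b A :
  a <= b -> (forall n, L2 (f n)) -> (forall n, supported a b (f n)) ->
  (forall e, 0 < e -> \forall n \near F, forall t, `|prim (f n) t - G t| <= e) ->
  (forall e, 0 < e -> \forall n \near F, \int[mu]_x f n x ^+ 2 <= A + e) ->
  exists g, [/\ L2 g, supported a b g, forall t, prim g t = G t & \int[mu]_x g x ^+ 2 <= A].
Proof.
move=> ab Lf fs fG fA.
pose S e g := [/\ L2 g, supported a b g & forall t, `|prim g t - G t| <= e].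
have Sle e e' g : e <= e' -> S e g -> S e' g.
  by move=> ee' [h1 h2 h3]; split => // t; exact: le_trans ee'.
(* the bounds from below that hold for some tolerance e; their supremum s is
   the limit of the infima *)
pose B := [set c : R | exists2 e, 0 < e & forall g, S e g -> c <= \int[mu]_x g x ^+ 2].
have B0 : B 0 by exists 1 => // g _; apply: Int_ge0 => x; exact: sqr_ge0.
have BA : ubound B A.
  move=> c [e e0 hc]; apply/ler_addgt0Pr => e' e'0.
  have [n [h1 h2]] := filter_ex (filterI (fG e e0) (fA e' e'0)).
  by apply: le_trans h2; apply: hc; split.
have supB : has_sup B by split; [exists 0|exists A].
pose s := sup B.
have sA : s <= A by apply: ge_sup => //; exists 0.
have p40 k : 0 < 1 / 4 ^+ k :> R by rewrite divr_gt0// exprn_gt0.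
have p20 k : 0 < 1 / 2 ^+ k :> R by rewrite divr_gt0// exprn_gt0.
have P k : exists eg : R * (R -> R), [/\ eg.1 <= 1 / 2 ^+ k,
    forall g, S eg.1 g -> s - 1 / 4 ^+ k <= \int[mu]_x g x ^+ 2,
    S eg.1 eg.2 & \int[mu]_x eg.2 x ^+ 2 <= s + 1 / 4 ^+ k].
  have [c [e e0 hc] sc] := sup_adherent (p40 k) supB.
  pose e' := Num.min e (1 / 2 ^+ k).
  have e'0 : 0 < e' by rewrite lt_min e0 p20.
  have [g [Sg gs]] : exists g, S e' g /\ \int[mu]_x g x ^+ 2 <= s + 1 / 4 ^+ k.
    apply: contrapT => /forallNP h.
    have : B (s + 1 / 4 ^+ k).
      exists e' => // g Sg; rewrite leNgt; apply/negP => /ltW h'.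
      by apply: (h g).
    by move=> /(sup_upper_bound supB); rewrite -/s gerDl leNgt p40.
  exists (e', g); split => //=; first by rewrite ge_min lexx orbT.
  move=> g1 Sg1; apply: (le_trans (ltW sc)); apply: hc; apply: Sle Sg1.
  by rewrite ge_min lexx.
have {P}[eg egP] := choice P.
pose g k := (eg k).2.
have Lg k : L2 (g k) by have [_ _ []] := egP k.
have gsup k : supported a b (g k) by have [_ _ []] := egP k.
have L1g k : L1 (g k) := L2_supported_L1 (Lg k) (gsup k).
have gA k : \int[mu]_x g k x ^+ 2 <= s + 1 / 4 ^+ k by have [] := egP k.
have gC k : \int[mu]_x (g k.+1 x - g k x) ^+ 2 <= 8 / 4 ^+ k.
  have p4S : 1 / 4 ^+ k.+1 <= 1 / 4 ^+ k :> R.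
    rewrite ler_pM2l// lef_pV2 ?posrE ?exprn_gt0// exprS.
    by rewrite ler_peMl ?exprn_ge0// ler1n.
  pose md x := 1 / 2 * (g k.+1 x + 1 * g k x).
  have Smid e : S e (g k) -> S e (g k.+1) -> S e md.
    move=> [_ _ h1] [_ _ h2]; split.
    - by apply: L2Z; under eq_fun do rewrite mul1r; exact: L2D.
    - by move=> x hx; rewrite /md !gsup// mulr0 addr0 mulr0.
    - move=> t; have -> : prim md t = 1 / 2 * (prim (g k.+1) t + prim (g k) t).
        rewrite /prim RintegralZl//; last first.
          by apply: L1_itv_integrable; apply: L1D => //; exact: L1Z.
        by have := primD 1 t (L1g k.+1) (L1g k); rewrite /prim mul1r => ->.
      rewrite (_ : _ - _ = 1 / 2 * ((prim (g k.+1) t - G t) + (prim (g k) t - G t))); last by field.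
      rewrite normrM ger0_norm//; have := ler_normD (prim (g k.+1) t - G t) (prim (g k) t - G t).
      by have := h1 t; have := h2 t; lra.
  (* the midpoint competes for the larger of the two tolerances *)
  have mid : s - 1 / 4 ^+ k <= \int[mu]_x md x ^+ 2.
    have [_ hk Sk _] := egP k; have [_ hk1 Sk1 _] := egP k.+1.
    have [h|/ltW h] := leP (eg k).1 (eg k.+1).1.
      by apply: le_trans (hk1 _ (Smid _ (Sle _ _ _ h Sk) Sk1)); rewrite lerD2l lerN2.
    exact: hk (Smid _ Sk (Sle _ _ _ h Sk1)).
  have E1 : \int[mu]_x md x ^+ 2 = (1 / 4) * \int[mu]_x (g k.+1 x + 1 * g k x) ^+ 2.
    rewrite -RintegralZl//.
      by apply: eq_Rintegral => x _; rewrite /md; field.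
    have : L2 (fun x => g k.+1 x + 1 * g k x) by apply: L2D => //; exact: L2Z.
    by case.
  have E2 : \int[mu]_x (g k.+1 x - g k x) ^+ 2 = \int[mu]_x (g k.+1 x + (-1) * g k x) ^+ 2.
    by apply: eq_Rintegral => x _; rewrite mulN1r.
  move: mid; rewrite E1 E2 !Int_sqrD//; have := gA k; have := gA k.+1.
  set p := 1 / 4 ^+ k in p4S *; rewrite (_ : 8 / 4 ^+ k = 8 * p); last by rewrite /p div1r.
  by move: p4S; lra.
have s4 e : 0 < e -> \forall k \near \oo, \int[mu]_x g k x ^+ 2 <= s + e.
  move=> e0; apply: filterS (half_pow_near e0) => k h; apply: (le_trans (gA k)); rewrite lerD2l.
  apply: le_trans h; rewrite ler_pM2l// lef_pV2 ?posrE ?exprn_gt0//.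
  by apply: lerXn2r; rewrite ?nnegrE// ler_nat.
have [h [Lh sh ph hA]] := L2_fast_cauchy ab (ler0n _ 8) Lg gsup gC s4.
exists h; split => //; last exact: le_trans sA.
move=> t; apply: (cvg_unique (@Rhausdorff R) (ph t)).
apply/cvgrPdist_le => e e0; apply: filterS (half_pow_near e0) => k hk.
by rewrite distrC; have [h1 _ [_ _ h2] _] := egP k; apply: (le_trans (h2 t)); exact: le_trans hk.
Qed.

Lemma prim_derive f : L1 f ->
  {ae mu, forall x, derivable (prim f) x 1 /\ ((prim f)^`())%classic x = f x}.
Proof.
move=> Lf; apply: FTC1Ny; last exact: open_integrable_locally openT Lf.
by move=> y; exact: L1_itv_integrable.
Qed.

(** Lebesgue differentiation recovers a function from its primitive. *)
Lemma prim_inj f g : L1 f -> L1 g -> (forall t, prim f t = prim g t) ->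
  {ae mu, forall x, f x = g x}.
Proof.
move=> Lf Lg fg; have E : prim f = prim g by apply/funext.
apply: aeS (ae_and (prim_derive Lf) (prim_derive Lg)) => x [[_ <-] [_ <-]].
by rewrite E.
Qed.

Lemma prim_ndecr_ge0 f : L1 f -> {homo prim f : s t / s <= t} ->
  {ae mu, forall x, 0 <= f x}.
Proof.
move=> Lf fnd; apply: aeS (prim_derive Lf) => x [dx <-].
rewrite derive1E; apply: (cvgr_to_ge dx); near=> h.
have h0 : h != 0 by near: h; exact: nbhs_dnbhs_neq.
rewrite /GRing.scale/= mulr1; have [hp|hn] := ltP 0 h.
  by rewrite mulr_ge0 ?invr_ge0 ?(ltW hp)// subr_ge0 fnd// lerDr ltW.
rewrite -mulrNN mulr_ge0// ?oppr_ge0 ?invr_le0// subr_le0 fnd//.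
by rewrite gerDr.
Unshelve. all: by end_near. Qed.

End WeakLimit.

(** * Uniform limits along an ultrafilter *)

Section UltraLimit.
Context {R : realType}.
Variables (U : set_system nat) (UU : UltraFilter U).

Let UF : ProperFilter U. Proof. exact: ultra_proper. Qed.

(** Compactness of segments provides a cluster point, and an ultrafilter
    converges to its cluster points. *)
Lemma ultra_bounded_cvg (x : nat -> R) B : (forall n, `|x n| <= B) ->
  exists l : R, x n @[n --> U] --> l.
Proof.
move=> xB; have cK := @segment_compact R (- B) B.
have FK : (x @ U) `[- B, B]%classic.
  by apply: nearW => n /=; rewrite in_itv/= -ler_norml.
have [l [_ cl]] := cK (x @ U) _ FK.
exists l => V nV; have [//|h] := in_ultra_setVsetC (x @^-1` V) UU.
have [y [h1 h2]] := cl (~` V) V h nV.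
by exfalso; apply: h1.
Qed.

(** The Ascoli theorem, with convergence along an ultrafilter instead of a
    subsequence: the limit exists at each point, and a finite grid of mesh
    [d] reduces uniform convergence to convergence at finitely many points. *)
Lemma ultra_equicontinuous_cvg (P : nat -> R -> R) (om : R -> R) a b :
  a <= b -> (forall n s t, `|P n t - P n s| <= om `|t - s|) ->
  (forall n t, t <= a -> P n t = 0) -> (forall n t, b <= t -> P n t = P n b) ->
  (forall e, 0 < e -> exists2 d, 0 < d & forall r, 0 <= r <= d -> om r <= e) ->
  exists G, (forall t, P^~ t @ U --> G t) /\
    forall e, 0 < e -> \forall n \near U, forall t, `|P n t - G t| <= e.
Proof.
move=> ab Pom Pa Pb om0.
have lim t : exists l : R, P n t @[n --> U] --> l.
  apply: (@ultra_bounded_cvg (P^~ t) (om `|t - a|)) => n.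
  by have := Pom n a t; rewrite (Pa n a (lexx _)) subr0.
have [G GP] := choice lim; exists G; split => // e e0.
have e3 : 0 < e / 3 by rewrite divr_gt0.
have [d d0 hd] := om0 _ e3.
have Gom s t : `|G t - G s| <= om `|t - s|.
  have c : `|P n t - P n s| @[n --> U] --> `|G t - G s|.
    by apply: cvg_norm; apply: cvgB; exact: GP.
  by apply: (cvgr_to_le c); apply: nearW => n; exact: Pom.
(* outside [a, b] the functions are constant *)
have Gcl t : G t = G (Num.min (Num.max t a) b).
  have E : P^~ t = P^~ (Num.min (Num.max t a) b).
    apply/funext => n; have [ta|/ltW ta] := leP t a; first by rewrite min_l// !Pa.
    by have [//|/ltW tb] := leP t b; rewrite Pb.
  have := GP t; rewrite E => h; apply: (cvg_unique (@Rhausdorff R) h); exact: GP.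
have Pcl n t : P n t = P n (Num.min (Num.max t a) b).
  have [ta|/ltW ta] := leP t a; first by rewrite min_l// !Pa.
  by have [//|/ltW tb] := leP t b; rewrite Pb.
pose N := (Num.truncn ((b - a) / d)).+1.
pose p (i : 'I_N) := a + i%:R * d.
have near_p : \forall n \near U, forall i : 'I_N, `|P n (p i) - G (p i)| <= e / 3.
  apply: filter_forall => i; have /cvgrPdist_le/(_ _ e3) := GP (p i).
  by apply: filterS => n; rewrite distrC.
apply: filterS near_p => n np t; rewrite Pcl Gcl; set c := Num.min _ _.
have ac : a <= c by rewrite /c le_min ab le_max lexx orbT.
have cb : c <= b by rewrite /c ge_min lexx orbT.
have x0 : 0 <= (c - a) / d by rewrite divr_ge0 ?subr_ge0// ltW.
have /andP[i1 i2] := truncn_itv x0.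
have iN : (Num.truncn ((c - a) / d) < N)%N.
  rewrite ltnS; apply: le_truncn; rewrite ler_pM2r ?invr_gt0//.
  by rewrite lerD2r.
have cp : 0 <= `|c - p (Ordinal iN)| <= d.
  rewrite normr_ge0 /p /=; move: i1 i2; set i := Num.truncn _.
  rewrite ler_pdivlMr// ltr_pdivrMr// -natr1 mulrDl mul1r => i1 i2.
  by rewrite ger0_norm; lra.
have h1 := le_trans (Pom n (p (Ordinal iN)) c) (hd _ cp).
have h2 := le_trans (Gom (p (Ordinal iN)) c) (hd _ cp).
have h3 := np (Ordinal iN).
move: h1 h2 h3; set y1 := P n c; set y2 := P n (p _); set y3 := G c; set y4 := G (p _).
rewrite !ler_norml => /andP[? ?] /andP[? ?] /andP[? ?]; apply/andP; split; lra.
Qed.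

End UltraLimit.

Lemma sqrt_modulus (R : realType) (E e : R) : 0 <= E -> 0 < e ->
  exists2 d, 0 < d & forall r, 0 <= r <= d -> Num.sqrt (E * r) <= e.
Proof.
move=> E0 e0; have E1 : 0 < E + 1 by rewrite ltr_wpDl.
exists (e ^+ 2 / (E + 1)); first by rewrite divr_gt0// exprn_gt0.
move=> r /andP[r0 rd]; rewrite -(ler_pXn2r (n := 2))// ?nnegrE ?(ltW e0)//.
rewrite sqr_sqrtr ?mulr_ge0//; move: rd; rewrite ler_pdivlMr//.
by apply: le_trans; rewrite mulrC ler_wpM2l// lerDl.
Qed.

(** * The optimal in-flux *)

Section Optimal.
Context {R : realType}.
Local Notation mu := (@lebesgue_measure R).
Implicit Types (t s r x e : R) (u : R -> R).
Variables (lam : R -> R) (T : R) (rho0 yd : R -> R).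
Hypotheses (lC1 : C1_on setT lam) (lp : forall w, 0 < lam w) (T0 : 0 < T).
Hypotheses (rL : in_Lp 2%:E `[0, 1] rho0) (r0 : ae_nonneg `[0, 1] rho0).
Hypothesis (ydL : in_Lp 2%:E `[0, T] yd).

Let ub u := u \_ `[0, T].
Let zb u := (fun t => outflux lam T rho0 u t - yd t) \_ `[0, T].

Let T0' : 0 <= T := ltW T0.

Lemma supported_patch f : supported 0 T f -> f \_ `[0, T] = f.
Proof.
move=> fs; apply/funext => x; rewrite patchE mem_setE in_itv/=.
by case: ifPn => // /fs ->.
Qed.

Let ubL u : L2plus T u -> L2 (ub u).
Proof. by move=> [h _]; apply/in_L2P. Qed.

Let zbL u : L2plus T u -> L2 (zb u).
Proof.
move=> uP; have yL := outflux_L2 lC1 lp T0 rL r0 uP.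
have dL := (in_L2P yd (measurable_itv `[0, T])).1 ydL.
have := L2B yL dL; rewrite (_ : (fun x => _ - _) = zb u)//.
by apply/funext => t; rewrite /zb !patchE; case: ifP => //; rewrite subrr.
Qed.

Lemma Int_patch_sqr f : L2 (f \_ `[0, T]) ->
  (\int[mu]_(t in `[0%R, T]) (`|f t| ^+ 2)%:E = (\int[mu]_t (f \_ `[0, T]) t ^+ 2)%:E)%E.
Proof.
move=> [_ Lf]; rewrite -(Int_EFin measurableT Lf) integral_mkcond; apply: eq_integral => t _.
by rewrite !patchE; case: ifP => _; rewrite ?expr0n// real_normK ?num_real.
Qed.

(** The functional as a real number, with the functions extended by 0 to the
    whole line. *)
Definition cost u := \int[mu]_t (u \_ `[0, T]) t ^+ 2 +
  \int[mu]_t ((fun t => outflux lam T rho0 u t - yd t) \_ `[0, T]) t ^+ 2.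

Lemma J_cost u : L2plus T u -> J lam T rho0 yd u = (cost u)%:E.
Proof.
move=> uP; rewrite /J (Int_patch_sqr (ubL uP)).
by rewrite (@Int_patch_sqr (fun t => outflux lam T rho0 u t - yd t) (zbL uP)).
Qed.

Lemma prim_patch f t : 0 <= t <= T -> prim (f \_ `[0, T]) t = \int[mu]_(s in `[0, t]) f s.
Proof.
move=> /andP[t0 tT]; rewrite /prim !IntE; apply: eq_Rintegral => s _.
rewrite patchE mem_setE !in_itv/=.
case: (leP s t) => st; last by rewrite andbF.
by rewrite (le_trans st tT) !andbT.
Qed.

Lemma prim_supported_le f t : measurable_fun setT f -> supported 0 T f -> t <= 0 -> prim f t = 0.
Proof.
move=> mf fs t0; rewrite /prim IntE -[RHS](@Int0 R); apply: Int_ae_eq => //.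
  by apply: measurable_if_real => //; exact: measurable_mem_itv.
apply: aeS (ae_neq 0) => s s0; rewrite in_itv/=; case: ifP => // st.
by rewrite fs// negb_and -ltNge lt_neqAle s0 (le_trans st).
Qed.

Lemma prim_supported_ge f t : supported 0 T f -> T <= t -> prim f t = prim f T.
Proof.
move=> fs tT; rewrite /prim !IntE; apply: eq_Rintegral => s _; rewrite !in_itv/=.
case: (leP s T) => sT; first by rewrite (le_trans sT).
by case: ifP => // _; rewrite fs// negb_and -!ltNge sT orbT.
Qed.

(** The contribution of the initial density cancels. *)
Lemma vin_sub_ae u1 u2 : L2plus T u1 -> L2plus T u2 ->
  {ae mu, forall r, vin T rho0 u1 r + (-1) * vin T rho0 u2 r = ub u1 r + (-1) * ub u2 r}.
Proof.
move=> [_ u10] [_ u20]; apply: aeS (ae_and (ae_neq 0) (ae_and u10 u20)) => r [rn0 [h1 h2]].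
rewrite /vin /ub !patchE mem_setE in_itv/=.
case: (boolP (0 < r <= T)) => [/andP[p1 p2]|rT].
  have rT : 0 <= r <= T by rewrite (ltW p1).
  by rewrite rT !max_l//; [apply: h2|apply: h1]; rewrite /= in_itv.
rewrite mulN1r subrr; case: ifPn => [/andP[p1 p2]|]; last by rewrite mulr0 addr0.
by move: rT; rewrite p2 andbT lt_neqAle p1 eq_sym rn0.
Qed.

Let vinL1 u : L2plus T u -> L1 (vin T rho0 u).
Proof. by move=> [uL _]; exact: influx_L1 (vin_influx T0 uL rL (lexx _)). Qed.

Let ubL1 u : L2plus T u -> L1 (ub u).
Proof. by move=> uP; apply: (L2_supported_L1 (ubL uP)); exact: patch_supported. Qed.

Let zbL1 u : L2plus T u -> L1 (zb u).
Proof. by move=> uP; apply: (L2_supported_L1 (zbL uP)); exact: patch_supported. Qed.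

Lemma prim_vinB u1 u2 t : L2plus T u1 -> L2plus T u2 ->
  prim (vin T rho0 u1) t - prim (vin T rho0 u2) t = prim (ub u1) t - prim (ub u2) t.
Proof.
move=> p1 p2; have L1v := vinL1 p1; have L2v := vinL1 p2.
have L1u := ubL1 p1; have L2u := ubL1 p2.
rewrite -!(mulN1r (prim _ _)) -!primD// /prim !IntE; apply: Int_ae_eq.
- apply: measurable_if_real => //; first exact: measurable_mem_itv.
  by apply: L1_measurable; apply: L1D => //; exact: L1Z.
- apply: measurable_if_real => //; first exact: measurable_mem_itv.
  by apply: L1_measurable; apply: L1D => //; exact: L1Z.
- by apply: aeS (vin_sub_ae p1 p2) => r ->.
Qed.

Lemma prim_ub_ndecr u : L2plus T u -> {homo prim (ub u) : s t / s <= t}.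
Proof.
move=> uP s t st; have [_ u0] := uP.
have E x : prim (ub u) x = prim (fun r => Num.max (ub u r) 0) x.
  rewrite /prim !IntE; apply: Int_ae_eq.
  - by apply: measurable_if_real => //; [exact: measurable_mem_itv|exact: (ubL uP).1].
  - apply: measurable_if_real => //; first exact: measurable_mem_itv.
    by apply: measurable_maxr => //; exact: (ubL uP).1.
  - apply: aeS u0 => r h; case: ifP => // _; rewrite max_l// /ub patchE mem_setE.
    by case: ifP => // hr; exact: h.
rewrite !E; apply: prim_le => //.
  apply: L1_dominated (L1_norm (ubL1 uP)) _.
    by apply: measurable_maxr => //; exact: (ubL uP).1.
  by move=> x; rewrite ger0_norm ?le_max ?lexx ?orbT// ge_max normr_ge0 ler_norm.
by move=> r; rewrite le_max lexx orbT.
Qed.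

Lemma prim_zb u xi t : L2plus T u -> 0 < t <= T ->
  (forall tau, 0 < tau <= T -> \int[mu]_(t in `[0, tau]) outflux lam T rho0 u t =
      prim (vin T rho0 u) tau - mass (vin T rho0 u) xi tau) ->
  prim (zb u) t = prim (vin T rho0 u) t - mass (vin T rho0 u) xi t - prim (yd \_ `[0, T]) t.
Proof.
move=> uP tT flux; have /andP[t0 tT'] := tT.
have t0T : 0 <= t <= T by rewrite (ltW t0).
have yL := outflux_L2 lC1 lp T0 rL r0 uP.
have dL := (in_L2P yd (measurable_itv `[0, T])).1 ydL.
have yL1 := L2_supported_L1 yL (@patch_supported _ _ _ _).
have dL1 := L2_supported_L1 dL (@patch_supported _ _ _ _).
rewrite -flux// -prim_patch// -[in RHS]mulN1r -primD// /prim; apply: eq_Rintegral => s _.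
rewrite /zb !patchE; case: ifP => _; first by rewrite mulN1r.
by rewrite mulr0 addr0.
Qed.

Lemma prim_modulus f E s t : L2 f -> L1 f -> \int[mu]_x f x ^+ 2 <= E ->
  `|prim f t - prim f s| <= Num.sqrt (E * `|t - s|).
Proof.
move=> Lf L1f fE; have E0 : 0 <= E.
  by apply: le_trans fE; apply: Int_ge0 => x; exact: sqr_ge0.
apply: (bounded_primC Lf L1f fE); first exact: sqrtr_ge0.
by rewrite sqr_sqrtr// mulr_ge0.
Qed.

Lemma cost_ge0 u : 0 <= cost u.
Proof. by rewrite addr_ge0//; apply: Int_ge0 => x; exact: sqr_ge0. Qed.

Lemma L2plus0 : L2plus T (fun=> 0).
Proof.
have z : (fun=> 0) \_ `[0, T] = (fun=> 0) :> (R -> R).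
  by apply/funext => x; rewrite patchE if_same.
split; last by exists set0; split => // x /=; case.
apply/in_L2P => //; rewrite z; split; first exact: measurable_cst.
by rewrite (_ : (fun=> _) = (fun=> 0)); [exact: L1_0|apply/funext => x; rewrite expr0n].
Qed.

(** The direct method. Along an ultrafilter, the primitives of a minimizing
    sequence converge uniformly, and [weak_limit] provides a limit in-flux
    [uoo]. By [characteristic_mass_stable] the primitives of the out-fluxes
    converge uniformly as well, to that of the out-flux of [uoo]. A second
    use of [weak_limit] then bounds the norm of the limit, which [prim_inj]
    identifies with the deviation of the out-flux of [uoo] from [yd]. *)
Lemma optimum_exists : exists2 uoo, L2plus T uoo &
  forall u, L2plus T u -> cost uoo <= cost u.
Proof.
pose S := [set cost u | u in L2plus T].
have infS : has_inf S.
  split; first by exists (cost (fun=> 0)), (fun=> 0) => //; exact: L2plus0.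
  by exists 0 => _ [u _ <-]; exact: cost_ge0.
pose d := inf S.
have dle u : L2plus T u -> d <= cost u.
  by move=> uP; apply: (ge_inf infS.2); exists u.
have n0 (n : nat) : 0 < n.+1%:R^-1 :> R by rewrite invr_gt0.
have near_opt (n : nat) : exists u, L2plus T u /\ cost u <= d + n.+1%:R^-1.
  have [_ [u uP <-] h] := inf_adherent (n0 n) infS.
  by exists u; split => //; exact: ltW.
have [u_ u_P] := choice near_opt.
have uP n : L2plus T (u_ n) by case: (u_P n).
have uc n : cost (u_ n) <= d + 1.
  case: (u_P n) => _ h; apply: (le_trans h); rewrite lerD2l.
  by rewrite invf_le1// ler1n.
pose Iu n := \int[mu]_t ub (u_ n) t ^+ 2; pose Iz n := \int[mu]_t zb (u_ n) t ^+ 2.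
have Iu0 n : 0 <= Iu n by apply: Int_ge0 => x; exact: sqr_ge0.
have Iz0 n : 0 <= Iz n by apply: Int_ge0 => x; exact: sqr_ge0.
have cE n : cost (u_ n) = Iu n + Iz n by [].
have Iu1 n : Iu n <= d + 1 by apply: le_trans (uc n); rewrite cE lerDl.
have Iz1 n : Iz n <= d + 1 by apply: le_trans (uc n); rewrite cE lerDr.
(* one bound E, hence one clipping level K, for the whole sequence and its
   limit *)
pose r2 := \int[mu]_(x in `[0, 1]) rho0 x ^+ 2.
have r20 : 0 <= r2 by apply: Rintegral_ge0 => x _; exact: sqr_ge0.
pose E := d + 1 + r2.
have E0 : 0 <= E by rewrite addr_ge0// (le_trans (Iu0 0%N)).
have iv v : L2plus T v -> \int[mu]_t (v \_ `[0, T]) t ^+ 2 <= d + 1 -> influx T E (vin T rho0 v).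
  by move=> [vL _] vE; apply: vin_influx => //; rewrite Int_sqr_patch lerD2r.
pose K := Num.sqrt (E * (T + 2)).
have K0 : 0 <= K by exact: sqrtr_ge0.
have EK : E * (T + 2) <= K ^+ 2 by rewrite sqr_sqrtr// mulr_ge0// addr_ge0.
have [m [M [L [[m0 m1 M1 L0] mM Llip]]]] := clipped_speed lC1 lp K0.
have [k k0 kE] := rate_exists m0 M1 L0 E0.
have [U [UU oU]] := @ultraFilterLemma nat \oo _.
have UF : ProperFilter U by exact: ultra_proper.
have Iuc : exists l : R, Iu n @[n --> U] --> l.
  by apply: (@ultra_bounded_cvg _ U UU Iu (d + 1)) => n; rewrite ger0_norm.
have Izc : exists l : R, Iz n @[n --> U] --> l.
  by apply: (@ultra_bounded_cvg _ U UU Iz (d + 1)) => n; rewrite ger0_norm.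
have [Au IuAu] := Iuc; have [Az IzAz] := Izc.
have AuE : Au <= d + 1 by apply: (cvgr_to_le IuAu); exact: nearW.
have AA : Au + Az <= d.
  apply/ler_addgt0Pr => e e0.
  have c : Iu n + Iz n @[n --> U] --> Au + Az by apply: cvgD.
  apply: (cvgr_to_le c); apply: oU; near=> n.
  have [_ h] := u_P n; apply: (le_trans h); rewrite lerD2l.
  rewrite -[e]invrK lef_pV2 ?posrE ?invr_gt0//.
  apply: (@le_trans _ _ n%:R); last by rewrite ler_nat.
  by near: n; exact: nbhs_infty_ger.
have nearA (I : nat -> R) A : I n @[n --> U] --> A ->
    forall e, 0 < e -> \forall n \near U, I n <= A + e.
  move=> /cvgrPdist_le IA e e0; apply: filterS (IA e e0) => n.
  by rewrite ler_norml => /andP[h _]; lra.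
have om0 e : 0 < e -> exists2 d', 0 < d' & forall r, 0 <= r <= d' -> Num.sqrt ((d + 1) * r) <= e.
  by apply: sqrt_modulus; exact: le_trans (Iu0 0%N) (Iu1 0%N).
have [G [GP Gunif]] := @ultra_equicontinuous_cvg _ U UU (fun n => prim (ub (u_ n)))
  (fun r => Num.sqrt ((d + 1) * r)) 0 T T0'
  (fun n s t => prim_modulus s t (ubL (uP n)) (ubL1 (uP n)) (Iu1 n))
  (fun n t => prim_supported_le (ubL (uP n)).1 (@patch_supported _ _ _ _))
  (fun n t => prim_supported_ge (@patch_supported _ _ _ _)) om0.
(* the limit in-flux; it is nonnegative because its primitive is
   nondecreasing *)
have [uoo [Loo soo poo Aoo]] := @weak_limit _ U UF (fun n => ub (u_ n)) G 0 T Au T0'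
  (fun n => ubL (uP n)) (fun n => @patch_supported _ _ _ _) Gunif (nearA _ _ IuAu).
have ubE : ub uoo = uoo := supported_patch soo.
have ooP : L2plus T uoo.
  split; first by apply/in_L2P => //; rewrite -/(ub uoo) ubE.
  have L1oo : L1 uoo := L2_supported_L1 Loo soo.
  apply: aeS (prim_ndecr_ge0 L1oo _) => // s t st.
  rewrite !poo; have c : prim (ub (u_ n)) t - prim (ub (u_ n)) s @[n --> U] --> G t - G s.
    by apply: cvgB; exact: GP.
  rewrite -subr_ge0; apply: (cvgr_to_ge c); apply: nearW => n.
  by rewrite subr_ge0; exact: prim_ub_ndecr.
have ivn n := iv _ (uP n) (Iu1 n).
have Aoo' : \int[mu]_t (uoo \_ `[0, T]) t ^+ 2 <= Au by rewrite -/(ub uoo) ubE.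
have ivoo := iv _ ooP (le_trans Aoo' AuE).
have [xioo choo fluxoo] := outflux_characteristic lC1 lp T0 rL r0 ooP ivoo K0 EK m0 m1 M1 mM.
pose Q := E * (2 / m * (4 * L * T * expR (k * T))).
have Q0 : 0 <= Q.
  by rewrite /Q !mulr_ge0 ?invr_ge0 ?expR_ge0// ltW.
have zunif e : 0 < e -> \forall n \near U, forall t, `|prim (zb (u_ n)) t - prim (zb uoo) t| <= e.
  move=> e0; have e2 : 0 < e / 2 by rewrite divr_gt0.
  have e6 : 0 < e / 6 by rewrite divr_gt0.
  have [d1 d10 hd1] := sqrt_modulus Q0 e2.
  pose dl := Num.min d1 (e / 6).
  have dl0 : 0 < dl by rewrite lt_min d10.
  apply: filterS (Gunif _ dl0) => n hn t.
  have vd s : `|prim (vin T rho0 (u_ n)) s - prim (vin T rho0 uoo) s| <= dl.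
    by rewrite (prim_vinB s (uP n) ooP) ubE poo.
  have [xin chn fluxn] := outflux_characteristic lC1 lp T0 rL r0 (uP n) (ivn n) K0 EK m0 m1 M1 mM.
  have ms := characteristic_mass_stable m0 M1 L0 mM Llip k0 kE T0' (ltW dl0) (ivn n) ivoo vd chn choo.
  have inner s : 0 < s <= T -> `|prim (zb (u_ n)) s - prim (zb uoo) s| <= e.
    move=> sT; have /andP[_ sT'] := sT.
    have Zn := prim_zb (uP n) sT fluxn; have Zoo := prim_zb ooP sT fluxoo.
    have ZE : prim (zb (u_ n)) s - prim (zb uoo) s =
        (prim (vin T rho0 (u_ n)) s - prim (vin T rho0 uoo) s) -
        (mass (vin T rho0 (u_ n)) xin s - mass (vin T rho0 uoo) xioo s).
      by rewrite [LHS](congr2 (fun x y => x - y) Zn Zoo); ring.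
    rewrite ZE; have h1 := vd s; have h2 := ms s sT'; rewrite -/Q in h2.
    have h3 : Num.sqrt (Q * dl) <= e / 2.
      by apply: hd1; rewrite (ltW dl0) /dl ge_min lexx.
    have h4 : dl <= e / 6 by rewrite /dl ge_min lexx orbT.
    apply: (le_trans (ler_normB _ _)); clear - h1 h2 h3 h4; move: h1 h2 h3 h4; lra.
  have zs v : supported 0 T (zb v) by exact: patch_supported.
  have [t0|t0] := leP t 0.
    have Zn := prim_supported_le (zbL (uP n)).1 (zs _) t0.
    have Zoo := prim_supported_le (zbL ooP).1 (zs _) t0.
    by rewrite [X in `|X|](congr2 (fun x y => x - y) Zn Zoo) subrr normr0 ltW.
  have [tT|/ltW tT] := leP t T; first by apply: inner; rewrite t0.
  have Zn := prim_supported_ge (zs (u_ n)) tT; have Zoo := prim_supported_ge (zs uoo) tT.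
  rewrite [X in `|X|](congr2 (fun x y => x - y) Zn Zoo).
  by apply: inner; rewrite T0 lexx.
have [w [Lw sw pw Aw]] := @weak_limit _ U UF (fun n => zb (u_ n)) (prim (zb uoo)) 0 T Az T0'
  (fun n => zbL (uP n)) (fun n => @patch_supported _ _ _ _) zunif (nearA _ _ IzAz).
have wz := prim_inj (L2_supported_L1 Lw sw) (zbL1 ooP) pw.
exists uoo; [exact: ooP|move=> u uP'; apply: (le_trans _ (dle u uP'))].
apply: (le_trans (lerD Aoo' _) AA); apply: (le_trans _ Aw); rewrite le_eqVlt; apply/orP; left; apply/eqP.
apply: Int_ae_eq.
- by apply: measurable_funX; exact: (zbL ooP).1.
- by apply: measurable_funX; exact: Lw.1.
- by apply: aeS wz => x ->.
Unshelve. all: by end_near. Qed.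

End Optimal.

Theorem theorem3p1 (R : realType)
    (lambda0 : R -> R)
    (lambda0_C1 : C1_on `[0, +oo[ lambda0)
    (lambda0_pos : forall w : R, 0 <= w -> 0 < lambda0 w)
    (lambda : R -> R)
    (lambda_C1 : C1_on setT lambda)
    (lambda_pos : forall w : R, 0 < lambda w)
    (lambda_extends : forall w : R, 0 <= w -> lambda w = lambda0 w)
    (T : R) (T_gt0 : 0 < T)
    (rho0 : R -> R)
    (rho0_L2 : in_Lp 2%:E `[0, 1] rho0)
    (rho0_ge0 : ae_nonneg `[0, 1] rho0)
    (yd : R -> R)
    (yd_L2 : in_Lp 2%:E `[0, T] yd) :
  exists uoo : R -> R, L2plus T uoo /\
    J lambda T rho0 yd uoo =
      ereal_inf [set J lambda T rho0 yd u | u in L2plus T].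
Proof.
have JE := J_cost lambda_C1 lambda_pos T_gt0 rho0_L2 rho0_ge0 yd_L2.
have [uoo ooP opt] := optimum_exists lambda_C1 lambda_pos T_gt0 rho0_L2 rho0_ge0 yd_L2.
exists uoo; split => //; apply/eqP; rewrite eq_le; apply/andP; split.
  apply: le_ereal_inf_tmp => _ [u uP <-]; rewrite (JE _ ooP) (JE _ uP) lee_fin.
  exact: opt.
by apply: ereal_inf_lbound; exists uoo.
Qed.
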